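(* Let $(\theta_n)_{n\in\mathbb{N}}$ be a regular sequence, let $X=T(\theta_n,S_n)_{\mathbb{N}}$ and let $\theta=\lim_n\theta_n^{1/n}$. Then: (1) For all $Y\prec X$, $\ddot{\delta}_1(Y)=\theta$. Moreover for all $\varepsilon>0$ there exists an equivalent norm $|\cdot|$ on $X$ such that $\delta_1((X,|\cdot|),(e_i))>\theta-\varepsilon$. (2) For all $Y\prec X$ and all $n\in\mathbb{N}$, $\ddot{\delta}_n(Y)=\theta^n$, and $\ddot{\delta}_\omega(Y)=0$. (3) For all $Y\prec X$, $I_\Delta(Y)=\omega$ if $\theta=1$, and $I_\Delta(Y)=1$ if $\theta<1$. (4) If $\frac{\theta_n}{\theta^n}\to0$ then $X$ is arbitrarily distortable.
   Context: $\mathbb{N}=\{1,2,\dots\}$. For $F,G\subset\mathbb{N}$, $F<G$ means $\max F<\min G$ or one of them is empty; $n\le F$ means $n\le\min F$ (or $F$ empty). Schreier families $S_\alpha$, $\alpha<\omega_1$ (fixed once and for all): $S_0=\{\{n\}:n\in\mathbb{N}\}\cup\{\emptyset\}$; $S_{\alpha+1}=\{\bigcup_{i=1}^nF_i: n\in\mathbb{N},\ n\le F_1<\dots<F_n,\ F_i\in S_\alpha\text{ for }1\le i\le n\}$; for a limit ordinal $\alpha$ a sequence of ordinals $\alpha_n\nearrow\alpha$ is chosen and $S_\alpha=\{F: n\le F\in S_{\alpha_n}\text{ for some }n\}$. A finite sequence $(E_i)_1^\ell$ of non-empty subsets of $\mathbb{N}$ is $\alpha$-admissible if $E_1<\dots<E_\ell$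 and $(\min E_i)_1^\ell\in S_\alpha$. A sequence $(\theta_n)_{n\in\mathbb{N}}$ is regular if $(\theta_n)\subset(0,1)$, $\theta_n\searrow0$ (nonincreasing with limit $0$) and $\theta_{n+m}\ge\theta_n\theta_m$ for all $n,m$; then $\theta=\lim_n\theta_n^{1/n}=\sup_n\theta_n^{1/n}$ exists. $c_{00}$ is the space of finitely supported real sequences with unit vector basis $(e_i)$; for $E\subseteq\mathbb{N}$, $Ex$ is the restriction of $x$ to $E$. $T(\theta_n,S_n)_{\mathbb{N}}$ is the completion of $c_{00}$ under the norm given implicitly by $\|x\|=\max\{\|x\|_\infty,\ \sup_{q\in\mathbb{N}}\sup\{\theta_q\sum_{i=1}^n\|E_ix\|:(E_i)_1^n\text{ is }q\text{-admissible}\}\}$; $(e_i)$ is a 1-unconditional basis of it. $(y_i)\prec(x_i)$ means $(y_i)$ (finite or infinite) is a block basis of $(x_i)$ (nonzero finite linear combinations over successive intervals of indices). $Y\prec X$ means $Y$ is an infinite dimensional (closed) subspace having a basis which is a block basis of $(e_i)$; asymptotic constants of $Y$ are computed with respect to this basis. For a basis $(x_i)$ of $Z$ and a norm $|\cdot|$ on $Z$, a finite block sequence $(y_i)_1^n\prec(x_i)$ is $\alpha$-admissible w.r.t. $(x_i)$ if $(\mathrm{ran}(y_i))_1^n$ is $\alpha$-admissible, where $\mathrm{ran}(y)$ is the smallest interval containing the support of $y$ w.r.t. $(x_i)$, and $\delta_\alpha((x_i),|\cdot|)=\sup\{\delta\ge0:|\sum_1^ny_i|\ge\delta\sum_1^n|y_i|$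 whenever $(y_i)_1^n\prec(x_i)$ is $\alpha$-admissible w.r.t. $(x_i)\}$. $\delta_\alpha((X,|\cdot|),(e_i))$ denotes this constant for the basis $(e_i)$ of $X$ and the norm $|\cdot|$. Further $\dot\delta_\alpha((x_i),|\cdot|)=\sup\{\delta_\alpha((y_i),|\cdot|):(y_i)\prec(x_i)\text{ infinite}\}$ and $\ddot\delta_\alpha(Z)=\sup\{\dot\delta_\alpha((x_i),|\cdot|):|\cdot|\text{ an equivalent norm on }Z\}$. The spectral index is $I_\Delta(Z)=\inf\{\alpha<\omega_1:\ddot\delta_\alpha(Z)<1\}$ if such $\alpha$ exists, and $\omega_1$ otherwise. For $\lambda>1$, $(X,\|\cdot\|)$ is $\lambda$-distortable if there is an equivalent norm $|\cdot|$ on $X$ such that for all $Y\prec X$, $\sup\{|y|/|z|:y,z\in Y,\ \|y\|=\|z\|=1\}\ge\lambda$. $X$ is arbitrarily distortable if it is $\lambda$-distortable for all $\lambda>1$. *)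

(* Defs.v *)
From HB Require Import structures.
From mathcomp Require Import all_boot all_order all_algebra.
From mathcomp Require Import all_classical all_reals all_analysis.
Import Order.TTheory GRing.Theory Num.Theory.
Import numFieldNormedType.Exports.

Set Implicit Arguments.
Unset Strict Implicit.
Unset Printing Implicit Defensive.

Local Open Scope classical_set_scope.
Local Open Scope ring_scope.

(* The countable ordinals are the elements of a well-order [W] of type
   omega_1, i.e. an uncountable one with countable initial segments. *)
Definition is_omega1 (d : Order.disp_t) (W : bOrderType d) : Prop :=
  [/\ well_founded (fun a b : W => (a < b)%O),
      forall a : W, countable [set b : W | (b < a)%O]
    & ~ countable [set: W]].

Section Ordinals.
Context (d : Order.disp_t) (W : bOrderType d).
Implicit Types (a b : W) (P : set W).

(* Meaningful when [P] is nonempty. *)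
Definition omin P : W := xget \bot%O [set a | P a /\ forall b, P b -> (a <= b)%O].

Definition osucc a : W := omin [set b | (a < b)%O].

Definition onat (n : nat) : W := iter n osucc \bot%O.

Definition is_limit a : Prop :=
  a <> \bot%O /\ forall b, (b < a)%O -> (osucc b < a)%O.

Definition oomega : W := omin is_limit.

(* A choice, for every limit ordinal [a], of a sequence [(fs a n)_{n >= 1}]
   increasing to [a]; the value [fs a 0] is irrelevant. *)
Definition fundamental_sequences (fs : W -> nat -> W) : Prop :=
  forall a, is_limit a ->
  [/\ forall n, (0 < n)%N -> (fs a n < a)%O,
      forall n m, (0 < n <= m)%N -> (fs a n <= fs a m)%O
    & forall b, (b < a)%O -> exists2 n, (0 < n)%N & (b < fs a n)%O].

End Ordinals.

Definition set_lt (E F : set nat) : Prop :=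
  forall i j, E i -> F j -> (i < j)%N.

(* Pairwise, so that an empty set in the middle of a sequence does not cancel
   the ordering between its neighbours. *)
Definition successive (d : Order.disp_t) (I : porderType d) (E : I -> set nat) :
    Prop :=
  forall i j, (i < j)%O -> set_lt (E i) (E j).

Definition is_least (E : set nat) (m : nat) : Prop :=
  E m /\ forall k, E k -> (m <= k)%N.

Section Schreier.
Context (d : Order.disp_t) (W : bOrderType d) (fs : W -> nat -> W).

(* Families of finite subsets of {1, 2, ...}.  In the successor case the bound
   [n <= F_1] is imposed on all the [F_i]; it follows from [n <= F_1] when [F_1]
   is nonempty. *)
Inductive schreier : W -> set nat -> Prop :=
| schreier_empty : schreier \bot%O set0
| schreier_single n : (0 < n)%N -> schreier \bot%O [set n]
| schreier_succ a n (F : 'I_n -> set nat) :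
    (0 < n)%N -> (forall i k, F i k -> (n <= k)%N) -> successive F ->
    (forall i, schreier a (F i)) ->
    schreier (osucc a) (\bigcup_i F i)
| schreier_limit a n F :
    is_limit a -> (0 < n)%N -> (forall k, F k -> (n <= k)%N) ->
    schreier (fs a n) F -> schreier a F.

(* Sequences (of basis vectors, of coordinates) and subsets of their index set
   are indexed from 0: index [k : nat] stands for the integer k + 1.  Hence the
   shift when passing to the Schreier families, which live on {1, 2, ...}. *)
Definition admissible (a : W) (l : nat) (E : 'I_l -> set nat) : Prop :=
  [/\ forall i, E i !=set0, successive E
    & schreier a [set m.+1 | m in [set m | exists i, is_least (E i) m]]].

End Schreier.

(* Only the values at n >= 1 are constrained. *)
Definition regular_seq (R : realType) (theta : nat -> R) : Prop :=
  [/\ forall n, (0 < n)%N -> 0 < theta n < 1,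
      forall n m, (0 < n <= m)%N -> theta m <= theta n,
      theta n @[n --> \oo] --> (0 : R)
    & forall n m, (0 < n)%N -> (0 < m)%N ->
        theta n * theta m <= theta (n + m)%N].

Definition root_limit (R : realType) (theta : nat -> R) : R :=
  lim (theta n `^ (n%:R)^-1 @[n --> \oo]).

Section Blocks.
Context (R : realType).
Implicit Types x : nat -> R.

Definition supp x : set nat := [set i | x i != 0].

Definition c00 : set (nat -> R) := [set x | finite_set (supp x)].

Definition ran x : set nat :=
  [set k | exists i j, [/\ supp x i, supp x j & (i <= k <= j)%N]].

Definition comb (V : lmodType R) (u : nat -> V) x : V :=
  \sum_(i \in [set: nat]) x i *: u i.

(* Coefficients of a (finite or infinite) block sequence. *)
Definition block_coefs (d : Order.disp_t) (I : porderType d)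
    (c : I -> nat -> R) : Prop :=
  [/\ forall i, c00 (c i), forall i, supp (c i) !=set0
    & successive (fun i => supp (c i))].

Definition block_basis (V : lmodType R) (u v : nat -> V) : Prop :=
  exists2 c : nat -> nat -> R, block_coefs c & forall i, v i = comb u (c i).

Definition closed_span (V : normedModType R) (u : nat -> V) : set V :=
  closure [set comb u x | x in c00].

Definition block_subspace (V : normedModType R) (e : nat -> V) (Y : set V)
    (y : nat -> V) : Prop :=
  block_basis e y /\ Y = closed_span y.

Definition equivalent_norm (V : normedModType R) (Y : set V) (p : V -> R) :
    Prop :=
  [/\ forall u v, Y u -> Y v -> p (u + v) <= p u + p v,
      forall (t : R) u, Y u -> p (t *: u) = `|t| * p u
    & exists c C : R, [/\ 0 < c, 0 < C
        & forall u, Y u -> c * `|u| <= p u <= C * `|u|]].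

End Blocks.

Section MixedTsirelson.
Context (d : Order.disp_t) (W : bOrderType d) (fs : W -> nat -> W).
Context (R : realType).

Definition tsirelson_rhs (theta : nat -> R) (N : (nat -> R) -> R)
    (x : nat -> R) : \bar R :=
  maxe (ereal_sup [set `|x i|%:E | i in [set: nat]])
       (ereal_sup [set ereal_sup [set t : \bar R |
            exists (l : nat) (E : 'I_l -> set nat),
              admissible fs (onat W q) E /\
              t = (theta q * \sum_(i < l) N (x \_ (E i)))%:E]
          | q in [set q | (0 < q)%N]]).

(* [X], with the vectors [e i], is the completion of c_00 under the norm given
   by the implicit equation: x |-> comb e x maps c_00 isometrically onto a dense
   subspace of the Banach space [X]. *)
Definition mixed_tsirelson (theta : nat -> R) (X : completeNormedModType R)
    (e : nat -> X) : Prop :=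
  (forall x, c00 x ->
     `|comb e x|%:E = tsirelson_rhs theta (fun z => `|comb e z|) x)
  /\ closed_span e = [set: X].

End MixedTsirelson.

Section Asymptotic.
Context (d : Order.disp_t) (W : bOrderType d) (fs : W -> nat -> W).
Context (R : realType) (V : normedModType R).
Implicit Types (a : W) (x : nat -> V) (p : V -> R) (Z : set V).

Definition delta a x p : \bar R :=
  ereal_sup [set dl%:E | dl in [set dl : R | 0 <= dl /\
    forall (n : nat) (c : 'I_n -> nat -> R),
      block_coefs c -> admissible fs a (fun i => ran (c i)) ->
      dl * \sum_(i < n) p (comb x (c i)) <= p (\sum_(i < n) comb x (c i))]].

Definition dot_delta a x p : \bar R :=
  ereal_sup [set delta a y p | y in [set y | block_basis x y]].

(* [x] is the given basis of [Z]. *)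
Definition ddot_delta a Z x : \bar R :=
  ereal_sup [set dot_delta a x p | p in [set p | equivalent_norm Z p]].

(* [None] stands for omega_1. *)
Definition spectral_index Z x : option W :=
  let P := [set a : W | (ddot_delta a Z x < 1)%E] in
  if `[< P !=set0 >] then Some (omin P) else None.

End Asymptotic.

Definition distortable (R : realType) (X : normedModType R) (e : nat -> X)
    (lambda : R) : Prop :=
  exists2 p : X -> R, equivalent_norm [set: X] p &
    forall (Y : set X) (y : nat -> X), block_subspace e Y y ->
      (lambda%:E <= ereal_sup [set (p w.1 / p w.2)%:E | w in
         [set w : X * X | [/\ Y w.1, Y w.2, (`|w.1| = 1)%R & (`|w.2| = 1)%R]]])%E.

Definition arbitrarily_distortable (R : realType) (X : normedModType R)
    (e : nat -> X) : Prop :=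
  forall lambda : R, 1 < lambda -> distortable e lambda.

(* Main.v *)
Require Import Defs.
From HB Require Import structures.
From mathcomp Require Import all_boot all_order all_algebra.
From mathcomp Require Import all_classical all_reals all_analysis.
From mathcomp Require Import zify ring lra.
Import Order.TTheory GRing.Theory Num.Theory.
Import numFieldNormedType.Exports.

(* Write |x|_k for the supremum of the sums of ||E_i x|| over k-admissible
   families (E_i), so that theta_k |x|_k <= ||x||.

   Lower bounds.  If r^n = theta_n, the norm sum_(k < n) r^k |x|_k satisfies a
   lower 1-estimate with constant r: passing from |.|_k to |.|_(k+1) costs a
   factor r, and theta_n |x|_n <= ||x|| = |x|_0 closes the cycle.  Lower
   estimates multiply along S_(m+n) = S_m[S_n].

   Upper bounds.  In every block subspace and for every L there is a nonzero x
   with |x|_k <= 2 theta^(-k) ||x|| for 1 <= k <= L.  Otherwise a deep average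
   w of depth D could be split repeatedly, each splitting of depth k gaining a
   factor theta^k / 2, which would give ||w|| <= (mu theta)^(D - L) + o(1) with
   a fixed mu < 1, against ||w|| >= theta_D.  Take a sequence of such vectors
   x_i for rapidly increasing L_i and an M-average w of the normalized x_i.
   If theta_q <= Phi theta^q for all q >= M, then ||w|| <= 3 Phi theta^(M-1):
   split w along the implicit equation until the depth q used so far reaches M;
   up to negligible pieces each x_i is then hit only by an S_(q-M+1)-family.

   If an equivalent norm has a lower n-estimate with constant delta, then with
   M = nk and Phi = 1 one gets delta^k <= K theta^(nk) for every k, hence
   delta <= theta^n; letting Phi theta^(M-1) tend to 0 settles the ordinal
   omega.  When theta_n / theta^n tends to 0 one may choose n with
   Phi = theta_n / theta^n small, and the norm Phi ||x|| + theta_n |x|_n is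
   comparable to theta on averages of this kind but to Phi on the vectors x_i. *)

Set Implicit Arguments.
Unset Strict Implicit.
Unset Printing Implicit Defensive.

Local Open Scope classical_set_scope.
Local Open Scope ring_scope.

(** * Schreier families of finite order *)

(** The vectors x_i answer one obstacle: a family of depth q that meets a block average spends some
    depth t < M on separating blocks and the rest, q - t, inside single blocks, where an arbitrary
    block may gain a factor up to 1 / theta_(q-t). A gain of 2 theta^(-(q-t)) is what theta_q <= Phi
    theta^q can pay for, and t <= M - 1 explains the exponent M - 1. Such control is available only
    up to a finite depth L_i; from L_(i+1) on the smallness of theta_q takes over, and the range in
    between concerns one block at a time. A second difficulty is that a family splitting the blocks
    counts the block i by its coordinates, which may be far larger than i. Averages are therefore
    made small on Schreier sets for an arbitrary counting p, while their supports stay in the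
    ordinary Schreier families. Since members of a family may end inside a block, the inductions
    bound w restricted to an arbitrary set of coordinates. The norms |.|_k live on c_00, whereas the
    theorem speaks of the completion, so the renormings have to be extended to X. *)

Section SchreierLevels.
Implicit Types (F U A : set nat) (p h g : nat -> nat).

(* The family S_n, where an index [x] counts as the integer [p x]; [p = succn]
   turns 0-based indices into the integers 1, 2, ... *)
Fixpoint Sch p n F : Prop :=
  if n is n'.+1 then
    exists m g, [/\ forall x, F x -> (g x < m <= p x)%N,
      forall x y, F x -> F y -> (x <= y)%N -> (g x <= g y)%N
      & forall i, Sch p n' [set x | F x /\ g x = i]]
  else forall x y, F x -> F y -> x = y.

Lemma Sch_sub p n F F' : F `<=` F' -> Sch p n F' -> Sch p n F.
Proof.
elim: n F F' => [|n IH] F F' FF' /=; first by move=> H x y /FF' + /FF'; exact: H.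
move=> [m [g [g1 g2 g3]]]; exists m, g; split.
- by move=> x /FF'; exact: g1.
- by move=> x y /FF' + /FF'; exact: g2.
- by move=> i; apply: IH (g3 i) => x [/FF' ? ?].
Qed.

Lemma Sch0 p n : Sch p n set0.
Proof.
elim: n => [|n IH] //=; exists 0%N, id; split=> // i.
by apply: Sch_sub IH => x [].
Qed.

Lemma Sch_S p n F : (forall x, F x -> (0 < p x)%N) -> Sch p n F -> Sch p n.+1 F.
Proof.
move=> pF SF; exists 1%N, (fun=> 0%N); split=> //.
by move=> i; apply: Sch_sub SF => x [].
Qed.

Lemma Sch_le p m n F : (forall x, F x -> (0 < p x)%N) -> (m <= n)%N ->
  Sch p m F -> Sch p n F.
Proof.
move=> pF; elim: n => [|n IH]; first by rewrite leqn0 => /eqP ->.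
rewrite leq_eqVlt => /predU1P[->//|mn SF]; apply: Sch_S => //.
exact: IH.
Qed.

(* S_m[S_n] is contained in S_(m+n); for [n = 0] this is the spreading property. *)
Lemma Sch_join p p' m n A F f : Sch p' m A ->
  (forall x, F x -> A (f x) /\ (p' (f x) <= p x)%N) ->
  (forall x y, F x -> F y -> (x <= y)%N -> (f x <= f y)%N) ->
  (forall a, Sch p n [set x | F x /\ f x = a]) ->
  Sch p (m + n) F.
Proof.
elim: m A F => [|m IH] A F /= HA H1 H2 H3.
  have [[x0 Fx0]|F0] := pselect (exists x, F x).
    apply: Sch_sub (H3 (f x0)) => x Fx /=; split=> //.
    by apply: HA; [exact: (H1 _ Fx).1|exact: (H1 _ Fx0).1].
  by apply: Sch_sub (Sch0 p n) => x Fx; case: F0; exists x.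
move: HA => [k [g [g1 g2 g3]]]; exists k, (g \o f); split.
- move=> x Fx; have [Af pf] := H1 _ Fx.
  by have /andP[-> /leq_trans ->] := g1 _ Af.
- move=> x y Fx Fy xy; apply: g2; [exact: (H1 _ Fx).1|exact: (H1 _ Fy).1|exact: H2].
- move=> i; apply: (IH _ _ (g3 i)).
  + by move=> x [Fx gi]; have [] := H1 _ Fx; split.
  + by move=> x y [Fx _] [Fy _]; exact: H2.
  + by move=> a; apply: Sch_sub (H3 a) => x [[]].
Qed.

Lemma Sch_spread p p' m A F f : Sch p' m A ->
  (forall x, F x -> A (f x) /\ (p' (f x) <= p x)%N) ->
  (forall x y, F x -> F y -> (x < y)%N -> (f x < f y)%N) ->
  Sch p m F.
Proof.
move=> SA H1 H2; rewrite -[m]addn0; apply: (Sch_join SA H1).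
  move=> x y Fx Fy; rewrite leq_eqVlt => /predU1P[->//|xy].
  exact: ltnW (H2 _ _ Fx Fy xy).
move=> a x y /= [Fx <-] [Fy]; case: (ltngtP x y) => // xy.
  by have := H2 _ _ Fx Fy xy; lia.
by have := H2 _ _ Fy Fx xy; lia.
Qed.

Lemma Sch_split p m n F : Sch p (m + n) F -> exists f,
  [/\ forall x, F x -> F (f x) /\ (f x <= x)%N,
    forall x y, F x -> F y -> (x <= y)%N -> (f x <= f y)%N,
    forall a, Sch p n [set x | F x /\ f x = a] & Sch p m (f @` F)].
Proof.
elim: m F => [|m IH] F /=.
  move=> SF; have [[x0 Fx0]|F0] := pselect (exists x, F x); last first.
    exists id; split=> //; try by move=> x Fx; case: F0; exists x.
      by move=> a; apply: Sch_sub SF => x [].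
    by move=> x y [u Fu _]; case: F0; exists u.
  have ex : exists x, `[< F x >] by exists x0; apply/asboolP.
  exists (fun=> ex_minn ex); case: ex_minnP => k /asboolP Fk kmin.
  split=> //.
  - by move=> x Fx; split=> //; apply: kmin; apply/asboolP.
  - by move=> a; apply: Sch_sub SF => x [].
  - by move=> x y [u _ <-] [v _ <-].
move=> [k [g [g1 g2 g3]]].
have /choice[f fP] : forall i, exists f : nat -> nat,
   [/\ forall x, (F x /\ g x = i) -> (F (f x) /\ g (f x) = i) /\ (f x <= x)%N,
    forall x y, F x /\ g x = i -> F y /\ g y = i -> (x <= y)%N -> (f x <= f y)%N,
    forall a, Sch p n [set x | (F x /\ g x = i) /\ f x = a] &
    Sch p m (f @` [set x | F x /\ g x = i])].
  by move=> i; exact: IH (g3 i).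
have fF x : F x -> (F (f (g x) x) /\ g (f (g x) x) = g x) /\ (f (g x) x <= x)%N.
  by move=> Fx; have [f1 _ _ _] := fP (g x); apply: f1.
exists (fun x => f (g x) x); split.
- by move=> x /fF[[]].
- move=> x y Fx Fy xy; have [f1 f2 _ _] := fP (g x).
  have := g2 _ _ Fx Fy xy; rewrite leq_eqVlt => /predU1P[gxy|gxy].
    by rewrite -gxy; apply: f2.
  have [[Ffx gfx] fx] := fF _ Fx; have [[Ffy gfy] fy] := fF _ Fy.
  apply: (leq_trans fx); case: (leqP x (f (g y) y)) => // /ltnW/(g2 _ _ Ffy Fx); lia.
- move=> a; have [[x [Fx fx]]|H] := pselect (exists x, F x /\ f (g x) x = a).
    have [_ _ f3 _] := fP (g x); apply: Sch_sub (f3 a) => y /= [Fy fy].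
    have gxy : g y = g x.
      by have [[_ <-] _] := fF _ Fy; have [[_ <-] _] := fF _ Fx; rewrite fx fy.
    by split=> //; rewrite -gxy.
  by apply: Sch_sub (Sch0 p n) => x ?; case: H; exists x.
- exists k, g; split.
  + by move=> _ [x Fx <-]; have [[Ff _] _] := fF _ Fx; apply: g1.
  + move=> _ _ [x Fx <-] [y Fy <-].
    have [[Ffx _] _] := fF _ Fx; have [[Ffy _] _] := fF _ Fy; exact: g2.
  + move=> i; have [_ _ _ f4] := fP i; apply: Sch_sub f4 => _ [[x Fx <-]].
    by have [[_ ->] _] := fF _ Fx => gi; exists x => //; rewrite gi.
Qed.

(* An n-admissible family is encoded by a monotone labelling [h] of its union
   [U], with members [piece U h a].  The labels are lower bounds of the members
   rather than their minima, so that restricting [U] keeps [h] admissible. *)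
Definition piece U h a : set nat := [set k | U k /\ h k = a].

Definition lab n U h : Prop :=
  [/\ forall x y, U x -> U y -> (x <= y)%N -> (h x <= h y)%N,
    forall x, U x -> (h x <= x)%N & Sch succn n (h @` U)].

Lemma lab_sub n U U' h : U' `<=` U -> lab n U h -> lab n U' h.
Proof.
move=> UU' [h1 h2 h3]; split.
- by move=> x y /UU' + /UU'; exact: h1.
- by move=> x /UU'; exact: h2.
- by apply: Sch_sub h3 => _ [x /UU' ? <-]; exists x.
Qed.

End SchreierLevels.

(** * Mass of a set of indices under nonnegative weights *)

Section WeightedSums.
Context (R : realType).
Implicit Types (F I : set nat) (a : nat -> R) (n : nat).

Definition wsum n a F : R := \sum_(i < n | `[< F i >]) a i.

Lemma wsumE n a F : wsum n a F = \sum_(i < n) (if `[< F i >] then a i else 0).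
Proof. by rewrite /wsum big_mkcond. Qed.

Lemma wsum_ge0 n a F : (forall i, 0 <= a i) -> 0 <= wsum n a F.
Proof. by move=> a0; apply: sumr_ge0. Qed.

Lemma wsum_set0 n a : wsum n a set0 = 0.
Proof. by rewrite wsumE big1// => i _; case: asboolP. Qed.

Lemma wsum_le_sum n a F : (forall i, 0 <= a i) -> wsum n a F <= \sum_(i < n) a i.
Proof.
move=> a0; rewrite wsumE; apply: ler_sum => i _.
by case: asboolP.
Qed.

Lemma wsum_Sch0 n a p F e : (forall i, 0 <= a i) -> (forall i, a i <= e) -> 0 <= e ->
  Sch p 0 F -> wsum n a F <= e.
Proof.
move=> a0 ae e0 SF; have [[i [Fi lin]]|H] := pselect (exists i, F i /\ (i < n)%N); last first.
  rewrite wsumE big1// => i _; case: asboolP => // Fi.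
  by case: H; exists i; split=> //; exact: ltn_ord.
rewrite wsumE (bigD1 (Ordinal lin))//= big1 ?addr0.
  by case: asboolP.
move=> j ji; case: asboolP => // Fj; case/eqP: ji.
by apply/val_inj => /=; exact: SF.
Qed.

Lemma wsum_fibers n a F (g : nat -> nat) s : (forall i, F i -> (g i < s)%N) ->
  wsum n a F = \sum_(j < s) wsum n a [set i | F i /\ g i = j].
Proof.
move=> gs; under [RHS]eq_bigr do rewrite wsumE.
rewrite exchange_big/= wsumE; apply: eq_bigr => i _.
case: asboolP => Fi.
  rewrite (bigD1 (Ordinal (gs _ Fi)))//= big1 ?addr0; first by case: asboolP => // -[].
  move=> j ji; case: asboolP => // -[_ gj]; case/eqP: ji; exact/val_inj.
by rewrite big1// => j _; case: asboolP => // -[].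
Qed.

Lemma wsum_disjoint n a B F (G : nat -> set nat) : (forall i, 0 <= a i) ->
  (forall b i, G b i -> F i) -> (forall b b' i, G b i -> G b' i -> b = b') ->
  \sum_(b < B) wsum n a (G b) <= wsum n a F.
Proof.
move=> a0 GF GG; under eq_bigr do rewrite wsumE.
rewrite exchange_big/= wsumE; apply: ler_sum => i _.
have [[b Gb]|H] := pselect (exists b : 'I_B, G b i); last first.
  rewrite big1; first by case: asboolP.
  by move=> b _; case: asboolP => // Gb; case: H; exists b.
rewrite (bigD1 b)//= big1 ?addr0; first by case: asboolP => //; case: asboolP => // ? /GF.
move=> b' bb'; case: asboolP => // Gb'; case/eqP: bb'.
by apply/val_inj; exact: GG Gb' Gb.
Qed.

Lemma wsum_widen n n' a F : (n <= n')%N -> (forall i, (n <= i)%N -> a i = 0) ->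
  wsum n' a F = wsum n a F.
Proof.
move=> nn' an; rewrite /wsum.
rewrite [RHS](big_ord_widen_cond n' (fun i => `[< F i >]) a)// [RHS]big_mkcondr/=.
by apply: eq_bigr => i _; case: (leqP n i) => [/an ->|].
Qed.

Lemma wsum_setT n a : wsum n a setT = \sum_(i < n) a i.
Proof. by rewrite wsumE; apply: eq_bigr => i _; rewrite asboolT. Qed.

Lemma wsumD n a b F : wsum n (fun i => a i + b i) F = wsum n a F + wsum n b F.
Proof. exact: big_split. Qed.

Lemma wsumZ n a c F : wsum n (fun i => c * a i) F = c * wsum n a F.
Proof. by rewrite /wsum mulr_sumr. Qed.

Lemma eq_wsum n a b F F' : (forall i, (i < n)%N -> F i <-> F' i) ->
  (forall i, (i < n)%N -> F i -> a i = b i) -> wsum n a F = wsum n b F'.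
Proof.
move=> FF' ab; rewrite !wsumE; apply: eq_bigr => i _.
have E := FF' _ (ltn_ord i).
case: asboolP => Fi; case: asboolP => F'i //; first exact: ab.
  by case: F'i; apply/E.
by case: Fi; apply/E.
Qed.

End WeightedSums.

(** * Repeated averages *)

Section Averages.
Context (R : realType).
Implicit Types (F : set nat) (p : nat -> nat) (a b : nat -> R).

Lemma wsum_Sch_le p D n a F e s : (forall i, 0 <= a i) -> 0 <= e ->
  (forall G, Sch p D G -> wsum n a G <= e) -> Sch p D.+1 F ->
  (exists2 i, F i & (p i <= s)%N) -> wsum n a F <= s%:R * e.
Proof.
move=> a0 e0 ae [m [g [g1 _ g3]]] [i Fi pis].
rewrite (@wsum_fibers _ n a F g m); last by move=> j /g1 /andP[].
have -> : s%:R * e = \sum_(j < s) e by rewrite sumr_const card_ord mulr_natl.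
have ms : (m <= s)%N by have /andP[_ /leq_trans ->] := g1 _ Fi.
apply: (@le_trans _ _ (\sum_(j < m) e)); first by apply: ler_sum => j _; exact/ae/g3.
by rewrite !sumr_const !card_ord -[leLHS]mulr_natl -[leRHS]mulr_natl ler_wpM2r ?ler_nat.
Qed.

(* A set of S_(D+1) splits into at most [p i] sets of S_D, [i] being any of its
   elements: the first average that it meets costs at most 1, and the later ones
   have been chosen after [p i] is known. *)
Lemma stack_averages p D (e : R) i0 r : 0 < e ->
  (forall (e : R) i0, 0 < e -> exists n a, [/\ forall i, 0 <= a i,
     forall i, a i != 0 -> (i0 <= i < n)%N, \sum_(i < n) a i = 1,
     Sch succn D.+1 [set i | a i != 0]
     & forall F, Sch p D F -> wsum n a F <= e]) ->
  exists n b g, [/\ forall i, 0 <= b i, forall i, b i != 0 -> (i0 <= i < n)%N,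
    \sum_(i < n) b i = r%:R,
    [/\ forall i, b i != 0 -> (g i < r)%N,
     forall i j, b i != 0 -> b j != 0 -> (i <= j)%N -> (g i <= g j)%N &
     forall k, Sch succn D.+1 [set i | b i != 0 /\ g i = k]]
    & forall F, Sch p D.+1 F -> wsum n b F <= 1 + r%:R * e].
Proof.
move=> e0 IH; elim: r => [|r [n [b [g [b0 bn b1 [g1 g2 g3] bF]]]]].
  exists 0%N, (fun=> 0), (fun=> 0%N); split=> //; rewrite ?big_ord0//.
  - by move=> i; rewrite eqxx.
  - by split=> [i|i j|k]; rewrite ?eqxx//; apply: Sch_sub (Sch0 _ _) => i [/eqP].
  - by move=> F _; rewrite /wsum big_ord0 mul0r addr0.
pose P := \max_(i < n) p i.
(* A set meeting the earlier averages contains some [i] with [p i <= P], so it has at most [P] parts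
   in the new average; this tolerance keeps their sum below [e]. *)
have e'0 : 0 < e / P.+1%:R by rewrite divr_gt0.
have [n' [a [a0 an a1 aS aF]]] := IH _ (maxn i0 n) e'0.
have bz i : (n <= i)%N -> b i = 0.
  by move=> ni; apply/eqP/negPn/negP => /bn; lia.
have az i : (n' <= i)%N -> a i = 0.
  by move=> ni; apply/eqP/negPn/negP => /an; lia.
have az' i : (i < n)%N -> a i = 0.
  by move=> ni; apply/eqP/negPn/negP => /an; lia.
have ba i : b i + a i != 0 -> if (i < n)%N then b i != 0 else a i != 0.
  by case: ltnP => ni; [rewrite az'// addr0|rewrite bz// add0r].
have na i : a i != 0 -> (n <= i)%N by move=> /an; lia.
exists (maxn n n'), (fun i => b i + a i), (fun i => if (i < n)%N then g i else r); split.
- by move=> i; rewrite addr_ge0.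
- by move=> i /ba; case: ifPn => [_ /bn|_ /an]; lia.
- rewrite big_split/= -!wsum_setT.
  rewrite (@wsum_widen _ n _ b) ?leq_maxl// (@wsum_widen _ n' _ a) ?leq_maxr//.
  by rewrite !wsum_setT b1 a1 natr1.
- split.
  + by move=> i /ba; case: ifPn => // _ /g1; lia.
  + move=> i j /ba + /ba.
    case: ifPn => // ni; case: ifPn => // nj; first exact: g2.
      by move=> /g1 /ltnW.
    by lia.
  + move=> k; have [->|kr] := eqVneq k r.
      apply: Sch_sub aS => i /= [/ba]; case: ifP => // ni /g1 + gi; lia.
    apply: Sch_sub (g3 k) => i /= [/ba]; case: ifP => // ni ? gi; last by move/eqP: kr; rewrite gi.
- move=> F SF; rewrite wsumD.
  rewrite (@wsum_widen _ n _ b) ?leq_maxl// (@wsum_widen _ n' _ a) ?leq_maxr//.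
  have [[i [Fi ni]]|H] := pselect (exists i, F i /\ (i < n)%N).
    rewrite -natr1 mulrDl mul1r addrA lerD ?bF//.
    have pi : (p i <= P)%N by exact: (@leq_bigmax _ (fun i : 'I_n => p i) (Ordinal ni)).
    apply: (le_trans (@wsum_Sch_le p D _ _ F (e / P.+1%:R) P a0 _ aF SF _)).
    - exact: ltW.
    - by exists i.
    rewrite mulrCA -[leRHS]mulr1 ler_wpM2l ?ltW// ltr_pdivrMr ?ltr0n// mul1r ltr_nat//.
  have -> : wsum n b F = 0.
    rewrite wsumE big1// => i _; case: asboolP => // Fi; case: H.
    by exists i; split=> //; exact: ltn_ord.
  rewrite add0r (le_trans (wsum_le_sum _ _ a0))// a1 lerDl mulr_ge0//; exact: ltW.
Qed.

(** Two countings occur: the support is an S_(D+1)-set for the ordinary one, so the norm of the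
    average is bounded below, while smallness is required for S_D-sets counted by [p], the ends of
    the blocks, since these describe which blocks a family can cut. *)
Lemma average p D (e : R) i0 : 0 < e -> exists n a, [/\ forall i, 0 <= a i,
  forall i, a i != 0 -> (i0 <= i < n)%N, \sum_(i < n) a i = 1,
  Sch succn D.+1 [set i | a i != 0] & forall F, Sch p D F -> wsum n a F <= e].
Proof.
elim: D e i0 => [|D IH] e i0 e0.
  have [N NP] : exists N : nat, e^-1 < N.+1%:R.
    by exists (Num.truncn e^-1); rewrite truncnS_gt.
  (* Starting at [N.+1] makes N + 1 consecutive singletons an S_1-set. *)
  pose k := maxn i0 N.+1.
  pose a i : R := if (k <= i < k + N.+1)%N then N.+1%:R^-1 else 0.
  have a0 i : 0 <= a i by rewrite /a; case: ifP; rewrite ?invr_ge0.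
  have aN i : a i != 0 -> (k <= i < k + N.+1)%N by rewrite /a; case: ifP => //; rewrite eqxx.
  exists (k + N.+1)%N, a; split=> //.
  - by move=> i /aN; lia.
  - rewrite big_split_ord/= big1 ?add0r; last first.
      by move=> i _; rewrite /a; case: ifP => //; have := ltn_ord i; lia.
    rewrite (eq_bigr (fun=> N.+1%:R^-1)).
      by rewrite sumr_const card_ord -[LHS]mulr_natl divff.
    by move=> i _; rewrite /a; case: ifP => //; have := ltn_ord i; lia.
  - exists N.+1, (fun i => i - k)%N; split.
    + by move=> i /aN; lia.
    + by move=> i j _ _; lia.
    + by move=> j x y /= [/aN ? ?] [/aN ? ?]; lia.
  - move=> F SF; apply: (wsum_Sch0 _ a0 _ _ SF); last exact: ltW.
    move=> i; rewrite /a; case: ifP => _; last exact: ltW.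
    by rewrite -[leRHS]invrK lef_pV2 ?posrE ?invr_gt0// ltW.
have [N NP] : exists N : nat, (e / 2)^-1 < N.+1%:R.
  by exists (Num.truncn (e / 2)^-1); rewrite truncnS_gt.
have e2 : 0 < e / 2 by rewrite divr_gt0.
(* The N + 1 averages start beyond [N.+1], so together they form a set of the next order; dividing
   by N + 1 turns the bound 1 + (N + 1) e / 2 into at most e / 2 + e / 2. *)
have [n [b [g [b0 bn b1 [g1 g2 g3] bF]]]] := stack_averages (maxn i0 N.+1) N.+1 e2 IH.
have N0 : 0 < N.+1%:R^-1 :> R by rewrite invr_gt0.
have bE : [set i | N.+1%:R^-1 * b i != 0] `<=` [set i | b i != 0].
  by move=> i /=; rewrite mulf_eq0 negb_or => /andP[].
exists n, (fun i => N.+1%:R^-1 * b i); split.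
- by move=> i; rewrite mulr_ge0// ltW.
- by move=> i /bE /bn; lia.
- by rewrite -mulr_sumr b1 mulVf.
- apply: Sch_sub bE _; exists N.+1, g; split.
  + by move=> i bi; rewrite g1//=; have := bn _ bi; lia.
  + exact: g2.
  + exact: g3.
- move=> F SF; rewrite wsumZ.
  apply: (@le_trans _ _ (N.+1%:R^-1 * (1 + N.+1%:R * (e / 2)))).
    by apply: ler_wpM2l; [exact: ltW|exact: bF].
  rewrite mulrDr mulr1 mulKf// [leRHS](splitr e) lerD2r.
  by rewrite -[leRHS]invrK lef_pV2 ?posrE ?invr_gt0// ltW.
Qed.

End Averages.

(** * Norms on finitely supported vectors *)

Section Norms.
Variable R : realType.
Implicit Types (x y w : nat -> R) (A I F U : set nat) (h : nat -> nat).

(** An explicit bound on the support makes all sums finite: labels are at most the points that they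
    label, so a member with label at least [B] misses the support, and sums over members run over
    [a < B]. *)
Definition bd B x : Prop := forall k, (B <= k)%N -> x k = 0.

Lemma rstE x A k : (x \_ A) k = if `[< A k >] then x k else 0.
Proof. by rewrite patchE. Qed.

Lemma rst_in x A k : A k -> (x \_ A) k = x k.
Proof. by move=> Ak; rewrite rstE asboolT. Qed.

Lemma rst_out x A k : ~ A k -> (x \_ A) k = 0.
Proof. by move=> Ak; rewrite rstE asboolF. Qed.

Lemma rst_rst x A A' : (x \_ A) \_ A' = x \_ (A `&` A').
Proof.
apply/funext => k; rewrite !rstE; case: asboolP => A'k; case: asboolP => //.
- by move=> Ak; rewrite asboolT.
- by move=> Ak; rewrite asboolF// => -[].
- by move=> [].
Qed.

Lemma eq_rst x y A A' : (forall k, x k != 0 -> A k <-> A' k) ->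
  (forall k, A' k -> x k = y k) -> x \_ A = y \_ A'.
Proof.
move=> AA' xy; apply/funext => k; rewrite !rstE.
have [xk|xk] := eqVneq (x k) 0.
  by rewrite xk if_same; case: asboolP => // /xy; rewrite xk.
have E := AA' _ xk; case: asboolP => Ak; case: asboolP => A'k //.
- exact: xy.
- by case: A'k; apply/E.
- by case: Ak; apply/E.
Qed.

Lemma rst_id x A : (forall k, x k != 0 -> A k) -> x \_ A = x.
Proof.
move=> xA; apply/funext => k; rewrite rstE; case: asboolP => // Ak.
by apply/eqP; rewrite eq_sym; apply/negPn/negP => /xA.
Qed.

Lemma bd_rst B x A : bd B x -> bd B (x \_ A).
Proof. by move=> xB k /xB xk; rewrite rstE xk if_same. Qed.

Lemma bd_le B B' x : (B <= B')%N -> bd B x -> bd B' x.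
Proof. by move=> BB' xB k kB'; apply: xB; exact: leq_trans kB'. Qed.

Lemma bd_c00 B x : bd B x -> c00 x.
Proof.
move=> xB; apply: (@sub_finite_set _ _ `I_B) (finite_II B) => k /=.
by rewrite /supp/= => xk; rewrite ltnNge; apply/negP => /xB /eqP; exact/negP.
Qed.

Lemma c00_bd x : c00 x -> exists B, bd B x.
Proof.
move=> /finite_fsetP[D DE].
exists (\max_(k <- finmap.enum_fset D) k).+1 => k kB.
apply/eqP/negPn/negP => xk; have : supp x k by [].
rewrite DE => /= kD; have := @leq_bigmax_seq _ (finmap.enum_fset D) xpredT id k kD isT.
by move=> /leq_ltn_trans/(_ kB); rewrite ltnn.
Qed.

(* [tn_coord] and [tn_adm] give one half of the implicit equation, [tn_max] the
   other half. *)
Record tnorm (theta : nat -> R) (N : (nat -> R) -> R) : Prop := TNorm {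
  tn_add : forall B x y, bd B x -> bd B y -> N (fun k => x k + y k) <= N x + N y;
  tn_scale : forall B t x, bd B x -> N (fun k => t * x k) = `|t| * N x;
  tn_coord : forall B x k, bd B x -> `|x k| <= N x;
  tn_adm : forall q U h B x, (0 < q)%N -> lab q U h -> bd B x ->
    theta q * \sum_(a < B) N (x \_ (piece U h a)) <= N x;
  tn_max : forall B x b, bd B x -> (forall k, `|x k| <= b) ->
    (forall q U h, (0 < q)%N -> lab q U h ->
       theta q * \sum_(a < B) N (x \_ (piece U h a)) <= b) -> N x <= b }.

(** [rt_pow] and [rt_app] say without roots that [th] is the supremum of theta_n^(1/n). The value 1
    at 0 lets depth 0 enter the estimates, as in [N_adm]. *)
Record regular_th (theta : nat -> R) (th : R) : Prop := RegularTh {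
  rt0 : theta 0%N = 1;
  rt_gt0 : forall n, 0 < theta n;
  rt_anti : forall n m, (n <= m)%N -> theta m <= theta n;
  rt_mul : forall n m, theta n * theta m <= theta (n + m)%N;
  rt_pow : forall n, theta n <= th ^+ n;
  rt_th0 : 0 < th;
  rt_th1 : th <= 1;
  rt_app : forall mu, 0 <= mu < 1 -> exists2 n, (0 < n)%N & (mu * th) ^+ n < theta n;
  rt_lim : forall e, 0 < e -> exists n, theta n < e }.

Context (theta : nat -> R) (th : R) (N : (nat -> R) -> R)
  (Hth : regular_th theta th) (HN : tnorm theta N).

Lemma rt_le1 n : theta n <= 1.
Proof. by rewrite -(rt0 Hth) (rt_anti Hth). Qed.

Lemma N_ge0 B x : bd B x -> 0 <= N x.
Proof. by move=> xB; exact: le_trans (normr_ge0 _) (tn_coord HN 0%N xB). Qed.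

Lemma N_zero x : (forall k, x k = 0) -> N x = 0.
Proof.
move=> x0; have xB : bd 0 x by move=> k _.
have -> : x = (fun k => 0 * x k) by apply/funext => k; rewrite mul0r.
by rewrite (tn_scale HN _ xB) normr0 mul0r.
Qed.

Lemma N_eq0 B x : bd B x -> N x = 0 -> forall k, x k = 0.
Proof.
by move=> xB x0 k; apply/eqP; rewrite -normr_le0 -x0; exact: (tn_coord HN _ xB).
Qed.

(** Both terms of the implicit equation decrease under restriction: intersecting the members with
    [A] leaves the family admissible because labels need not be minima. *)
Lemma N_restr B x A : bd B x -> N (x \_ A) <= N x.
Proof.
move=> xB; apply: (tn_max HN (bd_rst A xB)).
  move=> k; rewrite rstE; case: asboolP => _; first exact: (tn_coord HN _ xB).
  by rewrite normr0 (N_ge0 xB).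
move=> q U h q0 hU; apply: le_trans (tn_adm HN q0 (lab_sub (@subIsetl _ U A) hU) xB).
rewrite le_eqVlt; apply/predU1P; left; congr (_ * _).
apply: eq_bigr => a _; rewrite rst_rst; congr N; apply: eq_rst => //.
by move=> k _; split=> [[? [? ?]]|[[? ?] ?]].
Qed.

Lemma N_mono B x A A' : bd B x -> A `<=` A' -> N (x \_ A) <= N (x \_ A').
Proof.
move=> xB AA'; have -> : x \_ A = (x \_ A') \_ A.
  by rewrite rst_rst; congr (_ \_ _); apply/seteqP; split=> k //= => [/[dup] /AA'|[]].
exact: N_restr (bd_rst _ xB).
Qed.

Lemma N_adm q U h B x : lab q U h -> bd B x ->
  theta q * \sum_(a < B) N (x \_ (piece U h a)) <= N x.
Proof.
case: q => [|q]; last exact: tn_adm.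
move=> [_ _ /= h0] xB; rewrite (rt0 Hth) mul1r.
have [[a [k [Uk ka]]]|H] := pselect (exists a : 'I_B, exists k, U k /\ h k = a); last first.
  rewrite big1 ?(N_ge0 xB)// => a _; apply: N_zero => k; rewrite rst_out// => ?.
  by case: H; exists a, k.
rewrite (bigD1 a)//= big1 ?addr0 ?(N_restr _ xB)// => b ba.
apply: N_zero => k'; rewrite rst_out// => -[Uk' hb]; case/eqP: ba; apply/val_inj.
by rewrite /= -ka -hb; apply: h0; [exists k'|exists k].
Qed.

Lemma N_sum B n (X : 'I_n -> nat -> R) : (forall i, bd B (X i)) ->
  N (fun k => \sum_(i < n) X i k) <= \sum_(i < n) N (X i).
Proof.
elim: n X => [|n IH] X XB.
  by rewrite big_ord0 N_zero// => k; rewrite big_ord0.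
have -> : (fun k => \sum_(i < n.+1) X i k)
    = (fun k => X ord0 k + \sum_(i < n) X (lift ord0 i) k).
  by apply/funext => k; rewrite big_ord_recl.
have SB : bd B (fun k => \sum_(i < n) X (lift ord0 i) k).
  by move=> k kB; rewrite big1// => i _; exact: XB.
apply: (le_trans (tn_add HN (XB ord0) SB)).
by rewrite big_ord_recl lerD2l IH.
Qed.

Definition fib (beta : nat -> nat) i : set nat := [set k | beta k = i].

Lemma N_fibers B w A I beta : bd B w -> (forall k, (beta k <= k)%N) ->
  (forall k, A k -> I (beta k)) ->
  N (w \_ A) <= wsum B (fun i => N (w \_ (A `&` fib beta i))) I.
Proof.
move=> wB bk AI.
have -> : w \_ A = (fun k => \sum_(i < B) (if `[< I i >] then w \_ (A `&` fib beta i) else fun=> 0) k).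
  apply/funext => k; have [kB|kB] := ltnP k B; last first.
    rewrite (bd_rst A wB kB) big1// => i _; case: asboolP => // _.
    by rewrite (bd_rst _ wB kB).
  rewrite rstE; case: asboolP => Ak; last first.
    by rewrite big1// => i _; case: asboolP => // _; rewrite rst_out// => -[].
  have bB : (beta k < B)%N by exact: leq_ltn_trans kB.
  rewrite (bigD1 (Ordinal bB))//= asboolT ?rst_in//; last exact: AI.
  rewrite big1 ?addr0// => i ib; case: asboolP => // _; rewrite rst_out// => -[_ /= bi].
  by case/eqP: ib; apply/val_inj.
apply: (le_trans (@N_sum B _ _ _)).
  by move=> i; case: asboolP => // _; exact: bd_rst.
rewrite wsumE; apply: ler_sum => i _; case: asboolP => // _.
by rewrite N_zero.
Qed.

Lemma N_setU B w A A' A'' : bd B w -> A `<=` A' `|` A'' ->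
  N (w \_ A) <= N (w \_ A') + N (w \_ A'').
Proof.
move=> wB AA.
have -> : w \_ A = (fun k => (w \_ (A `&` A')) k + (w \_ (A `&` (A'' `\` A'))) k).
  apply/funext => k; rewrite !rstE; case: asboolP => Ak; last first.
    by rewrite !asboolF ?addr0// => -[].
  case: (AA _ Ak) => Hk; have [A'k|A'k] := pselect (A' k).
  - by rewrite asboolT// asboolF ?addr0// => -[_ []].
  - by [].
  - by rewrite asboolT// asboolF ?addr0// => -[_ []].
  - by rewrite asboolF ?asboolT ?add0r// => -[].
apply: (le_trans (tn_add HN (bd_rst _ wB) (bd_rst _ wB))).
apply: lerD; apply: (N_mono wB) => k; first by case.
by case=> _ [].
Qed.

End Norms.

(** * Largest mass of an S_t-set *)

Section Sigma.
Variable R : realType.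
Implicit Types (F I : set nat) (p : nat -> nat) (al : nat -> R).
Context (n : nat) (p : nat -> nat) (al : nat -> R) (al0 : forall i, 0 <= al i).

Definition ords (S : {set 'I_n}) : set nat := [set i | exists2 j, j \in S & i = j :> nat].

(** Only indices below [n] carry weight, so a maximum over the finitely many subsets of ['I_n] is
    the supremum over all S_t-sets inside [I], and it is attained. It measures the error caused by
    cut blocks. *)
Definition max_wsum t I : R :=
  \big[Num.max/0]_(S : {set 'I_n} | `[< ords S `<=` I /\ Sch p t (ords S) >]) wsum n al (ords S).

Lemma max_wsum_ge t I F : F `<=` I -> Sch p t F -> wsum n al F <= max_wsum t I.
Proof.
move=> FI SF; pose S : {set 'I_n} := finset (fun j : 'I_n => `[< F j >]).
have SF' : ords S `<=` F by move=> _ [j + ->]; rewrite inE => /asboolP.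
have -> : wsum n al F = wsum n al (ords S).
  apply: eq_wsum => // i ni; split=> [Fi|/SF'//].
  by exists (Ordinal ni) => //; rewrite inE; apply/asboolP.
apply: le_bigmax_cond; apply/asboolP; split; last exact: Sch_sub SF.
by move=> i /SF' /FI.
Qed.

Lemma max_wsum_att t I : exists F, [/\ F `<=` I, Sch p t F & max_wsum t I = wsum n al F].
Proof.
rewrite /max_wsum; elim/big_ind: _.
- by exists set0; split; [|exact: Sch0|rewrite wsum_set0].
- move=> x y [F [? ? ->]] [G [? ? ->]]; case: leP => _; first by exists G.
  by exists F.
- by move=> S /asboolP[? ?]; exists (ords S).
Qed.

Lemma max_wsum_ge0 t I : 0 <= max_wsum t I.
Proof. by have [F [_ _ ->]] := max_wsum_att t I; exact: wsum_ge0. Qed.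

Lemma max_wsum_le t t' I I' : (forall i, 0 < p i)%N -> (t <= t')%N -> I `<=` I' ->
  max_wsum t I <= max_wsum t' I'.
Proof.
move=> p0 tt' II'; have [F [FI SF ->]] := max_wsum_att t I; apply: max_wsum_ge.
  by move=> i /FI /II'.
exact: Sch_le tt' SF.
Qed.

Lemma max_wsum_bound t I e : (forall F, Sch p t F -> wsum n al F <= e) -> max_wsum t I <= e.
Proof. by move=> H; have [F [_ SF ->]] := max_wsum_att t I; exact: H. Qed.

End Sigma.

(** * Splitting a vector along an admissible family *)

Section Splitting.
Context (R : realType) (theta : nat -> R) (th : R) (N : (nat -> R) -> R).
Context (Hth : regular_th theta th) (HN : tnorm theta N).
Context (B : nat) (w : nat -> R) (wB : bd B w).
Context (beta p : nat -> nat) (bmono : forall k l, (k <= l)%N -> (beta k <= beta l)%N)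
  (bk : forall k, (beta k <= k)%N) (pb : forall k, (k < p (beta k))%N).
Implicit Types (A I F U : set nat) (h : nat -> nat).

Let al i := N (w \_ (fib beta i)).

Lemma al_ge0 i : 0 <= al i.
Proof. exact: (N_ge0 HN (bd_rst _ wB)). Qed.

(* The block [i] meets two different members of the family. *)
Definition split_by U h A i : Prop := exists k l,
  [/\ A k, A l, U k, U l & [/\ beta k = i, beta l = i & (h k < h l)%N]].

Lemma beta_lt k l : (beta k < beta l)%N -> (k < l)%N.
Proof. by case: (ltnP k l) => // /bmono; lia. Qed.

(** Send a cut block to the larger of two labels that it meets. These labels increase strictly: the
    next cut block starts with at least this label and also meets a larger one. They are at most a
    coordinate of the block, hence below [p i], and spreading applies. *)
Lemma split_by_Sch q U h A : lab q U h -> Sch p q (split_by U h A).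
Proof.
move=> [h1 h2 h3].
have /choice[f fP] : forall i, exists l, split_by U h A i -> exists k,
    [/\ U k, U l & [/\ beta k = i, beta l = i & (h k < h l)%N]].
  move=> i; have [[k [l [_ _ Uk Ul H]]]|H] := pselect (split_by U h A i).
    by exists l => _; exists k.
  by exists 0%N.
apply: (@Sch_spread p succn q _ _ (h \o f) h3).
  move=> i /fP [k [Uk Ul [bk1 bl hkl]]]; split; first by exists (f i).
  rewrite -{2}bl; have := h2 _ Ul; have := pb (f i) => /= ? ?; lia.
move=> i j /fP[k [Uk Ul [bki bl hkl]]] /fP[k' [Uk' Ul' [bk' bl' hkl']]] ij /=.
apply: leq_ltn_trans hkl'; apply: h1 => //; apply: ltnW; apply: beta_lt.
by rewrite bl bk'.
Qed.

(* The blocks cut by the family form an S_q-set and are charged to the last term;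
   every other block belongs to a single member. *)
Lemma split_sum q t U h A (c b : R) : lab q U h -> 0 <= b -> 0 <= c ->
  (forall A', A' `<=` A ->
    N (w \_ A') <= c * wsum B al (beta @` A') + b * max_wsum B p al t (beta @` A')) ->
  \sum_(a < B) N (w \_ (A `&` piece U h a)) <=
    c * wsum B al (beta @` A) + b * max_wsum B p al (q + t) (beta @` A)
    + (theta q)^-1 * max_wsum B p al q (beta @` A).
Proof.
move=> hU b0 c0 HA; have [h1 h2 h3] := hU.
pose Bad := split_by U h A.
(* The part of the member [a] lying in uncut blocks; a block occurs in at most one [G a]. *)
pose G a := [set k | [/\ A k, U k, h k = a & ~ Bad (beta k)]].
have GA a : G a `<=` A by move=> k [].
have BadA : Bad `<=` beta @` A by move=> i [k [l [Ak _ _ _ [<- _ _]]]]; exists k.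
have Guniq a a' i : (beta @` G a) i -> (beta @` G a') i -> a = a'.
  move=> [k [Ak Uk <- nb] bki] [l [Al Ul <- _] bli].
  case: (ltngtP (h k) (h l)) => // hkl; case: nb; first by exists k, l; rewrite bki bli.
  by exists l, k; rewrite bki bli.
have GAi a i : (beta @` G a) i -> (beta @` A) i by move=> [k [? _ _ _] <-]; exists k.
have step1 a : N (w \_ (A `&` piece U h a)) <= N (w \_ (G a))
    + wsum B (fun i => N (w \_ (A `&` piece U h a `&` fib beta i))) Bad.
  apply: (le_trans (N_setU HN (A' := G a)
    (A'' := (A `&` piece U h a) `&` [set k | Bad (beta k)]) wB _)).
    move=> k [Ak [Uk hk]]; have [bb|nb] := pselect (Bad (beta k)); first by right.
    by left.
  rewrite lerD2l; apply: (le_trans (N_fibers HN (I := Bad) wB bk _)).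
    by move=> k [].
  rewrite !wsumE; apply: ler_sum => i _; case: asboolP => // _.
  by apply: (N_mono HN wB) => k [[]].
apply: (le_trans (ler_sum _ (fun (a : 'I_B) _ => step1 a))); rewrite big_split/=.
apply: lerD; last first.
  have -> : \sum_(a < B) wsum B (fun i => N (w \_ (A `&` piece U h a `&` fib beta i))) Bad
     = wsum B (fun i => \sum_(a < B) N (w \_ (A `&` piece U h a `&` fib beta i))) Bad.
    by rewrite /wsum exchange_big.
  (* Inside one cut block the family is still q-admissible, so by the implicit equation its pieces
     add up to at most [al i / theta q]. *)
  apply: (@le_trans _ _ ((theta q)^-1 * wsum B al Bad)).
    rewrite -wsumZ !wsumE; apply: ler_sum => i _; case: asboolP => // _.
    rewrite ler_pdivlMl ?(rt_gt0 Hth)//.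
    apply: (le_trans _ (N_adm Hth HN (lab_sub (@subIsetl _ U A) hU)
      (bd_rst (fib beta i) wB))).
    rewrite le_eqVlt; apply/predU1P; left; congr (_ * _).
    apply: eq_bigr => a _; rewrite rst_rst; congr N; apply: eq_rst => //.
    by move=> k _; split=> [[[? [? ?]] ?]|[? [[? ?] ?]]].
  rewrite ler_wpM2l ?invr_ge0 ?(ltW (rt_gt0 Hth _))//.
  by apply: max_wsum_ge => //; exact: split_by_Sch.
apply: (le_trans (ler_sum _ (fun (a : 'I_B) _ => HA _ (GA a)))).
rewrite big_split/= -!mulr_sumr; apply: lerD.
  rewrite ler_wpM2l//; apply: (@wsum_disjoint _ _ _ _ _ (fun a => beta @` G a) al_ge0); first exact: GAi.
  exact: Guniq.
rewrite ler_wpM2l//.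
(* The S_t-sets attaining the maxima in the different members are disjoint, and the labels of the
   members organize their union as a set of S_q[S_t], hence of S_(q+t). *)
have /choice[F FP] : forall a, exists F, [/\ F `<=` beta @` G a, Sch p t F &
    max_wsum B p al t (beta @` G a) = wsum B al F].
  by move=> a; exact: max_wsum_att.
have Funiq a a' i : F a i -> F a' i -> a = a'.
  move=> Fi F'i; have [FG _ _] := FP a; have [FG' _ _] := FP a'.
  exact: Guniq (FG _ Fi) (FG' _ F'i).
rewrite (eq_bigr (fun a : 'I_B => wsum B al (F a))); last first.
  by move=> a _; have [] := FP a.
apply: (@le_trans _ _ (wsum B al [set i | exists a, F a i])).
  by apply: (@wsum_disjoint _ _ _ _ _ F al_ge0) => // a i Fi; exists a.
apply: max_wsum_ge.
  by move=> i [a]; have [+ _ _] := FP a => /[apply]; exact: GAi.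
have /choice[f fP] : forall i, exists a, (exists a, F a i) -> F a i.
  move=> i; have [[a Fa]|H] := pselect (exists a, F a i); first by exists a.
  by exists 0%N.
apply: (@Sch_join p succn q t _ _ f h3).
- move=> i /fP Fi; have [+ _ _] := FP (f i) => /(_ _ Fi)[k [Ak Uk hk _] bki].
  split; first by exists k.
  rewrite -bki; have := h2 _ Uk; have := pb k; rewrite hk bki; lia.
- move=> i j /fP Fi /fP Fj; rewrite leq_eqVlt => /predU1P[->//|ij].
  have [+ _ _] := FP (f i) => /(_ _ Fi)[k [Ak Uk <- _] bki].
  have [+ _ _] := FP (f j) => /(_ _ Fj)[l [Al Ul <- _] blj].
  by apply: h1 => //; apply: ltnW; apply: beta_lt; rewrite bki blj.
- move=> a; have [_ + _] := FP a; apply: Sch_sub => i [/fP Fi <-] //.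
Qed.

End Splitting.

(** * Block sequences *)

Lemma bernoulli (R : realType) (y : R) n : -1 <= y -> 1 + n%:R * y <= (1 + y) ^+ n.
Proof.
move=> y1; elim: n => [|n IH]; first by rewrite mul0r addr0 expr0.
rewrite exprSr -natr1; apply: (@le_trans _ _ ((1 + n%:R * y) * (1 + y))).
  have -> : (1 + n%:R * y) * (1 + y) = 1 + (n%:R + 1) * y + n%:R * y ^+ 2 by ring.
  by rewrite lerDl mulr_ge0// sqr_ge0.
by rewrite ler_wpM2r//; lra.
Qed.

Section Blocks.
Context (R : realType).

(* [beta k] is the block containing the coordinate [k], and [p i] bounds the
   coordinates of the block [i]. *)
Record block_system (v : nat -> nat -> R) (beta p : nat -> nat) : Prop := BlockSystem {
  bs_mono : forall k l, (k <= l)%N -> (beta k <= beta l)%N;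
  bs_le : forall k, (beta k <= k)%N;
  bs_lt : forall k, (k < p (beta k))%N;
  bs_pmono : forall i j, (i <= j)%N -> (p i <= p j)%N;
  bs_supp : forall i k, v i k != 0 -> beta k = i;
  bs_neq0 : forall i, exists k, v i k != 0 }.

(* The combination of the blocks [v i] with coefficients [d i]; no sum is needed
   because the blocks are disjointly supported. *)
Definition lin (v : nat -> nat -> R) (beta : nat -> nat) (d : nat -> R) : nat -> R :=
  fun k => d (beta k) * v (beta k) k.

Context (v : nat -> nat -> R) (beta p : nat -> nat) (Hv : block_system v beta p).
Implicit Types (d : nat -> R).

Lemma bd_block i : bd (p i) (v i).
Proof.
move=> k kp; apply/eqP/negPn/negP => /(bs_supp Hv) bk.
by have := bs_lt Hv k; rewrite bk; lia.
Qed.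

Lemma bd_lin n d : bd n d -> bd (p n) (lin v beta d).
Proof.
move=> dn k kp; rewrite /lin dn ?mul0r//; case: (leqP n (beta k)) => // /ltnW/(bs_pmono Hv).
by have := bs_lt Hv k; lia.
Qed.

Lemma lin_fib d i : (lin v beta d) \_ (fib beta i) = (fun k => d i * v i k).
Proof.
apply/funext => k; rewrite rstE; case: asboolP => [<-//|nb].
have [->|/(bs_supp Hv)//] := eqVneq (v i k) 0.
by rewrite mulr0.
Qed.

Lemma lin_rst d I : (lin v beta d) \_ (beta @^-1` I) = lin v beta (d \_ I).
Proof.
apply/funext => k; rewrite /lin !rstE/= /preimage/=.
by case: asboolP => _ //; rewrite mul0r.
Qed.

Lemma lab_lin n U h : lab n U h -> lab n (beta @^-1` U) (h \o beta).
Proof.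
move=> [h1 h2 h3]; split.
- by move=> i j Ui Uj ij; exact: h1 Ui Uj (bs_mono Hv ij).
- by move=> i Ui; apply: leq_trans (h2 _ Ui) (bs_le Hv i).
- by apply: Sch_sub h3 => _ [i Ui <-]; exists (beta i).
Qed.

Lemma lin_piece d U h a :
  lin v beta (d \_ (piece U h a)) = (lin v beta d) \_ (piece (beta @^-1` U) (h \o beta) a).
Proof. by rewrite -lin_rst. Qed.

Lemma lin_neq0 d i : d i != 0 -> exists k, lin v beta d k != 0.
Proof.
move=> di; have [k vk] := bs_neq0 Hv i; exists k.
by rewrite /lin (bs_supp Hv vk) mulf_neq0.
Qed.

Lemma block_system_comp ds delta q : block_system ds delta q ->
  block_system (fun i => lin v beta (ds i)) (delta \o beta) (p \o q).
Proof.
move=> Hd; split.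
- by move=> k l /(bs_mono Hv) /(bs_mono Hd).
- by move=> k; apply: leq_trans (bs_le Hd _) (bs_le Hv k).
- move=> k; apply: leq_trans (bs_lt Hv k) _; apply: (bs_pmono Hv).
  exact: ltnW (bs_lt Hd _).
- by move=> i j /(bs_pmono Hd) /(bs_pmono Hv).
- move=> i k xk; apply: (bs_supp Hd); apply: contra_neq xk => dk.
  by rewrite /lin dk mul0r.
- by move=> i; have [j dj] := bs_neq0 Hd i; exact: lin_neq0 dj.
Qed.

End Blocks.
Arguments bd_block {R v beta p} Hv i k _.

Section Nice.
Context (R : realType) (theta : nat -> R) (th : R) (N : (nat -> R) -> R).
Context (Hth : regular_th theta th) (HN : tnorm theta N).

(** The inequality |x|_k <= 2 theta^(-k) ||x|| for 1 <= k <= L. When it fails for all combinations,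
    the 2 pays both for a rate smaller than [th] and for merging the two error terms of [split_sum]
    into one. *)
Definition nice L x : Prop := forall k U h B, (0 < k <= L)%N -> lab k U h -> bd B x ->
  th ^+ k * \sum_(a < B) N (x \_ (piece U h a)) <= 2 * N x.

Lemma big_piece_le (f : (nat -> R) -> R) n U h B B' x : (forall y, (forall k, y k = 0) -> f y = 0) ->
  lab n U h -> bd B x -> (B <= B')%N ->
  \sum_(a < B) f (x \_ (piece U h a)) = \sum_(a < B') f (x \_ (piece U h a)).
Proof.
move=> f0 [_ h2 _] xB BB'; rewrite (big_ord_widen B' (fun a => f (x \_ (piece U h a))))//.
rewrite big_mkcond/=; apply: eq_bigr => a _; case: ltnP => // Ba.
rewrite f0// => k; rewrite rstE; case: asboolP => // -[Uk hk].
by apply: xB; have := h2 _ Uk; lia.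
Qed.

Lemma big_piece (f : (nat -> R) -> R) n U h B B' x : (forall y, (forall k, y k = 0) -> f y = 0) ->
  lab n U h -> bd B x -> bd B' x ->
  \sum_(a < B) f (x \_ (piece U h a)) = \sum_(a < B') f (x \_ (piece U h a)).
Proof.
move=> f0 hU xB xB'; have [BB'|BB'] := leqP B B'; first exact: big_piece_le hU xB BB'.
by rewrite -(big_piece_le f0 hU xB' (ltnW BB')).
Qed.

Lemma theta_mulX n k : theta n ^+ k <= theta (n * k)%N.
Proof.
elim: k => [|k IH]; first by rewrite muln0 (rt0 Hth) expr0.
rewrite exprSr mulnS addnC; apply: le_trans (rt_mul Hth _ _).
by rewrite ler_pM2r ?(rt_gt0 Hth).
Qed.

(** Choose mu < nu < 1 and [n] with (nu th)^n < theta_n. Supermultiplicativity keeps theta_(nm)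
    above (nu th)^(nm), and the quotient (nu / mu)^(nm) exceeds [c] for large m by Bernoulli's
    inequality. *)
Lemma theta_app mu c : 0 < mu < 1 -> exists D, c * (mu * th) ^+ D.+1 < theta D.+1.
Proof.
move=> /andP[mu0 mu1]; pose nu := (mu + 1) / 2.
have nu0 : mu < nu by rewrite /nu; lra.
have [|n n0 nP] := rt_app Hth (mu := nu); first by rewrite /nu; lra.
have th0 := rt_th0 Hth.
pose q := nu / mu.
have q1 : 0 < q - 1 by rewrite subr_gt0 /q ltr_pdivlMr// mul1r.
have bern k : 1 + k%:R * (q - 1) <= q ^+ k.
  by have := bernoulli k (y := q - 1); rewrite subrKC; apply; lra.
pose m := (Num.truncn (c / (q - 1))).+1.
have cm : c < 1 + m%:R * (q - 1).
  have : c / (q - 1) < m%:R by rewrite truncnS_gt.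
  by rewrite ltr_pdivrMr//; lra.
have nm : (n * m = (n * m).-1.+1)%N by rewrite prednK// muln_gt0 n0.
exists (n * m).-1; rewrite -nm; apply: lt_le_trans (theta_mulX _ _).
apply: (@lt_trans _ _ (((nu * th) ^+ n) ^+ m)); last first.
  rewrite ltr_pXn2r// nnegrE ?(ltW (rt_gt0 Hth _))// exprn_ge0//.
  by rewrite mulr_ge0// ltW// (lt_trans mu0).
rewrite -exprM; have -> : nu * th = q * (mu * th).
  by rewrite /q; field; rewrite gt_eqF.
rewrite [ltRHS]exprMn ltr_pM2r ?exprn_gt0 ?mulr_gt0//.
apply: lt_le_trans cm _; apply: le_trans (bern m) _.
by rewrite ler_weXn2l ?leq_pmull//; lra.
Qed.

Lemma half_pow L : exists mu : R, [/\ 0 < mu, mu < 1 & 2^-1 <= mu ^+ L].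
Proof.
have x1 : L.+1%:R^-1 <= 1 :> R by rewrite invf_le1// ler1n.
have Lx : L%:R * L.+1%:R^-1 <= 1 :> R by rewrite ler_pdivrMr// mul1r ler_nat.
have x0 : 0 < L.+1%:R^-1 :> R by rewrite invr_gt0.
move: L.+1%:R^-1 x0 x1 Lx => x x0 x1 Lx; pose mu : R := 1 - x / 2.
exists mu; split; try by rewrite /mu; lra.
by apply: le_trans (bernoulli L _); lra.
Qed.

End Nice.

(** * Vectors that do not gain by splitting *)

Section NiceVectors.
Context (R : realType) (theta : nat -> R) (th : R) (N : (nat -> R) -> R).
Context (Hth : regular_th theta th) (HN : tnorm theta N).
Context (v : nat -> nat -> R) (beta p : nat -> nat) (Hv : block_system v beta p).

Lemma N_block_gt0 i : 0 < N (v i).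
Proof.
rewrite lt_neqAle (N_ge0 HN (bd_block Hv i)) andbT eq_sym; apply/eqP => vi.
by have [k] := bs_neq0 Hv i; rewrite (N_eq0 HN (bd_block Hv i) vi) eqxx.
Qed.

Lemma nice_vector L J : exists n d, [/\ bd n d, forall j, d j != 0 -> (J <= j)%N,
  exists j, d j != 0 & nice th N L (lin v beta d)].
Proof.
apply: contrapT => Hn.
have H n d : bd n d -> (forall j, d j != 0 -> (J <= j)%N) -> (exists j, d j != 0) ->
    exists k U h B, [/\ (0 < k <= L)%N, lab k U h, bd B (lin v beta d)
    & 2 * N (lin v beta d) < th ^+ k * \sum_(a < B) N (lin v beta d \_ (piece U h a))].
  move=> dn dJ d0; apply: contrapT => H; apply: Hn; exists n, d; split=> //.
  move=> k U h B kL hU xB; rewrite leNgt; apply/negP => ?.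
  by apply: H; exists k, U, h, B.
have th0 := rt_th0 Hth; have th1 := rt_th1 Hth.
have [mu [mu0 mu1 muL]] := half_pow R L.
have muth0 : 0 < mu * th by rewrite mulr_gt0.
have muth1 : mu * th <= 1 by rewrite mulr_ile1// ltW.
(* Normalized so that [C t >= 1] for t <= L, where the triangle inequality suffices. As mu^k >= 1/2
   for k <= L, one gets th^k C(t-k) / 2 <= C t, which is one step of the induction below. *)
pose C t := (mu * th) ^+ t / (mu * th) ^+ L.
have C0 t : 0 <= C t by rewrite divr_ge0// exprn_ge0// ltW.
have [D HD] := theta_app Hth (2 / (mu * th) ^+ L / (mu * th)) (introT andP (conj mu0 mu1)).
have CD : 2 * C D < theta D.+1.
  apply: le_lt_trans HD; rewrite exprS le_eqVlt; apply/predU1P; left; rewrite /C.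
  by field; rewrite expf_neq0 ?andbT ?gt_eqF.
(* The error term becomes theta_(D+1) / 4, and twice [C D] is below theta_(D+1), so the upper bound
   stays under the lower bound theta_(D+1). *)
pose e := theta D.+1 * theta L / 4.
have e0 : 0 < e by rewrite divr_gt0// mulr_gt0// (rt_gt0 Hth).
have [n [a [a0 an a1 aS aF]]] := average p D J e0.
have az i : (n <= i)%N -> a i = 0.
  by move=> ni; apply/eqP/negPn/negP => /an/andP[_]; rewrite ltnNge ni.
pose d i := a i / N (v i).
have dn : bd n d by move=> i /az ai; rewrite /d ai mul0r.
have da i : d i != 0 -> a i != 0 by apply: contra_neq => ai; rewrite /d ai mul0r.
pose w := lin v beta d; pose B := maxn n (p n).
have wB : bd B w by apply: bd_le (bd_lin Hv dn); exact: leq_maxr.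
pose al i := N (w \_ (fib beta i)).
have alE i : al i = a i.
  rewrite /al (lin_fib Hv) (tn_scale HN _ (bd_block Hv i)) ger0_norm; last first.
    by rewrite divr_ge0// ltW// N_block_gt0.
  by rewrite /d divfK// gt_eqF// N_block_gt0.
have al0 i : 0 <= al i by rewrite alE.
have alF F : wsum B al F = wsum n a F.
  rewrite -(wsum_widen F (leq_maxl n (p n)) az).
  by apply: eq_wsum => // i _ _; exact: alE.
have p0 i : (0 < p i)%N.
  apply: leq_trans (bs_pmono Hv (leq0n i)); have := bs_lt Hv 0.
  by have := bs_le Hv 0; rewrite leqn0 => /eqP ->.
have sg0 t I : 0 <= max_wsum B p al t I by exact: max_wsum_ge0.
have tL0 : 0 < (theta L)^-1 by rewrite invr_gt0 (rt_gt0 Hth).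
(* Here [t] is the depth still available. Each splitting of depth k <= L lowers it by k, and the
   induction stops once t <= L. *)
have T t A : N (w \_ A) <= C t * wsum B al (beta @` A) + (theta L)^-1 * max_wsum B p al t (beta @` A).
  elim/ltn_ind: t A => t IH A.
  have [tL|Lt] := leqP t L.
    apply: (@le_trans _ _ (wsum B al (beta @` A))); last first.
      apply: ler_wpDr; first by rewrite mulr_ge0// ltW.
      rewrite ler_peMl// ?wsum_ge0//.
      by rewrite /C ler_pdivlMr ?exprn_gt0// mul1r ler_wiXn2l// ltW.
    apply: le_trans (N_fibers HN (I := beta @` A) wB (bs_le Hv) _) _.
      by move=> k Ak; exists k.
    rewrite !wsumE; apply: ler_sum => i _; case: asboolP => // _.
    by apply: (N_mono HN wB) => k [].
  pose I := beta @` A; pose A1 := beta @^-1` I.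
  have AA1 : A `<=` A1 by move=> k Ak; exists k.
  have A1I : beta @` A1 = I by apply/seteqP; split=> [_ [k ? <-]//|_ [k Ak <-]]; exists k => //; exact: AA1.
  apply: le_trans (N_mono HN wB AA1) _.
  have RHS0 : 0 <= C t * wsum B al I + (theta L)^-1 * max_wsum B p al t I.
    by apply: addr_ge0; apply: mulr_ge0 => //; [exact: wsum_ge0|exact: ltW].
  have A1E : w \_ A1 = lin v beta (d \_ I) by rewrite lin_rst.
  have [d0|d0] := pselect (exists j, (d \_ I) j != 0); last first.
    rewrite A1E (N_zero HN)// => k; rewrite /lin.
    have -> : (d \_ I) (beta k) = 0 by apply/eqP/negPn/negP => ?; apply: d0; exists (beta k).
    by rewrite mul0r.
  have dI j : (d \_ I) j != 0 -> (J <= j)%N.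
    by rewrite rstE; case: ifP; rewrite ?eqxx// => _ /da /an /andP[].
  have [k [U [h [B' [/andP[k0 kL] hU xB' lt]]]]] := H _ _ (bd_rst I dn) dI d0.
  move: lt; rewrite (big_piece (f := N) _ hU xB' (bd_le (leq_maxr n _) (bd_lin Hv (bd_rst I dn)))); last first.
    by move=> y; exact: (N_zero HN).
  rewrite -A1E -/B; under eq_bigr do rewrite rst_rst.
  move=> lt.
  have kt : (k <= t)%N by exact: leq_trans kL (ltnW Lt).
  have tkt : (t - k < t)%N by rewrite ltn_subrL k0 (leq_trans k0).
  have := @split_sum _ theta th N Hth HN B w wB beta p (bs_mono Hv) (bs_le Hv) (bs_lt Hv)
     k (t - k)%N U h A1 (C (t - k)%N) (theta L)^-1 hU (ltW tL0) (C0 _)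
     (fun A' _ => IH (t - k)%N tkt A').
  rewrite A1I subnKC//.
  rewrite -/al => ss.
  have thk0 : 0 < th ^+ k by rewrite exprn_gt0.
  have thk1 : th ^+ k <= 1 by rewrite exprn_ile1// ltW.
  have Ck : 2^-1 * th ^+ k * C (t - k)%N <= C t.
    rewrite /C mulrA ler_pM2r ?invr_gt0 ?exprn_gt0//.
    have -> : (mu * th) ^+ t = mu ^+ k * th ^+ k * (mu * th) ^+ (t - k)%N.
      by rewrite -exprMn -exprD subnKC.
    rewrite ler_pM2r ?exprn_gt0// ler_pM2r//.
    by apply: le_trans muL _; rewrite ler_wiXn2l// ltW.
  have sk : max_wsum B p al k I <= max_wsum B p al t I by exact: max_wsum_le.
  have tk : (theta k)^-1 <= (theta L)^-1.
    by rewrite lef_pV2 ?posrE ?(rt_gt0 Hth)//; apply: rt_anti Hth _ _ kL.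
  (* The two error terms are now equal; the 2 on the left halves their sum, so that errors do not
     accumulate along the induction. *)
  have {lt ss} : 2 * N (w \_ A1) <= th ^+ k * (C (t - k)%N * wsum B al I +
      (theta L)^-1 * max_wsum B p al t I + (theta L)^-1 * max_wsum B p al t I).
    apply: le_trans (ltW lt) _; rewrite ler_pM2l//; apply: le_trans ss _.
    rewrite lerD2l; apply: ler_pM => //; rewrite invr_ge0; exact: ltW (rt_gt0 Hth _).
  have W0 : 0 <= wsum B al I by exact: wsum_ge0.
  have S0 : 0 <= (theta L)^-1 * max_wsum B p al t I by rewrite mulr_ge0// ltW.
  have := ler_wpM2r W0 Ck.
  have := ler_wpM2r S0 thk1; rewrite mul1r.
  set X1 := (theta L)^-1 * _; set X2 := wsum _ _ _.
  have -> : 2^-1 * th ^+ k * C (t - k)%N * X2 = 2^-1 * (th ^+ k * C (t - k)%N * X2) by ring.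
  have -> : th ^+ k * (C (t - k)%N * X2 + X1 + X1) = th ^+ k * C (t - k)%N * X2 + 2 * (th ^+ k * X1) by ring.
  lra.
have := T D setT.
rewrite rst_id//.
have low : theta D.+1 <= N w.
  pose U := [set k | d (beta k) != 0].
  have hU : lab D.+1 U beta.
    split; [by move=> x y _ _; exact: bs_mono Hv _ _|by move=> x _; exact: bs_le Hv _|].
    by apply: Sch_sub aS => _ [k Uk <-]; exact: da.
  apply: le_trans (N_adm Hth HN hU wB).
  have -> : \sum_(i < B) N (w \_ (piece U beta i)) = 1.
    rewrite -a1 -!wsum_setT -alF wsum_setT; apply: eq_bigr => i _.
    congr N; apply: eq_rst => // k wk; split=> [[]//|bi]; split=> //.
    by apply: contra_neq wk => dk; rewrite /w /lin dk mul0r.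
  by rewrite mulr1.
have up1 : wsum B al (beta @` setT) <= 1.
  by rewrite alF -a1; exact: wsum_le_sum.
have up2 : max_wsum B p al D (beta @` setT) <= e by apply: max_wsum_bound => F SF; rewrite alF aF.
have H1 : C D * wsum B al (beta @` setT) <= C D by rewrite ler_piMr.
have H2 : (theta L)^-1 * max_wsum B p al D (beta @` setT) <= theta D.+1 / 4.
  apply: (@le_trans _ _ ((theta L)^-1 * e)); first by rewrite ler_pM2l.
  by rewrite /e -mulrA mulrCA mulKf// gt_eqF// (rt_gt0 Hth).
have := rt_gt0 Hth D.+1; lra.
Qed.

End NiceVectors.

(** * Rapidly increasing sequences *)

Section RapidlyIncreasing.
Context (R : realType) (theta : nat -> R) (th : R) (N : (nat -> R) -> R).
Context (Hth : regular_th theta th) (HN : tnorm theta N).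
Context (B : nat) (w : nat -> R) (wB : bd B w).
Context (beta p : nat -> nat) (bmono : forall k l, (k <= l)%N -> (beta k <= beta l)%N)
  (bk : forall k, (beta k <= k)%N) (pb : forall k, (k < p (beta k))%N)
  (p0 : forall i, (0 < p i)%N).
Context (L : nat -> nat) (Lmono : forall i j, (i <= j)%N -> (L i <= L j)%N).
Context (M : nat) (eta Phi : R) (eta0 : 0 <= eta) (Phi0 : 0 <= Phi).
Context (HPhi : forall q, (M <= q)%N -> theta q <= Phi * th ^+ q).
Implicit Types (A I F U : set nat) (h : nat -> nat).

Let al i := N (w \_ (fib beta i)).

Context (Hnice : forall i k U h, (0 < k <= L i)%N -> lab k U h ->
  th ^+ k * \sum_(a < B) N ((w \_ (fib beta i)) \_ (piece U h a)) <= 2 * al i).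
Context (Hbig : forall i q U h, (L i.+1 <= q)%N -> lab q U h ->
  theta q * \sum_(a < B) N ((w \_ (fib beta i)) \_ (piece U h a)) <= eta * al i).

Let C := eta + 2 * Phi * th ^+ M.-1.

(* Write S_q = S_t[S_(q-t)].  The blocks cut by the S_t-part form an S_t-set; at
   most one block has [L i < q < L i.+1]; any other block is hit by a single
   S_(q-t)-family, to which [Hnice] or [Hbig] applies. *)
Lemma ris_top t q U h A : (t < M)%N -> (t < q)%N -> lab q U h ->
  theta (M - t.+1)%N * (theta q * \sum_(a < B) N ((w \_ A) \_ (piece U h a))) <=
  C * wsum B al (beta @` A) + 2 * max_wsum B p al t (beta @` A).
Proof.
move=> tM tq hU; have [h1 h2 h3] := hU.
have th0 := rt_th0 Hth.
have al0 i : 0 <= al i by exact: (N_ge0 HN (bd_rst _ wB)).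
pose S i := \sum_(a < B) N ((w \_ (fib beta i)) \_ (piece (U `&` A) h a)).
have S0 i : 0 <= S i.
  by apply: sumr_ge0 => a _; exact: (N_ge0 HN (bd_rst _ (bd_rst _ wB))).
have qE : (q = t + (q - t))%N by rewrite subnKC// ltnW.
have qt0 : (0 < q - t)%N by rewrite subn_gt0.
have [g [g1 g2 g3 g4]] : exists f,
  [/\ forall x, (h @` U) x -> (h @` U) (f x) /\ (f x <= x)%N,
    forall x y, (h @` U) x -> (h @` U) y -> (x <= y)%N -> (f x <= f y)%N,
    forall a, Sch succn (q - t) [set x | (h @` U) x /\ f x = a] &
    Sch succn t (f @` (h @` U))] by apply: Sch_split; rewrite -qE.
have hU' : lab t U (g \o h).
  split.
  - by move=> x y Ux Uy xy; apply: g2; [exists x|exists y|exact: h1].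
  - move=> x Ux; have [_ gx] := g1 (h x) (ex_intro2 _ _ x Ux erefl).
    exact: leq_trans gx (h2 _ Ux).
  - by apply: Sch_sub g4 => _ [x Ux <-]; exists (h x) => //; exists x.
pose Bad := split_by beta U (g \o h) A.
pose Ex := [set i | (beta @` A) i /\ (L i < q < L i.+1)%N].
have BadS : Sch p t Bad by exact: split_by_Sch hU'.
have ExS : Sch p t Ex.
  apply: (@Sch_le p 0) => // i j [_ ip] [_ jp].
  case: (ltngtP i j) => // /Lmono; move: ip jp => /andP[? ?] /andP[? ?] ?; lia.
pose kap := theta (M - t.+1)%N * theta q.
have kap0 : 0 <= kap by rewrite mulr_ge0// ltW// (rt_gt0 Hth).
have kapq : kap <= theta q by rewrite ler_piMl ?(rt_le1 Hth)// ltW// (rt_gt0 Hth).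
have Sq i : theta q * S i <= al i.
  by apply: (N_adm Hth HN (lab_sub (@subIsetl _ U A) hU) (bd_rst (fib beta i) wB)).
have kS i : kap * S i <= al i.
  by apply: le_trans (Sq i); rewrite ler_wpM2r.
have C0 : 0 <= C by rewrite addr_ge0// !mulr_ge0// exprn_ge0// ltW.
have key i : kap * S i <= C * al i + (if `[< Bad i >] then al i else 0)
    + (if (L i < q < L i.+1)%N then al i else 0).
  have Cal : 0 <= C * al i by rewrite mulr_ge0.
  case: asboolP => nB.
    apply: le_trans (kS i) _; rewrite -addrA addrCA lerDl addr_ge0//.
    by case: ifP.
  case: ifPn => [_|].
    by apply: le_trans (kS i) _; rewrite addr0 lerDr.
  rewrite !addr0 negb_and -!leqNgt => H.
  have [Lq|qL] := leqP (L i.+1) q.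
    apply: (@le_trans _ _ (theta q * S i)); first by rewrite ler_wpM2r.
    apply: le_trans (Hbig Lq (lab_sub (@subIsetl _ U A) hU)) _.
    by rewrite ler_wpM2r// lerDl !mulr_ge0// exprn_ge0// ltW.
  have qLi : (q - t <= L i)%N by move: H; rewrite (leqNgt (L i.+1)) qL/= orbF; apply: leq_trans; exact: leq_subr.
  pose U' := U `&` A `&` fib beta i.
  have hU1 : lab (q - t) U' h.
    split.
    - by move=> x y [[Ux _] _] [[Uy _] _]; exact: h1.
    - by move=> x [[Ux _] _]; exact: h2.
    - have [[x0 [[Ux0 Ax0] bx0]]|H0] := pselect (exists x, U' x).
        apply: Sch_sub (g3 (g (h x0))) => _ [x [[Ux Ax] bx] <-]; split; first by exists x.
        case: (ltngtP (g (h x)) (g (h x0))) => // ltg; case: nB.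
          by exists x, x0.
        by exists x0, x.
      by apply: Sch_sub (Sch0 _ _) => y [x Ux _]; case: H0; exists x.
  have qq : (0 < q - t <= L i)%N by rewrite qt0.
  have := @Hnice i (q - t)%N U' h qq hU1.
  have -> : \sum_(a < B) N ((w \_ (fib beta i)) \_ (piece U' h a)) = S i.
    apply: eq_bigr => a _; rewrite !rst_rst; congr N; apply: eq_rst => // k _.
    by split=> [[? [[[? ?] ?] ?]]|[? [[? ?] ?]]].
  move=> nS.
  (* The total depth M - t - 1 + q is at least M because t < q, so the hypothesis on theta applies
     and leaves exactly the th^(q-t) required by niceness. *)
  have kapP : kap <= Phi * th ^+ M.-1 * th ^+ (q - t).
    apply: le_trans (rt_mul Hth _ _) _; rewrite -mulrA -exprD.
    have -> : (M.-1 + (q - t) = M - t.+1 + q)%N by lia.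
    by apply: HPhi; lia.
  apply: (@le_trans _ _ (Phi * th ^+ M.-1 * (2 * al i))).
    apply: (@le_trans _ _ (Phi * th ^+ M.-1 * (th ^+ (q - t) * S i))).
      by rewrite mulrA ler_wpM2r.
    by rewrite ler_wpM2l// mulr_ge0// exprn_ge0// ltW.
  have -> : Phi * th ^+ M.-1 * (2 * al i) = 2 * Phi * th ^+ M.-1 * al i by ring.
  by rewrite ler_wpM2r// lerDr.
rewrite mulrA -/kap.
apply: (@le_trans _ _ (wsum B (fun i => kap * S i) (beta @` A))).
  rewrite wsumZ ler_wpM2l//.
  have -> : wsum B S (beta @` A) = \sum_(a < B) wsum B
      (fun i => N ((w \_ (fib beta i)) \_ (piece (U `&` A) h a))) (beta @` A).
    by rewrite /wsum exchange_big.
  apply: ler_sum => a _; rewrite rst_rst.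
  apply: le_trans (N_fibers HN (I := beta @` A) wB bk _) _.
    by move=> k [Ak _]; exists k.
  rewrite !wsumE; apply: ler_sum => i _; case: asboolP => // _.
  rewrite le_eqVlt; apply/predU1P; left; rewrite rst_rst; congr N; apply: eq_rst => // k _.
  by split=> [[[? [? ?]] ?]|[? [[? ?] ?]]].
apply: (@le_trans _ _ (C * wsum B al (beta @` A) + wsum B al Bad + wsum B al Ex)).
  rewrite -wsumZ !wsumE -!big_split/=; apply: ler_sum => i _.
  have BA : Bad i -> (beta @` A) i by move=> [k [l [Ak _ _ _ [<- _ _]]]]; exists k.
  case: (asboolP ((beta @` A) i)) => Ai; last first.
    rewrite asboolF; last by move=> /BA.
    by rewrite asboolF ?addr0// => -[].
  apply: le_trans (key i) _; rewrite lerD2l.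
  by case: ifPn => H; [rewrite asboolT|case: asboolP].
rewrite -addrA lerD2l [2]mulr2n mulrDl mul1r lerD//; apply: max_wsum_ge => //.
  by move=> i [k [l [Ak _ _ _ [<- _ _]]]]; exists k.
by move=> i [].
Qed.

(** The prefactor is the discount for the depth M - 1 - t already spent: by supermultiplicativity a
    splitting of depth q <= t turns it into the prefactor for t - q, while q > t is the case of
    [ris_top]. Each splitting costs one more [max_wsum] and lowers t by at least 1, hence a
    coefficient growing linearly in t. *)
Lemma ris_le t A : (t < M)%N ->
  theta (M - t.+1)%N * N (w \_ A) <=
  C * wsum B al (beta @` A) + (t%:R + 3) * max_wsum B p al t (beta @` A).
Proof.
have th0 := rt_th0 Hth.
have al0 i : 0 <= al i by exact: (N_ge0 HN (bd_rst _ wB)).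
have C0 : 0 <= C by rewrite addr_ge0// !mulr_ge0// exprn_ge0// ltW.
elim/ltn_ind: t A => t IH A tM.
set RHS := leRHS.
have W0 I : 0 <= wsum B al I by exact: wsum_ge0.
have S0 s I : 0 <= max_wsum B p al s I by exact: max_wsum_ge0.
have t0 : 0 < theta (M - t.+1)%N by rewrite (rt_gt0 Hth).
have t1 : theta (M - t.+1)%N <= 1 by rewrite (rt_le1 Hth).
(* Coordinates are dominated by the norm of their block, and a single block is an S_0-set. *)
rewrite -ler_pdivlMl//; apply: (tn_max HN (bd_rst A wB)).
  move=> k; rewrite ler_pdivlMl//.
  apply: (@le_trans _ _ `|(w \_ A) k|); first by rewrite ler_piMl.
  rewrite rstE; case: asboolP => Ak; last first.
    by rewrite normr0 addr_ge0// mulr_ge0// addr_ge0.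
  have [kB|Bk] := ltnP k B; last first.
    by rewrite wB// normr0 addr_ge0// mulr_ge0// addr_ge0.
  have wk : `|w k| <= al (beta k).
    have := tn_coord HN k (bd_rst (fib beta (beta k)) wB).
    by rewrite rst_in.
  apply: le_trans wk _.
  have F1 : wsum B al [set beta k] = al (beta k).
    have bB : (beta k < B)%N by exact: leq_ltn_trans (bk k) kB.
    rewrite wsumE (bigD1 (Ordinal bB))//= asboolT// big1 ?addr0// => i ib.
    rewrite asboolF// => /= ibk; case/eqP: ib; exact/val_inj.
  have : al (beta k) <= max_wsum B p al t (beta @` A).
    rewrite -F1; apply: max_wsum_ge; first by move=> _ ->; exists k.
    by apply: (@Sch_le p 0) => // x y -> ->.
  move=> H; apply: le_trans H _; apply: ler_wpDl; first by rewrite mulr_ge0.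
  by rewrite ler_peMl//; have : 0 <= t%:R :> R by []; lra.
move=> q U h q0 hU; rewrite ler_pdivlMl//.
have [tq|qt] := ltnP t q.
  apply: le_trans (ris_top A tM tq hU) _; rewrite lerD2l ler_wpM2r//.
  by have : 0 <= t%:R :> R by []; lra.
have qt1 : (t - q < t)%N by rewrite ltn_subrL q0 (leq_trans q0).
have qtM : (t - q < M)%N by exact: ltn_trans tM.
pose s := theta (M - (t - q).+1)%N.
have s0 : 0 < s by rewrite (rt_gt0 Hth).
have kap : theta (M - t.+1)%N * theta q <= s.
  apply: le_trans (rt_mul Hth _ _) _; rewrite /s.
  by rewrite (_ : (M - t.+1 + q = M - (t - q).+1)%N)//; lia.
have IH' A' : N (w \_ A') <= (C / s) * wsum B al (beta @` A') +
    (((t - q)%:R + 3) / s) * max_wsum B p al (t - q) (beta @` A').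
  have := IH _ qt1 A' qtM; rewrite -/s -ler_pdivlMl//.
  by rewrite mulrDr !mulrA ![s^-1 * _]mulrC.
have b0 : 0 <= ((t - q)%:R + 3) / s by rewrite divr_ge0 ?addr_ge0// ltW.
have c0 : 0 <= C / s by rewrite divr_ge0// ltW.
have := @split_sum _ theta th N Hth HN B w wB beta p bmono bk pb
     q (t - q)%N U h A _ _ hU b0 c0 (fun A' _ => IH' A').
rewrite subnKC// -/al.
under eq_bigr do rewrite -rst_rst.
set X := \sum_(a < B) _ => HX.
have X0 : 0 <= X.
  by apply: sumr_ge0 => a _; exact: (N_ge0 HN (bd_rst _ (bd_rst _ wB))).
have sq : max_wsum B p al q (beta @` A) <= max_wsum B p al t (beta @` A) by exact: max_wsum_le.
have tq0 : 0 < theta q by rewrite (rt_gt0 Hth).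
have HX1 : theta (M - t.+1)%N * (theta q * X) <=
   C * wsum B al (beta @` A) + ((t - q)%:R + 3) * max_wsum B p al t (beta @` A)
   + max_wsum B p al q (beta @` A).
  rewrite mulrA; set kp := _ * theta q.
  have kp0 : 0 <= kp by rewrite mulr_ge0// ltW.
  apply: le_trans (ler_wpM2l kp0 HX) _.
  rewrite !mulrDr; apply: lerD; first apply: lerD.
  - rewrite mulrA ler_wpM2r// mulrCA ler_piMr// ler_pdivrMr// mul1r//.
  - rewrite mulrA ler_wpM2r// mulrCA ler_piMr ?addr_ge0// ler_pdivrMr// mul1r//.
  - rewrite mulrA ler_piMl// /kp -mulrA divff ?mulr1// gt_eqF//.
apply: le_trans HX1 _.
have qt' : (t - q)%:R + 1 <= t%:R :> R by rewrite natr1 ler_nat.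
rewrite /RHS -addrA lerD2l; apply: (@le_trans _ _ (((t - q)%:R + 3 + 1) * max_wsum B p al t (beta @` A))).
  by rewrite [leRHS]mulrDl mul1r lerD2l.
by rewrite ler_wpM2r//; lra.
Qed.

End RapidlyIncreasing.

(** Gaps must be assigned as well, since every coordinate needs a block: those below [P 0] go to
    block 0, and otherwise [delta k] is the interval containing [k]. *)
Lemma interval_blocks (P : nat -> nat) : (forall i, (P i < P i.+1)%N) ->
  exists delta, [/\ forall k l, (k <= l)%N -> (delta k <= delta l)%N,
    forall k, (delta k <= k)%N, forall k, (k < P (delta k).+1)%N
    & forall i k, (P i <= k < P i.+1)%N -> delta k = i].
Proof.
move=> PS.
have Pmono i j : (i <= j)%N -> (P i <= P j)%N.
  elim: j => [|j IH]; first by rewrite leqn0 => /eqP ->.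
  rewrite leq_eqVlt => /predU1P[->//|/IH/leq_trans]; apply; exact: ltnW.
have kP k : (k < P k.+1)%N.
  elim: k => [|k IH]; first exact: leq_ltn_trans (PS 0%N).
  exact: leq_ltn_trans IH (PS _).
have ex k : exists i, (k < P i.+1)%N by exists k.
exists (fun k => ex_minn (ex k)); split.
- move=> k l kl; case: ex_minnP => i _ imin; case: ex_minnP => j lj _.
  exact: imin (leq_ltn_trans kl lj).
- by move=> k; case: ex_minnP => i _; apply.
- by move=> k; case: ex_minnP.
- move=> i k /andP[ik ki]; case: ex_minnP => j kj jmin.
  apply/eqP; rewrite eqn_leq jmin//= leqNgt; apply/negP => /Pmono; lia.
Qed.

(** * Averages of rapidly increasing sequences have small norm *)

Section UpperEstimate.
Context (R : realType) (theta : nat -> R) (th : R) (N : (nat -> R) -> R).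
Context (Hth : regular_th theta th) (HN : tnorm theta N).

Definition slow (eta : R) L x : Prop := forall q U h B, (L <= q)%N -> lab q U h -> bd B x ->
  theta q * \sum_(a < B) N (x \_ (piece U h a)) <= eta * N x.

Lemma rst_scale (c : R) (x : nat -> R) (A : set nat) : (fun k => c * x k) \_ A = (fun k => c * (x \_ A) k).
Proof. by apply/funext => k; rewrite !rstE; case: asboolP => // _; rewrite mulr0. Qed.

Lemma big_scale (c : R) B0 x U h B : bd B0 x ->
  \sum_(a < B) N ((fun k => c * x k) \_ (piece U h a)) =
  `|c| * \sum_(a < B) N (x \_ (piece U h a)).
Proof.
move=> xB; rewrite mulr_sumr; apply: eq_bigr => a _.
by rewrite rst_scale (tn_scale HN _ (bd_rst _ xB)).
Qed.

Lemma bd_scaleK (c : R) B x : c != 0 -> bd B (fun k => c * x k) -> bd B x.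
Proof.
by move=> c0 xB k /xB /eqP; rewrite mulf_eq0 (negbTE c0) => /eqP.
Qed.

Lemma nice_scale c L x B0 : bd B0 x -> nice th N L x -> nice th N L (fun k => c * x k).
Proof.
move=> xB xn k U h B kL hU cxB.
have [c0|c0] := eqVneq c 0.
  rewrite [N _](N_zero HN); last by move=> j; rewrite c0 mul0r.
  rewrite big1 ?mulr0// => a _; apply: (N_zero HN) => j.
  by rewrite rst_scale c0 mul0r.
rewrite (big_scale _ _ _ _ xB) (tn_scale HN _ xB) mulrCA [leRHS]mulrCA ler_pM2l ?normr_gt0//.
by apply: xn => //; exact: bd_scaleK cxB.
Qed.

Lemma slow_scale c eta L x B0 : bd B0 x -> slow eta L x -> slow eta L (fun k => c * x k).
Proof.
move=> xB xn k U h B kL hU cxB.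
have [c0|c0] := eqVneq c 0.
  rewrite [N _](N_zero HN); last by move=> j; rewrite c0 mul0r.
  rewrite big1 ?mulr0// => a _; apply: (N_zero HN) => j.
  by rewrite rst_scale c0 mul0r.
rewrite (big_scale _ _ _ _ xB) (tn_scale HN _ xB) mulrCA [leRHS]mulrCA ler_pM2l ?normr_gt0//.
by apply: xn => //; exact: bd_scaleK cxB.
Qed.

(** At most [B] members meet the support, so the sum is at most [B * N x], and theta_q tends to
    0. *)
Lemma slow_ex eta B x L : 0 < eta -> bd B x -> exists2 L', (L <= L')%N & slow eta L' x.
Proof.
move=> eta0 xB; have [|n nP] := rt_lim Hth (e := eta / B.+1%:R); first by rewrite divr_gt0.
exists (maxn L n); first exact: leq_maxl.
move=> q U h B' Lq hU xB'; rewrite (big_piece _ hU xB' xB); last by move=> y; exact: (N_zero HN).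
have N0 := N_ge0 HN xB.
apply: (@le_trans _ _ (theta q * (B%:R * N x))).
  apply: ler_wpM2l; first exact: ltW (rt_gt0 Hth _).
  apply: (@le_trans _ _ (\sum_(a < B) N x)); first by apply: ler_sum => a _; exact: (N_restr HN _ xB).
  by rewrite sumr_const card_ord mulr_natl.
rewrite mulrA ler_wpM2r//.
have tq : theta q <= eta / B.+1%:R.
  by apply: le_trans (ltW nP); apply: (rt_anti Hth); apply: leq_trans Lq; exact: leq_maxr.
apply: (@le_trans _ _ (eta / B.+1%:R * B%:R)); first by rewrite ler_wpM2r.
rewrite mulrAC ler_pdivrMr//; apply: ler_wpM2l; first exact: ltW.
by rewrite ler_nat.
Qed.

Context (v : nat -> nat -> R) (beta p : nat -> nat) (Hv : block_system v beta p).

Lemma rapidly_increasing eta J : 0 < eta -> exists (P L : nat -> nat) (d : nat -> nat -> R),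
  [/\ P 0%N = J, forall i j, d i j != 0 -> (P i <= j < P i.+1)%N,
    forall i, exists j, d i j != 0, forall i, (L i <= L i.+1)%N
    & forall i, nice th N (L i) (lin v beta (d i)) /\ slow eta (L i.+1) (lin v beta (d i))].
Proof.
move=> eta0.
have /choice[f fP] : forall s : nat * nat, exists r : nat * (nat -> R) * nat,
   [/\ bd r.1.1 r.1.2, forall j, r.1.2 j != 0 -> (s.1 <= j)%N, exists j, r.1.2 j != 0,
     (s.2 <= r.2)%N & nice th N s.2 (lin v beta r.1.2) /\ slow eta r.2 (lin v beta r.1.2)].
  move=> [J' L]; have [n [d [dn dJ d0 nd]]] := nice_vector Hth HN Hv L J'.
  have [L' LL' sl] := slow_ex L eta0 (bd_lin Hv dn).
  by exists (n, d, L').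
(* The state holds the first free index and the current depth. The next depth is chosen after the
   vector, so that the vector is slow from there on, and the following vector must be nice up to
   it. *)
pose st i := iter i (fun s => ((f s).1.1, (f s).2)) (J, 0%N).
exists (fun i => (st i).1), (fun i => (st i).2), (fun i => (f (st i)).1.2); split=> //.
- move=> i j dj; have [H1 H2 _ _ _] := fP (st i); rewrite H2//= ltnNge.
  by apply/negP => /H1 /eqP; exact/negP.
- by move=> i; have [] := fP (st i).
- by move=> i; have [] := fP (st i).
- by move=> i; have [] := fP (st i).
Qed.

(** The vector is the average [w] written in terms of the given blocks, with the supports of the x_i
    as members. [J] allows it to start arbitrarily far out, which membership in S_omega will
    require. *)
Lemma upper_estimate J M Phi : (0 < M)%N -> 0 < Phi ->
  (forall q, (M <= q)%N -> theta q <= Phi * th ^+ q) ->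
  exists n d h, [/\ bd n d, forall j, d j != 0 -> (J <= j)%N,
    lab M [set j | d j != 0] h,
    \sum_(a < n) N (lin v beta (d \_ (piece [set j | d j != 0] h a))) = 1
    & N (lin v beta d) <= 3 * Phi * th ^+ M.-1].
Proof.
case: M => // M _ Phi0 HPhi /=.
pose X := Phi * th ^+ M.
have X0 : 0 < X by rewrite mulr_gt0// exprn_gt0// (rt_th0 Hth).
have X2 : 0 < X / 2 by rewrite divr_gt0.
have [P [L [ds [PJ dP d0 LS dnice]]]] := rapidly_increasing J X2.
have PS i : (P i < P i.+1)%N by have [j /dP /andP[]] := d0 i; exact: leq_ltn_trans.
have Pmono i j : (i <= j)%N -> (P i <= P j)%N.
  elim: j => [|j IH]; first by rewrite leqn0 => /eqP ->.
  rewrite leq_eqVlt => /predU1P[->//|/IH/leq_trans]; apply; exact: ltnW.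
have iP i : (i <= P i)%N by elim: i => // i /leq_ltn_trans; apply.
have Lmono i j : (i <= j)%N -> (L i <= L j)%N.
  elim: j => [|j IH]; first by rewrite leqn0 => /eqP ->.
  by rewrite leq_eqVlt => /predU1P[->//|/IH/leq_trans]; apply.
have [delta [dmono dle dlt dE]] := interval_blocks PS.
have dsb i : bd (P i.+1) (ds i).
  move=> j Pj; apply/eqP/negPn/negP => /dP /andP[_]; by rewrite ltnNge Pj.
pose x i := lin v beta (ds i).
pose beta2 k := delta (beta k); pose p2 i := p (P i.+1).
have Hd : block_system ds delta (P \o succn).
  by split=> // i j; [move=> ij; exact: Pmono|move=> dij; exact/dE/dP].
have Hx : block_system x beta2 p2 by exact: block_system_comp Hd.
(* With eta = X / 2, [ris_le] yields (X / 2 + 2 X) times the mass, at most 1, plus (M + 3) e = X /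
   2, in total 3 X. Here [M] is one less than in the statement, so the average has its support in
   the family of the stated order. *)
pose e := X / 2 / (M%:R + 3).
have M3 : 0 < M%:R + 3 :> R by rewrite ltr_wpDl.
have e0 : 0 < e by rewrite divr_gt0.
have [n [a [a0 an a1 aS aF]]] := average p2 M 0 e0.
have az i : (n <= i)%N -> a i = 0.
  by move=> ni; apply/eqP/negPn/negP => /an/andP[_]; rewrite ltnNge ni.
pose c i := a i / N (x i).
have ca i : c i != 0 -> a i != 0 by apply: contra_neq => ai; rewrite /c ai mul0r.
have cn : bd n c by move=> i /az ai; rewrite /c ai mul0r.
pose w := lin x beta2 c; pose B := maxn n (p2 n).
have wB : bd B w by apply: bd_le (bd_lin Hx cn); exact: leq_maxr.
pose al i := N (w \_ (fib beta2 i)).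
have alE i : al i = a i.
  rewrite /al (lin_fib Hx) (tn_scale HN _ (bd_block Hx i)) ger0_norm; last first.
    by rewrite divr_ge0// ltW// (N_block_gt0 HN Hx).
  by rewrite /c divfK// gt_eqF// (N_block_gt0 HN Hx).
have alF F : wsum B al F = wsum n a F.
  rewrite -(wsum_widen F (leq_maxl n (p2 n)) az).
  by apply: eq_wsum => // i _ _; exact: alE.
have p0 i : (0 < p2 i)%N.
  apply: leq_trans (bs_pmono Hx (leq0n i)); have := bs_lt Hx 0.
  by have := bs_le Hx 0; rewrite leqn0 => /eqP ->.
have Hnice i k U h : (0 < k <= L i)%N -> lab k U h ->
    th ^+ k * \sum_(a < B) N ((w \_ (fib beta2 i)) \_ (piece U h a)) <= 2 * al i.
  move=> kL hU; have bb := bd_rst (fib beta2 i) wB; move: bb.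
  rewrite /al (lin_fib Hx) => bb.
  exact: (nice_scale (c := c i) (bd_block Hx i) (dnice i).1 kL hU bb).
have Hbig i q U h : (L i.+1 <= q)%N -> lab q U h ->
    theta q * \sum_(a < B) N ((w \_ (fib beta2 i)) \_ (piece U h a)) <= X / 2 * al i.
  move=> kL hU; have bb := bd_rst (fib beta2 i) wB; move: bb.
  rewrite /al (lin_fib Hx) => bb.
  exact: (slow_scale (c := c i) (bd_block Hx i) (dnice i).2 kL hU bb).
have ub := @ris_le R theta th N Hth HN B w wB beta2 p2 (bs_mono Hx) (bs_le Hx) (bs_lt Hx) p0
  L Lmono M.+1 (X / 2) Phi (ltW X2) (ltW Phi0) HPhi Hnice Hbig M setT (ltnSn M).
pose d := lin ds delta c.
have dw : lin v beta d = w.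
  by apply/funext => k; rewrite /lin/= /d /lin /w /lin/= /x /lin mulrA.
have dsupp j : d j != 0 -> c (delta j) != 0 /\ (P (delta j) <= j < P (delta j).+1)%N.
  by rewrite mulf_eq0 negb_or => /andP[? /dP].
exists (P n), d, delta; split.
- move=> j Pj; apply/eqP/negPn/negP => /dsupp [cj /andP[_ jP]].
  have /andP[_ jn] := an _ (ca _ cj).
  by have := Pmono _ _ jn; rewrite leqNgt (leq_ltn_trans Pj jP).
- move=> j /dsupp [_ /andP[+ _]]; apply: leq_trans.
  by rewrite -PJ Pmono.
- split; first by move=> k l _ _; exact: dmono.
    by move=> k _; exact: dle.
  by apply: Sch_sub aS => _ [j /dsupp[/ca ? _] <-].
- transitivity (\sum_(i < P n) a i).
    apply: eq_bigr => i _; rewrite -alE /al -lin_rst dw; congr N.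
    apply: eq_rst => // k wk; split=> [[]//|bi]; split=> //=.
    by move: wk; rewrite -dw {1}/lin mulf_eq0 negb_or => /andP[].
  by rewrite -a1 -!wsum_setT (wsum_widen _ (iP n) az).
- rewrite dw; move: ub; rewrite subnn (rt0 Hth) mul1r rst_id// => ub.
  apply: le_trans ub _.
  have H1 : wsum B al (beta2 @` setT) <= 1 by rewrite alF -a1; exact: wsum_le_sum.
  have H2 : max_wsum B p2 al M (beta2 @` setT) <= e.
    by apply: max_wsum_bound => F SF; rewrite alF aF.
  have C0 : 0 <= X / 2 + 2 * Phi * th ^+ M by rewrite -mulrA addr_ge0 ?(ltW X2)// mulr_ge0// ltW.
  apply: (@le_trans _ _ ((X / 2 + 2 * Phi * th ^+ M) + X / 2)); last first.
    rewrite -[2 * Phi * _]mulrA -[3 * Phi * _]mulrA -/X.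
    by move: (X) => Y; lra.
  apply: lerD; first by rewrite ler_piMr.
  apply: (@le_trans _ _ ((M%:R + 3) * e)); first by rewrite ler_wpM2l// ltW.
  by rewrite /e mulrC divfK// gt_eqF.
Qed.

End UpperEstimate.

(** * The norms |x|_k and lower estimates *)

(* Replacing the labels by the minima makes it possible to concatenate
   labellings of successive sets. *)
Lemma lab_normalize n U h : lab n U h -> exists h', [/\ lab n U h',
  forall x, U x -> [/\ U (h' x), h (h' x) = h x & h' (h' x) = h' x]
  & forall x, U x -> piece U h' (h' x) = piece U h (h x)].
Proof.
move=> [h1 h2 h3].
have /choice[f fP] : forall x, exists y, U x -> [/\ U y, h y = h x, (y <= x)%N &
    forall z, U z -> h z = h x -> (y <= z)%N].
  move=> x; have [Ux|nU] := pselect (U x); last by exists 0%N.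
  have ex : exists y, `[< U y /\ h y = h x >] by exists x; apply/asboolP.
  exists (ex_minn ex) => _; case: ex_minnP => y /asboolP[Uy hy] ymin.
  split=> //; first by apply: ymin; apply/asboolP.
  by move=> z Uz hz; apply: ymin; apply/asboolP.
have fE x y : U x -> U y -> h x = h y -> f x = f y.
  move=> Ux Uy xy; have [Ufx hfx _ fx] := fP _ Ux; have [Ufy hfy _ fy] := fP _ Uy.
  by apply/eqP; rewrite eqn_leq fx ?hfy// fy ?hfx.
exists f; split; first split.
- move=> x y Ux Uy xy; have [Ufx hfx fx _] := fP _ Ux; have [Ufy hfy _ _] := fP _ Uy.
  have := h1 _ _ Ux Uy xy; rewrite leq_eqVlt => /predU1P[/fE ->//|hxy].
  apply: (leq_trans fx); rewrite leqNgt; apply/negP => /ltnW/(h1 _ _ Ufy Ux).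
  by rewrite hfy leqNgt hxy.
- by move=> x /fP[].
- apply: (Sch_spread (f := h) h3).
    move=> _ [x Ux <-]; have [Ufx hfx _ _] := fP _ Ux.
    by split; [exists (f x)|exact: h2].
  move=> _ _ [x Ux <-] [y Uy <-] fxy.
  have [Ufx hfx _ _] := fP _ Ux; have [Ufy hfy _ _] := fP _ Uy.
  have := h1 _ _ Ufx Ufy (ltnW fxy); rewrite leq_eqVlt => /predU1P[|//].
  by rewrite hfx hfy => /(fE _ _ Ux Uy) fE'; move: fxy; rewrite fE' ltnn.
- move=> x Ux; have [Ufx hfx _ _] := fP _ Ux; split=> //; exact: fE.
- move=> x Ux; apply/seteqP; split=> y [Uy] yx; split=> //.
    have [_ <- _ _] := fP _ Ux; rewrite -yx; by have [_ -> _ _] := fP _ Uy.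
  exact: fE.
Qed.

Section AveragedNorms.
Context (R : realType) (theta : nat -> R) (th : R) (N : (nat -> R) -> R).
Context (Hth : regular_th theta th) (HN : tnorm theta N).
Implicit Types (U : set nat) (h : nat -> nat) (x : nat -> R).

(** The bound [B] is quantified so that it is not an argument of the norm; by [big_piece] the sum
    does not depend on its choice. *)
Definition Nk k x : R := sup [set s | exists U h B, [/\ lab k U h, bd B x
  & s = \sum_(a < B) N (x \_ (piece U h a))]].

Lemma lab_set0 k h : lab k set0 h.
Proof. by split=> //; apply: Sch_sub (Sch0 _ _) => x [y]. Qed.

Lemma Nk_has_sup k B x : bd B x -> has_sup [set s | exists U h B, [/\ lab k U h, bd B x
  & s = \sum_(a < B) N (x \_ (piece U h a))]].
Proof.
move=> xB; split.
  by exists (\sum_(a < B) N (x \_ (piece set0 id a))), set0, id, B; split=> //; exact: lab_set0.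
exists (N x / theta k) => _ [U [h [B' [hU xB' ->]]]].
by rewrite ler_pdivlMr ?(rt_gt0 Hth)// mulrC; exact: N_adm Hth HN _ _ _ _ _ hU xB'.
Qed.

Lemma Nk_ub k U h B x : lab k U h -> bd B x -> \sum_(a < B) N (x \_ (piece U h a)) <= Nk k x.
Proof.
move=> hU xB; apply: sup_upper_bound; first exact: Nk_has_sup xB.
by exists U, h, B.
Qed.

Lemma Nk_le k B x b : bd B x ->
  (forall U h, lab k U h -> \sum_(a < B) N (x \_ (piece U h a)) <= b) -> Nk k x <= b.
Proof.
move=> xB H; apply: ge_sup; first by case: (Nk_has_sup k xB).
move=> _ [U [h [B' [hU xB' ->]]]].
by rewrite (big_piece _ hU xB' xB); [exact: H|move=> y; exact: (N_zero HN)].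
Qed.

Lemma Nk_ge0 k B x : bd B x -> 0 <= Nk k x.
Proof.
move=> xB; apply: le_trans (Nk_ub (lab_set0 k id) xB).
by apply: sumr_ge0 => a _; exact: (N_ge0 HN (bd_rst _ xB)).
Qed.

Lemma Nk_theta k B x : bd B x -> theta k * Nk k x <= N x.
Proof.
move=> xB; rewrite -ler_pdivlMl ?(rt_gt0 Hth)//; apply: (Nk_le xB) => U h hU.
by rewrite ler_pdivlMl ?(rt_gt0 Hth)//; exact: N_adm Hth HN _ _ _ _ _ hU xB.
Qed.

Lemma Nk_zero k x : (forall j, x j = 0) -> Nk k x = 0.
Proof.
move=> x0; have xB : bd 0 x by move=> j _.
apply/eqP; rewrite eq_le (Nk_ge0 _ xB) andbT; apply: (Nk_le xB) => U h _.
by rewrite big_ord0.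
Qed.

Lemma lab_const k U : lab k U (fun=> 0%N).
Proof.
split=> //; apply: (@Sch_le _ 0) => // _ _ [x _ <-] [y _ <-] //.
Qed.

Lemma Nk_ge k B x : bd B x -> N x <= Nk k x.
Proof.
case: B => [|B] xB.
  rewrite (N_zero HN); first exact: Nk_ge0 xB.
  by move=> j; exact: xB.
apply: le_trans (Nk_ub (lab_const k setT) xB).
rewrite big_ord_recl rst_id//= lerDl; apply: sumr_ge0 => a _.
exact: (N_ge0 HN (bd_rst _ xB)).
Qed.

Lemma Nk_add k B x y : bd B x -> bd B y -> Nk k (fun j => x j + y j) <= Nk k x + Nk k y.
Proof.
move=> xB yB; have xyB : bd B (fun j => x j + y j) by move=> j jB; rewrite xB// yB// addr0.
apply: (Nk_le xyB) => U h hU.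
apply: (le_trans _ (lerD (Nk_ub hU xB) (Nk_ub hU yB))).
rewrite -big_split/=; apply: ler_sum => a _.
apply: (le_trans _ (tn_add HN (bd_rst _ xB) (bd_rst _ yB))).
rewrite le_eqVlt; apply/predU1P; left; congr N; apply/funext => j.
by rewrite !rstE; case: asboolP => // _; rewrite addr0.
Qed.

Lemma Nk_scale_le k B t x : bd B x -> Nk k (fun j => t * x j) <= `|t| * Nk k x.
Proof.
move=> xB; have txB : bd B (fun j => t * x j) by move=> j jB; rewrite xB// mulr0.
apply: (Nk_le txB) => U h hU.
by rewrite (big_scale HN _ _ _ _ xB) ler_wpM2l//; exact: Nk_ub.
Qed.

Lemma Nk_scale k B t x : bd B x -> Nk k (fun j => t * x j) = `|t| * Nk k x.
Proof.
move=> xB; have txB : bd B (fun j => t * x j) by move=> j jB; rewrite xB// mulr0.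
apply/eqP; rewrite eq_le (Nk_scale_le _ _ xB)/=.
have [->|t0] := eqVneq t 0.
  by rewrite normr0 mul0r (Nk_ge0 _ (B := B))// => j _; rewrite mul0r.
have := Nk_scale_le k t^-1 txB.
rewrite normfV -ler_pdivrMl ?invr_gt0 ?normr_gt0// invrK.
apply: le_trans; rewrite ler_wpM2l// le_eqVlt; apply/predU1P; left.
by congr (Nk k _); apply/funext => j; rewrite mulKf.
Qed.

(** A nonzero piece with label [a] reappears unchanged under a new label [c], its representative,
    which is below [B]. The double sum in the proof pairs [a] with [c]; each [c] has only one
    partner, [h c]. *)
Lemma big_normalize n U h h' B x : lab n U h -> lab n U h' -> bd B x ->
  (forall k, U k -> [/\ U (h' k), h (h' k) = h k & h' (h' k) = h' k]) ->
  (forall k, U k -> piece U h' (h' k) = piece U h (h k)) ->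
  \sum_(a < B) N (x \_ (piece U h a)) <= \sum_(a < B) N (x \_ (piece U h' a)).
Proof.
move=> hU [h1' h2' _] xB Uh hE.
have N0 A : 0 <= N (x \_ A) by exact: (N_ge0 HN (bd_rst _ xB)).
apply: (@le_trans _ _ (\sum_(a < B) \sum_(c < B)
    if `[< U c /\ h c = a >] && (h' c == c) then N (x \_ (piece U h' c)) else 0)).
  apply: ler_sum => a _; have [[k [Uk hk xk]]|H] := pselect (exists k, [/\ U k, h k = a & x k != 0]).
    have kB : (k < B)%N by rewrite ltnNge; apply/negP => /xB /eqP; exact/negP.
    have cB : (h' k < B)%N by apply: leq_ltn_trans kB; exact: h2'.
    have [Uhk hhk hhk'] := Uh _ Uk.
    rewrite (bigD1 (Ordinal cB))//= hhk hhk' eqxx andbT asboolT//.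
    rewrite (hE _ Uk) hk lerDl; apply: sumr_ge0 => c _; by case: ifP.
  rewrite (N_zero HN); first by apply: sumr_ge0 => c _; case: ifP.
  move=> k; have [xk|xk] := eqVneq (x k) 0; first by rewrite rstE xk if_same.
  rewrite rst_out// => -[Uk hk]; apply: H; exists k; split=> //.
rewrite exchange_big/=; apply: ler_sum => c _.
have [[a ha]|H] := pselect (exists a : 'I_B, h c = a); last first.
  rewrite big1// => a _; case: asboolP => //= -[_ ha]; case: H; by exists a.
rewrite (bigD1 a)//= big1 ?addr0; first by case: ifP.
move=> b ba; case: asboolP => //= -[_ hb]; case/eqP: ba; apply/val_inj => /=.
by rewrite -ha -hb.
Qed.

(** An S_1-family of S_k-families has order k + 1 once the inner labels are representatives: the new
    label of a point lies in the same outer member as the point, so different outer members never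
    share a label and [h] recovers the outer member from it, as [Sch_join] needs. *)
Lemma big_concat k U h B x (V : nat -> set nat) (g : nat -> nat -> nat) :
  lab 1 U h -> bd B x -> (forall k, x k != 0 -> U k) -> (forall a, lab k (V a) (g a)) ->
  \sum_(a < B) \sum_(b < B) N ((x \_ (piece U h a)) \_ (piece (V a) (g a) b)) <= Nk k.+1 x.
Proof.
move=> hU xB xU gV; have [h1 h2 h3] := hU.
pose V' a := V a `&` piece U h a.
have gV' a : lab k (V' a) (g a) by exact: lab_sub (@subIsetl _ _ _) (gV a).
have /choice[f fP] : forall a, exists h' : nat -> nat, [/\ lab k (V' a) h',
  forall j, V' a j -> [/\ V' a (h' j), g a (h' j) = g a j & h' (h' j) = h' j]
  & forall j, V' a j -> piece (V' a) h' (h' j) = piece (V' a) (g a) (g a j)].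
  by move=> a; have [h' H] := lab_normalize (gV' a); exists h'.
pose H j := f (h j) j; pose W := [set j | V' (h j) j].
have WU j : W j -> U j by case=> _ [].
have HW j : W j -> [/\ W (H j), h (H j) = h j & (H j <= j)%N].
  move=> Wj; have [[_ f2 _] + _] := fP (h j) => /(_ _ Wj)[Vf _ _].
  have [_ [_ hf]] := Vf; split=> //; last exact: f2.
  by rewrite /W/= /H hf.
have labW : lab k.+1 W H.
  split.
  - move=> i j Wi Wj ij; have := h1 _ _ (WU _ Wi) (WU _ Wj) ij.
    rewrite leq_eqVlt => /predU1P[hij|hij].
      rewrite /H -hij; have [[f1 _ _] _ _] := fP (h i); apply: f1 => //.
      by rewrite hij.
    have [_ _ Hi] := HW _ Wi; have [WHj hHj _] := HW _ Wj.
    apply: leq_trans Hi _; rewrite leqNgt; apply/negP => /ltnW/(h1 _ _ (WU _ WHj) (WU _ Wi)).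
    by rewrite hHj leqNgt hij.
  - by move=> j /HW[].
  - rewrite -add1n; apply: (Sch_join (f := h) h3).
    + move=> _ [j Wj <-]; have [WHj hHj _] := HW _ Wj.
      by split; [exists (H j) => //; exact: WU|exact/h2/WU].
    + move=> _ _ [i Wi <-] [j Wj <-]; have [WHi _ _] := HW _ Wi; have [WHj _ _] := HW _ Wj.
      by apply: h1; exact: WU.
    + move=> a; have [[_ _ f3] _ _] := fP a; apply: Sch_sub f3 => _ [[j Wj <-]].
      have [_ -> _] := HW _ Wj => ha; exists j; last by rewrite /H ha.
      by rewrite -ha.
apply: le_trans _ (Nk_ub labW xB).
apply: (@le_trans _ _ (\sum_(a < B) \sum_(b < B) N ((x \_ (piece U h a)) \_ (piece (V' a) (f a) b)))).
  apply: ler_sum => a _; have [fa1 fa2 fa3] := fP a.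
  apply: le_trans (big_normalize (gV' a) fa1 (bd_rst (piece U h a) xB) fa2 fa3).
  rewrite le_eqVlt; apply/predU1P; left; apply: eq_bigr => b _.
  by congr N; apply: eq_rst => // j; rewrite rstE; case: asboolP => [Uj _|_ /eqP//];
    split=> [[? ?]|[[? ?] ?]].
rewrite exchange_big/=; apply: ler_sum => b _.
have N0 A : 0 <= N (x \_ A) by exact: (N_ge0 HN (bd_rst _ xB)).
have [[a [j [Vj fj]]]|H0] := pselect (exists a : 'I_B, exists j, V' a j /\ f a j = b); last first.
  rewrite big1// => a _; apply: (N_zero HN) => j; rewrite rst_out// => Hj.
  by apply: H0; exists a, j.
have hb a' i : V' a' i -> f a' i = b -> h b = a'.
  by move=> Vi <-; have [_ + _] := fP a' => /(_ _ Vi)[[_ [_ ->]]].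
rewrite (bigD1 a)//= big1 ?addr0.
  rewrite rst_rst; apply: (N_mono HN xB) => i [[Ui hi] [Vi fi]].
  by split; [rewrite /W/= hi|rewrite /H hi].
move=> a' aa'; apply: (N_zero HN) => i; rewrite rst_out// => -[Vi fi].
by case/eqP: aa'; apply/val_inj; rewrite /= -(hb _ _ Vi fi) -(hb _ _ Vj fj).
Qed.

Lemma Nk_succ k U h B x : lab 1 U h -> bd B x -> (forall k, x k != 0 -> U k) ->
  \sum_(a < B) Nk k (x \_ (piece U h a)) <= Nk k.+1 x.
Proof.
move=> hU xB xU; apply/ler_addgt0Pr => e e0.
pose e' := e / B.+1%:R; have e'0 : 0 < e' by rewrite divr_gt0.
have /choice[V VP] : forall a, exists Vg : set nat * (nat -> nat), lab k Vg.1 Vg.2 /\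
    Nk k (x \_ (piece U h a)) <= \sum_(b < B) N ((x \_ (piece U h a)) \_ (piece Vg.1 Vg.2 b)) + e'.
  move=> a; have aB := bd_rst (piece U h a) xB.
  have [_ [V [g [B' [gV xB' ->]]]] lt] := sup_adherent e'0 (Nk_has_sup k aB).
  exists (V, g); split=> //=; rewrite -lerBlDr ltW//.
  by rewrite (big_piece _ gV aB xB')//; move=> y; exact: (N_zero HN).
apply: (le_trans (ler_sum _ (fun (a : 'I_B) _ => (VP a).2))).
rewrite big_split/= sumr_const card_ord; apply: lerD.
  exact: (big_concat (V := fun a => (V a).1) (g := fun a => (V a).2) hU xB xU (fun a => (VP a).1)).
rewrite -[leLHS]mulr_natl /e' mulrCA ler_piMr ?ltW// ltr_pdivrMr// mul1r ltr_nat//.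
Qed.

End AveragedNorms.

(** * Lower estimates and their passage to block bases *)

Section LowerEstimates.
Context (R : realType).
Implicit Types (U : set nat) (h : nat -> nat) (x : nat -> R) (q : (nat -> R) -> R).

(** Since [U] contains the support, [x] is the sum of its pieces, as for the block sequences in
    [delta]. Nothing is asked of proper restrictions, under which an equivalent norm may
    increase. *)
Definition lower_est q n dl : Prop := forall B x U h, bd B x -> lab n U h ->
  (forall k, x k != 0 -> U k) -> dl * \sum_(a < B) q (x \_ (piece U h a)) <= q x.

Context (q : (nat -> R) -> R) (q0 : forall x, (forall k, x k = 0) -> q x = 0)
  (q_ge0 : forall B x, bd B x -> 0 <= q x).

Lemma lower_est0 : lower_est q 0 1.
Proof.
move=> B x U h xB [_ _ h0] xU; rewrite mul1r.
have [[a [k [Uk ka]]]|H] := pselect (exists a : 'I_B, exists k, U k /\ h k = a); last first.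
  rewrite big1 ?(q_ge0 xB)// => a _; apply: q0 => k; rewrite rst_out// => ?.
  by case: H; exists a, k.
rewrite (bigD1 a)//= big1 ?addr0.
  rewrite rst_id// => j /xU Uj; split=> //.
  by rewrite -ka; apply: h0; [exists j|exists k].
move=> b ba; apply: q0 => k'; rewrite rst_out// => -[Uk' hb]; case/eqP: ba; apply/val_inj.
by rewrite /= -ka -hb; apply: h0; [exists k'|exists k].
Qed.

Lemma lower_estM n m dl dl' : 0 <= dl -> 0 <= dl' -> lower_est q n dl -> lower_est q m dl' ->
  lower_est q (n + m) (dl * dl').
Proof.
move=> dl0 dl0' Hn Hm B x U h xB hU xU; have [h1 h2 h3] := hU.
have [g [g1 g2 g3 g4]] := Sch_split h3.
have hg : lab n U (g \o h).
  split.
  - by move=> i j Ui Uj ij; apply: g2; [exists i|exists j|exact: h1].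
  - move=> i Ui; have [_ gx] := g1 (h i) (ex_intro2 _ _ i Ui erefl).
    exact: leq_trans gx (h2 _ Ui).
  - by apply: Sch_sub g4 => _ [i Ui <-]; exists (h i) => //; exists i.
apply: le_trans (Hn _ _ _ _ xB hg xU); rewrite -mulrA ler_wpM2l//.
pose Y c := x \_ (piece U (g \o h) c).
have hc c : dl' * \sum_(a < B) q (Y c \_ (piece (piece U (g \o h) c) h a)) <= q (Y c).
  apply: (Hm _ _ _ _ (bd_rst _ xB)); last first.
    by move=> k; rewrite rstE; case: asboolP => //; rewrite eqxx.
  split.
  - by move=> i j [Ui _] [Uj _]; exact: h1.
  - by move=> i [Ui _]; exact: h2.
  - by apply: Sch_sub (g3 c) => _ [i [Ui gi] <-]; split=> //; exists i.
apply: (le_trans _ (ler_sum _ (fun (c : 'I_B) _ => hc c))).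
rewrite -mulr_sumr ler_wpM2l// exchange_big/=; apply: ler_sum => a _.
have qY0 c : 0 <= q (Y c \_ (piece (piece U (g \o h) c) h a)).
  exact: q_ge0 (bd_rst _ (bd_rst _ xB)).
have [[k [Uk hk]]|H] := pselect (exists k, U k /\ h k = a); last first.
  rewrite q0; first exact: sumr_ge0.
  by move=> k; rewrite rst_out// => -[Uk hk]; apply: H; exists k.
have gaB : (g a < B)%N.
  apply: leq_ltn_trans (ltn_ord a); have [] := g1 (h k); first by exists k.
  by rewrite hk.
rewrite (bigD1 (Ordinal gaB))//= [leLHS](_ : _ = q (Y (g a) \_ (piece (piece U (g \o h) (g a)) h a))).
  by rewrite lerDl sumr_ge0.
congr q; rewrite rst_rst; apply: eq_rst => // j _; split; last by move=> [[? ?] [? ?]].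
move=> [Uj hj]; have P1 : piece U (g \o h) (g a) j by split=> //=; rewrite hj.
by split.
Qed.

Lemma lower_estX n dl k : 0 <= dl -> lower_est q n dl -> lower_est q (n * k) (dl ^+ k).
Proof.
move=> dl0 H; elim: k => [|k IH]; first by rewrite muln0 expr0; exact: lower_est0.
by rewrite mulnS exprS; apply: lower_estM => //; rewrite exprn_ge0.
Qed.

(** Block indices are at most the coordinates in the block, so a family admissible with respect to
    the blocks stays admissible for the basis vectors; passing to a block basis thus preserves the
    constant. *)
Lemma lower_est_lin v beta p n dl : block_system v beta p ->
  lower_est q n dl -> lower_est (q \o lin v beta) n dl.
Proof.
move=> Hv H B x U h xB hU xU /=.
pose B' := maxn B (p B).
have hU' := lab_lin Hv hU.
have xB' : bd B' (lin v beta x) by apply: bd_le (bd_lin Hv xB); exact: leq_maxr.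
rewrite (@big_piece_le _ (q \o lin v beta) n U h B B' x _ hU xB (leq_maxl _ _)); last first.
  by move=> y y0; apply: q0 => k; rewrite /lin y0 mul0r.
rewrite (eq_bigr (fun a : 'I_B' =>
  q ((lin v beta x) \_ (piece (beta @^-1` U) (h \o beta) a)))); last first.
  by move=> a _; rewrite /= lin_piece.
apply: H => // k; rewrite /lin mulf_eq0 negb_or => /andP[xk _]; exact: xU.
Qed.

End LowerEstimates.

Section AveragedNorm.
Context (R : realType) (theta : nat -> R) (th : R) (N : (nat -> R) -> R).
Context (Hth : regular_th theta th) (HN : tnorm theta N).
Context (n : nat) (r : R) (n0 : (0 < n)%N) (r0 : 0 < r) (rn : r ^+ n = theta n).

Definition qn x : R := \sum_(k < n) r ^+ k * Nk N k x.

Lemma qn_lower : lower_est qn 1 r.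
Proof.
move=> B x U h xB hU xU; rewrite /qn.
have -> : r * \sum_(a < B) \sum_(k < n) r ^+ k * Nk N k (x \_ (piece U h a)) =
    \sum_(k < n) r ^+ k.+1 * \sum_(a < B) Nk N k (x \_ (piece U h a)).
  rewrite mulr_sumr; under eq_bigr do rewrite mulr_sumr.
  rewrite exchange_big/=; apply: eq_bigr => k _; rewrite mulr_sumr.
  by apply: eq_bigr => a _; rewrite exprS mulrA.
apply: (@le_trans _ _ (\sum_(k < n) r ^+ k.+1 * Nk N k.+1 x)).
  apply: ler_sum => k _; rewrite ler_wpM2l//; first by rewrite exprn_ge0// ltW.
  exact: (Nk_succ Hth HN).
pose F k := r ^+ k * Nk N k x.
have E : F 0%N + \sum_(k < n) F k.+1 = \sum_(k < n) F k + F n.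
  by rewrite -(big_ord_recr n (fun k : 'I_n.+1 => F k)) big_ord_recl.
have F0 : F n <= F 0%N.
  rewrite /F [r ^+ 0]expr0 mul1r rn; apply: le_trans (Nk_theta Hth HN n xB) _.
  exact: (Nk_ge Hth HN 0 xB).
suff : \sum_(k < n) F k.+1 <= \sum_(k < n) F k by [].
by move: E F0; lra.
Qed.

Lemma qn_add B x y : bd B x -> bd B y -> qn (fun k => x k + y k) <= qn x + qn y.
Proof.
move=> xB yB; rewrite /qn -big_split/=; apply: ler_sum => k _.
rewrite -mulrDr ler_wpM2l//; first by rewrite exprn_ge0// ltW.
exact: (Nk_add Hth HN _ xB yB).
Qed.

Lemma qn_scale B t x : bd B x -> qn (fun k => t * x k) = `|t| * qn x.
Proof.
move=> xB; rewrite /qn mulr_sumr; apply: eq_bigr => k _.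
by rewrite (Nk_scale Hth HN _ _ xB) mulrCA.
Qed.

Lemma qn_ge B x : bd B x -> N x <= qn x.
Proof.
move=> xB; rewrite /qn (bigD1 (Ordinal n0))//= expr0 mul1r.
apply: le_trans (Nk_ge Hth HN 0 xB) _; rewrite lerDl; apply: sumr_ge0 => k _.
by apply: mulr_ge0; [rewrite exprn_ge0// ltW|exact: (Nk_ge0 Hth HN _ xB)].
Qed.

Lemma qn_le B x : bd B x -> qn x <= (\sum_(k < n) r ^+ k / theta k) * N x.
Proof.
move=> xB; rewrite /qn mulr_suml; apply: ler_sum => k _.
rewrite -mulrA ler_wpM2l//; first by rewrite exprn_ge0// ltW.
by rewrite ler_pdivlMl ?(rt_gt0 Hth)// (Nk_theta Hth HN _ xB).
Qed.

End AveragedNorm.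

(** * Countable ordinals and Schreier families *)

Section Ordinals.
Context (d : Order.disp_t) (W : bOrderType d) (hW : is_omega1 W).
Implicit Types (a b : W) (P : set W).

Lemma ominP P : P !=set0 -> P (omin P) /\ forall b, P b -> (omin P <= b)%O.
Proof.
move=> [a0 Pa0]; apply: (@xgetPex _ \bot%O [set a | P a /\ forall b, P b -> (a <= b)%O]).
have [wf _ _] := hW; elim/(well_founded_ind wf): a0 Pa0 => a IH Pa.
have [[b [Pb ba]]|H] := pselect (exists b, P b /\ (b < a)%O); first exact: IH Pb.
exists a; split=> // b Pb; rewrite leNgt; apply/negP => ba.
by apply: H; exists b.
Qed.

(** Otherwise [a] would be the greatest element, and W, the segment below [a] together with [a],
    would be countable. *)
Lemma osucc_ex a : [set b | (a < b)%O] !=set0.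
Proof.
have [_ hc hu] := hW; apply: contrapT => H; apply: hu.
apply: (@sub_countable _ _ _ (\bigcup_(t in [set: bool]) if t then [set b | (b < a)%O] else [set a])).
  apply: subset_card_le => b _ /=; have [ab|ab|->] := ltgtP a b; last by exists false.
    by case: H; exists b.
  by exists true.
by apply: bigcup_countable => // -[] _; [exact: hc|exact: countable1].
Qed.

Lemma lt_osucc a : (a < osucc a)%O.
Proof. exact: (ominP (osucc_ex a)).1. Qed.

Lemma osucc_le a b : (a < b)%O -> (osucc a <= b)%O.
Proof. exact: (ominP (osucc_ex a)).2. Qed.

Lemma osucc_inj : injective (@osucc d W).
Proof.
move=> a b ab; apply/eqP; rewrite eq_le !leNgt; apply/andP; split; apply/negP => lt.
- by have := le_lt_trans (osucc_le lt) (lt_osucc a); rewrite ab ltxx.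
- by have := le_lt_trans (osucc_le lt) (lt_osucc b); rewrite ab ltxx.
Qed.

Lemma osucc_neq0 a : osucc a <> \bot%O.
Proof. by move=> a0; have := lt_osucc a; rewrite a0 ltx0. Qed.

Lemma onat_not_limit n : ~ is_limit (onat W n).
Proof.
by case: n => [|n] [n0]//= /(_ (onat W n) (lt_osucc _)); rewrite ltxx.
Qed.

Lemma lt_onat n m : (n < m)%N -> (onat W n < onat W m)%O.
Proof.
elim: m => // m IH; rewrite ltnS leq_eqVlt => /predU1P[->|/IH nm]; first exact: lt_osucc.
exact: lt_trans nm (lt_osucc _).
Qed.

Lemma le_onat b n : (b <= onat W n)%O -> exists2 k, (k <= n)%N & b = onat W k.
Proof.
elim: n b => [|n IH] b.
  by rewrite lex0 => /eqP ->; exists 0%N.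
have [bn _|nb] := leP b (onat W n).
  by have [k kn ->] := IH _ bn; exists k => //; exact: leqW.
move=> bS; exists n.+1 => //=; apply/eqP; rewrite eq_le bS/=; exact: osucc_le.
Qed.

Lemma onat_lt_limit a n : is_limit a -> (onat W n < a)%O.
Proof.
move=> [a0 aS]; elim: n => [|n IH] /=; last exact: aS.
by rewrite lt0x; apply/eqP.
Qed.

Lemma omega_ex : [set a | forall n, (onat W n < a)%O] !=set0.
Proof.
have [_ hc hu] := hW; apply: contrapT => H; apply: hu.
apply: (@sub_countable _ _ _ (\bigcup_(n in [set: nat]) [set onat W n])); last first.
  by apply: bigcup_countable => // n _; exact: countable1.
apply: subset_card_le => b _ /=.
have [n bn] : exists n, (b <= onat W n)%O.
  apply: contrapT => Hn; apply: H; exists b => n; rewrite ltNge; apply/negP => ?.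
  by apply: Hn; exists n.
by have [k _ ->] := le_onat bn; exists k.
Qed.

(** Let [c] be the least element above all finite ordinals, which exists because W is uncountable.
    It is a limit with only finite ordinals below it, so the least limit is at most [c]. *)
Lemma oomegaP : is_limit (oomega W) /\ forall b, (b < oomega W)%O -> exists n, b = onat W n.
Proof.
have [cP cmin] := ominP omega_ex; set c := omin _ in cP cmin.
have below b : (b < c)%O -> exists n, b = onat W n.
  move=> bc; have [n bn] : exists n, (b <= onat W n)%O.
    apply: contrapT => Hn; have := cmin b; rewrite leNgt bc => H.
    suff : false by []. apply: H => n; rewrite ltNge; apply/negP => ?.
    by apply: Hn; exists n.
  by have [k _ ->] := le_onat bn; exists k.
have cl : is_limit c.
  split; first by move=> c0; have := cP 0%N; rewrite c0 ltx0.
  by move=> b /below [n ->]; exact: (cP n.+1).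
have [wl wmin] : is_limit (oomega W) /\ forall b, is_limit b -> (oomega W <= b)%O.
  by apply: ominP; exists c.
split=> // b bw; apply: below; exact: lt_le_trans bw (wmin _ cl).
Qed.

End Ordinals.

(** * Comparison with the inductively defined Schreier families *)

Section SchreierFamilies.
Context (d : Order.disp_t) (W : bOrderType d) (hW : is_omega1 W) (fs : W -> nat -> W).
Implicit Types (a b : W) (F : set nat).

Lemma schreier_Sch a F n : schreier fs a F -> a = onat W n -> Sch succn n [set k | F k.+1].
Proof.
move=> HF; elim: HF n => {a F}.
- by move=> n _; apply: Sch_sub (Sch0 _ _).
- move=> m m0 [|n]; last by move=> /esym /(osucc_neq0 hW).
  by move=> _ x y /= [] <- [] ->.
- move=> a n F n0 nF Fsucc _ IH [|k]; first by move=> /(osucc_neq0 hW).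
  move=> /(osucc_inj hW) ak /=.
  have /choice[g gP] : forall x, exists j, (\bigcup_i F i) x.+1 ->
      exists i : 'I_n, F i x.+1 /\ i = j :> nat.
    move=> x; have [[i _ Fi]|H] := pselect ((\bigcup_i F i) x.+1); last by exists 0%N.
    by exists i => _; exists i.
  exists n, g; split.
  + move=> x Fx; have [i [Fi <-]] := gP _ Fx; rewrite ltn_ord/=.
    exact: nF Fi.
  + move=> x y Fx Fy xy; have [i [Fi <-]] := gP _ Fx; have [j [Fj <-]] := gP _ Fy.
    rewrite leqNgt; apply/negP => ji; have := Fsucc _ _ ji _ _ Fj Fi.
    by rewrite ltnS ltnNge xy.
  + move=> j; have [jn|nj] := ltnP j n.
      apply: Sch_sub (IH (Ordinal jn) _ ak) => x /= [Fx gx].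
      have [i [Fi ij]] := gP _ Fx; suff -> : Ordinal jn = i by [].
      by apply/val_inj; rewrite /= ij.
    apply: Sch_sub (Sch0 _ _) => x /= [Fx gx].
    by have [i [_ ij]] := gP _ Fx; move: nj; rewrite -gx -ij leqNgt ltn_ord.
- by move=> a n F al _ _ _ _ k ak; case: (onat_not_limit hW (n := k)); rewrite -ak.
Qed.

Lemma Sch_schreier n (B : set nat) : Sch succn n B -> schreier fs (onat W n) (succn @` B).
Proof.
elim: n B => [|n IH] B /=.
  move=> HB; have [[x Bx]|B0] := pselect (exists x, B x).
    rewrite (_ : succn @` B = [set x.+1]); first exact: schreier_single.
    apply/seteqP; split; first by move=> _ [y By <-]; rewrite (HB _ _ By Bx).
    by move=> _ ->; exists x.
  rewrite (_ : succn @` B = set0); first exact: schreier_empty.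
  by apply/seteqP; split=> // z [y By _]; case: B0; exists y.
move=> [m [g [g1 g2 g3]]].
(* For empty [B] the number [m] of parts may be 0, which [schreier_succ] excludes; one empty part is
   used instead. *)
have [[x0 Bx0]|B0] := pselect (exists x, B x); last first.
  rewrite (_ : succn @` B = \bigcup_(i : 'I_1) set0); last first.
    by apply/seteqP; split=> [z [x Bx _]|z [i _ []]]; case: B0; exists x.
  apply: schreier_succ => //; first by move=> i j _ k l [].
  by move=> _; have := IH set0 (Sch0 _ _); rewrite image_set0.
rewrite (_ : succn @` B = \bigcup_(i : 'I_m) (succn @` [set x | B x /\ g x = i])); last first.
  apply/seteqP; split.
    move=> z [x Bx <-]; have /andP[gm _] := g1 _ Bx.
    by exists (Ordinal gm) => //; exists x.
  by move=> z [i _ [x [Bx gx] <-]]; exists x.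
apply: schreier_succ.
- by have /andP[+ _] := g1 _ Bx0; exact: leq_ltn_trans.
- by move=> i _ [x [Bx _] <-]; have /andP[] := g1 _ Bx.
- move=> i j ij _ _ [x [Bx gx] <-] [y [By gy] <-]; rewrite ltnS ltnNge; apply/negP => yx.
  by have := g2 _ _ By Bx yx; rewrite gx gy leqNgt => /negP; apply; exact: ij.
- by move=> i; exact: IH (g3 i).
Qed.

End SchreierFamilies.

Lemma is_least_ex (E : set nat) : E !=set0 -> exists m, is_least E m.
Proof.
move=> [x Ex]; have ex : exists x, `[< E x >] by exists x; apply/asboolP.
exists (ex_minn ex); case: ex_minnP => m /asboolP Em mmin; split=> // k Ek.
by apply: mmin; apply/asboolP.
Qed.

Section Admissible.
Context (d : Order.disp_t) (W : bOrderType d) (hW : is_omega1 W) (fs : W -> nat -> W).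
Context (R : realType).
Implicit Types (E : set nat).

(** Points are labelled by the minimum of their member, so the set of labels is the set of
    minima. *)
Lemma adm_lab n l (E : 'I_l -> set nat) : admissible fs (onat W n) E ->
  exists h, lab n (\bigcup_i E i) h /\
  forall (f : (nat -> R) -> R) B x, (forall y, (forall k, y k = 0) -> f y = 0) -> bd B x ->
    \sum_(i < l) f (x \_ (E i)) = \sum_(a < B) f (x \_ (piece (\bigcup_i E i) h a)).
Proof.
move=> [E0 Esucc SE].
have /choice[m mP] : forall i, exists m, is_least (E i) m by move=> i; exact: is_least_ex.
have lt_of (i j : 'I_l) x y : E i x -> E j y -> (x <= y)%N -> (i <= j)%N.
  move=> Ex Ey xy; rewrite leqNgt; apply/negP => ji.
  by have := Esucc _ _ ji _ _ Ey Ex; rewrite ltnNge xy.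
have Edisj (i j : 'I_l) x : E i x -> E j x -> i = j.
  move=> Ex Ey; apply/val_inj/eqP; rewrite eqn_leq /=.
  by rewrite (lt_of _ _ _ _ Ex Ey (leqnn _)) (lt_of _ _ _ _ Ey Ex (leqnn _)).
have /choice[h hP] : forall x, exists a, forall i, E i x -> m i = a.
  move=> x; have [[i Ei]|H] := pselect (exists i, E i x).
    by exists (m i) => j Ej; rewrite (Edisj _ _ _ Ej Ei).
  by exists 0%N => i Ei; case: H; exists i.
have mlt (i j : 'I_l) : (i < j)%N -> (m i < m j)%N.
  by move=> ij; apply: Esucc ij _ _ (mP i).1 (mP j).1.
exists h; split; first split.
- move=> x y [i _ Ex] [j _ Ey] xy; rewrite -(hP _ _ Ex) -(hP _ _ Ey).
  have := lt_of _ _ _ _ Ex Ey xy; rewrite leq_eqVlt => /predU1P[ij|/mlt/ltnW//].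
  by have -> : i = j by apply/val_inj.
- by move=> x [i _ Ex]; rewrite -(hP _ _ Ex); exact: (mP i).2.
- have := schreier_Sch hW SE erefl; apply: Sch_sub => z [x [i _ Ex] <-].
  exists (h x) => //; exists i; rewrite -(hP _ _ Ex); exact: mP.
move=> f B x f0 xB.
have pE i : piece (\bigcup_i E i) h (m i) = E i.
  apply/seteqP; split=> k.
    move=> [[j _ Ej]]; rewrite -(hP _ _ Ej) => mij; suff -> : i = j by [].
    by apply: (Edisj _ _ (m i)); [exact: (mP i).1|rewrite -mij; exact: (mP j).1].
  by move=> Ek; split; [exists i|rewrite -(hP _ _ Ek)].
have mB i : (B <= m i)%N -> f (x \_ (E i)) = 0.
  move=> Bm; apply: f0 => k; rewrite rstE; case: asboolP => // Ek.
  by apply: xB; apply: leq_trans Bm _; exact: (mP i).2.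
rewrite (eq_bigr (fun i : 'I_l => \sum_(a < B)
    if m i == a then f (x \_ (piece (\bigcup_i E i) h a)) else 0)); last first.
  move=> i _; have [miB|/mB fi] := ltnP (m i) B.
    rewrite (bigD1 (Ordinal miB))//= eqxx pE big1 ?addr0// => a am.
    by case: eqP => // ma; case/eqP: am; apply/val_inj.
  by rewrite fi big1// => a _; case: eqP => // ma; rewrite -ma pE.
rewrite exchange_big/=; apply: eq_bigr => a _.
have [[i mi]|H] := pselect (exists i, m i = a).
  rewrite (bigD1 i)//= mi eqxx big1 ?addr0// => j ji; case: eqP => // mj; case/eqP: ji.
  by apply: (Edisj _ _ a); [rewrite -mj; exact: (mP j).1|rewrite -mi; exact: (mP i).1].
rewrite big1; last by move=> i _; case: eqP => // mi; case: H; exists i.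
rewrite f0// => k; rewrite rst_out// => -[[i _ Ei]]; rewrite -(hP _ _ Ei) => mi.
by apply: H; exists i.
Qed.

(** The members are listed by increasing label. The reindexing holds for every [f] vanishing at zero
    vectors, since it is applied to norms and also to single coordinates. *)
Lemma lab_adm n (U : set nat) h B : lab n U h -> (forall k, U k -> (k < B)%N) ->
  exists l (E : 'I_l -> set nat), [/\ forall i, E i !=set0, successive E,
    forall i, E i `<=` U, Sch succn n [set m | exists i, is_least (E i) m]
  & forall (f : (nat -> R) -> R) x,
     (forall y, (forall k, y k = 0) -> f y = 0) ->
    \sum_(i < l) f (x \_ (E i)) = \sum_(a < B) f (x \_ (piece U h a))].
Proof.
move=> [h1 h2 h3] UB.
pose P a := `[< exists k, U k /\ h k = a >].
pose s := [seq a <- iota 0 B | P a]; pose l := size s.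
pose E (i : 'I_l) := piece U h (nth 0%N s i).
have sE (i : 'I_l) : nth 0%N s i \in s by exact: mem_nth.
have srt : sorted ltn s by apply: sorted_filter (iota_ltn_sorted 0 B); exact: ltn_trans.
have nlt (i j : 'I_l) : (i < j)%N -> (nth 0%N s i < nth 0%N s j)%N.
  by move=> ij; apply: (sorted_ltn_nth ltn_trans) => //; rewrite inE.
have lt_of k k' : U k -> U k' -> (h k < h k')%N -> (k < k')%N.
  by move=> Uk Uk' hk; rewrite ltnNge; apply/negP => /(h1 _ _ Uk' Uk); rewrite leqNgt hk.
exists l, E; split.
- move=> i; have := sE i; rewrite mem_filter => /andP[/asboolP[k [Uk hk]] _].
  by exists k.
- move=> i j ij k k' [Uk hk] [Uk' hk']; apply: lt_of => //.
  by rewrite hk hk'; exact: nlt.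
- by move=> i k [].
(* The true minima dominate the labels, so they form a spread of the set of labels. *)
- apply: (Sch_spread (f := h) h3).
    move=> x [i [[Ux _] _]]; split; first by exists x.
    exact: h2.
  move=> x y [i [[Ux hx] xmin]] [j [[Uy hy] ymin]] xy; rewrite ltnNge; apply/negP => hyx.
  have hxy := h1 _ _ Ux Uy (ltnW xy).
  have exy : h x = h y by apply/eqP; rewrite eqn_leq hxy.
  have := ymin x; rewrite leqNgt xy => H; suff : false by [].
  by apply: H; split=> //; rewrite exy.
- move=> f x f0; rewrite -(big_mkord xpredT (fun i => f (x \_ (piece U h (nth 0%N s i))))).
  rewrite -(big_nth 0%N xpredT (fun a => f (x \_ (piece U h a)))) big_filter.
  rewrite -/(index_iota 0 B) (_ : iota 0 B = index_iota 0 B); last by rewrite /index_iota subn0.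
  rewrite big_mkord big_mkcond/=; apply: eq_bigr => a _; rewrite /P; case: asboolP => // H.
  by rewrite f0// => k; rewrite rst_out// => -[Uk hk]; apply: H; exists k.
Qed.

End Admissible.

(** * The mixed Tsirelson norm *)

Section Comb.
Context (R : realType) (V : lmodType R).
Implicit Types (u : nat -> V) (x y : nat -> R).

Lemma combE u B x : bd B x -> comb u x = \sum_(i < B) x i *: u i.
Proof.
move=> xB; rewrite /comb (fsbig_ord _ B (fun i => x i *: u i)).
apply/esym/fsbig_widen => // i [_ /= iB]; rewrite xB ?scale0r//.
by rewrite leqNgt; exact/negP.
Qed.

Lemma combD u B x y : bd B x -> bd B y -> comb u (fun k => x k + y k) = comb u x + comb u y.
Proof.
move=> xB yB; rewrite !(combE u (B := B))//; last by move=> k kB; rewrite xB// yB// addr0.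
by rewrite -big_split/=; apply: eq_bigr => i _; rewrite scalerDl.
Qed.

Lemma combZ u B t x : bd B x -> comb u (fun k => t * x k) = t *: comb u x.
Proof.
move=> xB; rewrite !(combE u (B := B))//; last by move=> k kB; rewrite xB// mulr0.
by rewrite scaler_sumr; apply: eq_bigr => i _; rewrite scalerA.
Qed.

Lemma comb0 u x : (forall k, x k = 0) -> comb u x = 0.
Proof. by move=> x0; rewrite (combE u (B := 0)) ?big_ord0// => k _. Qed.

Lemma comb_sum u B n (X : 'I_n -> nat -> R) : (forall i, bd B (X i)) ->
  comb u (fun k => \sum_(i < n) X i k) = \sum_(i < n) comb u (X i).
Proof.
move=> XB; rewrite (combE u (B := B)); last by move=> k kB; rewrite big1// => i _; exact: XB.
rewrite (eq_bigr (fun i => \sum_(k < B) X i k *: u k)); last by move=> i _; exact: combE.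
by rewrite exchange_big/=; apply: eq_bigr => k _; rewrite scaler_suml.
Qed.

Lemma comb_lin u z v beta p d n : block_system v beta p -> (forall i, z i = comb u (v i)) ->
  bd n d -> comb u (lin v beta d) = comb z d.
Proof.
move=> Hv zE dn; rewrite (combE z dn).
have bs i : bd (maxn n (p n)) (fun k => if (i < n)%N then d i * v i k else 0).
  move=> k; rewrite geq_max => /andP[nk pk]; case: ltnP => // ni.
  rewrite (bd_block Hv) ?mulr0//; apply: leq_trans pk.
  by apply: (bs_pmono Hv); exact: ltnW.
transitivity (comb u (fun k => \sum_(i < n) (if (i < n)%N then d i * v i k else 0))).
  congr comb; apply/funext => k; have [bn|nb] := ltnP (beta k) n.
    rewrite (bigD1 (Ordinal bn))//= bn big1 ?addr0// => i ib; rewrite ltn_ord.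
    have [->|/(bs_supp Hv) bi] := eqVneq (v i k) 0; first by rewrite mulr0.
    by case/eqP: ib; apply/val_inj.
  rewrite /lin dn// mul0r big1// => i _; rewrite ltn_ord.
  have [->|/(bs_supp Hv) bi] := eqVneq (v i k) 0; first by rewrite mulr0.
  by move: nb; rewrite bi leqNgt ltn_ord.
rewrite (comb_sum u (fun i : 'I_n => bs i)); apply: eq_bigr => i _.
by rewrite ltn_ord zE (combZ u _ (bd_block Hv i)).
Qed.

End Comb.

(* The value at 0, unconstrained in [regular_seq], is set to 1 so that theta is
   supermultiplicative on all of nat. *)
Definition theta_ext (R : realType) (theta : nat -> R) n : R := if n is 0 then 1 else theta n.

Section ExtendedMax.
Context (R : realType).
Implicit Types x y z : \bar R.

Lemma lee_maxl x y : (x <= maxe x y)%E.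
Proof. by rewrite /Order.max; case: ifP => // /ltW. Qed.

Lemma lee_maxr x y : (y <= maxe x y)%E.
Proof. by rewrite /Order.max; case: ifPn => //; rewrite -leNgt. Qed.

Lemma maxe_le x y z : (x <= z)%E -> (y <= z)%E -> (maxe x y <= z)%E.
Proof. by rewrite /Order.max; case: ifP. Qed.

End ExtendedMax.

Section TsirelsonNorm.
Context (d : Order.disp_t) (W : bOrderType d) (hW : is_omega1 W) (fs : W -> nat -> W).
Context (R : realType) (theta : nat -> R) (X : completeNormedModType R) (e : nat -> X).
Context (hX : mixed_tsirelson fs theta e).

Lemma tnorm_tsirelson : tnorm (theta_ext theta) (fun x => `|comb e x|).
Proof.
have [hn _] := hX; split.
- by move=> B x y xB yB; rewrite (combD e xB yB); exact: ler_normD.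
- by move=> B t x xB; rewrite (combZ e t xB) normrZ.
- move=> B x k xB; rewrite -lee_fin (hn _ (bd_c00 xB)) /tsirelson_rhs.
  apply: le_trans (lee_maxl _ _).
  by apply: ereal_sup_ubound; exists k.
- move=> [|q] // U h B x _ hU xB /=.
  (* Cutting [U] at [B] does not affect [x] and leaves finitely many members, as [admissible]
     demands. *)
  have hU' : lab q.+1 (U `&` `I_B) h by apply: lab_sub hU => k [].
  have [l [E [E0 Esucc EU SE Esum]]] := lab_adm R hU' (fun k (Hk : (U `&` `I_B) k) => Hk.2).
  have f0 (y : nat -> R) : (forall k, y k = 0) -> `|comb e y| = 0.
    by move=> y0; rewrite comb0// normr0.
  have -> : \sum_(a < B) `|comb e (x \_ (piece U h a))| =
      \sum_(i < l) `|comb e (x \_ (E i))|.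
    rewrite (Esum (fun y => `|comb e y|) x f0); apply: eq_bigr => a _; congr (`|comb e _|).
    apply: eq_rst => // k xk; split=> [[? ?]|[[? ?] ?]]; split=> //; split=> //=.
    by rewrite ltnNge; apply/negP => /xB /eqP; exact/negP.
  rewrite -lee_fin (hn _ (bd_c00 xB)) /tsirelson_rhs; apply: le_trans (lee_maxr _ _).
  apply: le_trans (ereal_sup_ubound _); last by exists q.+1.
  apply: ereal_sup_ubound; exists l, E; split=> //; split=> //.
  exact: Sch_schreier.
- move=> B x b xB xb H; rewrite -lee_fin (hn _ (bd_c00 xB)) /tsirelson_rhs.
  apply: maxe_le; apply: ge_ereal_sup.
    by move=> _ [k _ <-]; rewrite lee_fin.
  move=> _ [[|q] // _ <-]; apply: ge_ereal_sup => _ [l [E [adE ->]]]; rewrite lee_fin.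
  have [h [hU hsum]] := adm_lab hW R adE.
  rewrite (hsum (fun y => `|comb e y|) B) //; first exact: (H q.+1).
  by move=> y y0; rewrite comb0// normr0.
Qed.

End TsirelsonNorm.

(** * Convergence of theta_n^(1/n) to its supremum (Fekete) *)

Section RootLimit.
Context (R : realType) (theta : nat -> R) (htheta : regular_seq theta).

Let a n : R := theta n `^ (n%:R)^-1.

Lemma root_powE n : (0 < n)%N -> a n ^+ n = theta n.
Proof.
move=> n0; have [h1 _ _ _] := htheta; have /andP[t0 _] := h1 _ n0.
rewrite /a -powR_mulrn ?powR_ge0// -powRrM mulVf ?pnatr_eq0 -?lt0n// powRr1//.
exact: ltW.
Qed.

Lemma root_gt0 n : (0 < n)%N -> 0 < a n.
Proof.
by move=> n0; have [h1 _ _ _] := htheta; have /andP[t0 _] := h1 _ n0; exact: powR_gt0.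
Qed.

Lemma root_lt1 n : (0 < n)%N -> a n < 1.
Proof.
move=> n0; have [h1 _ _ _] := htheta; have /andP[_ t1] := h1 _ n0.
rewrite ltNge; apply/negP => /(exprn_ege1 n); rewrite root_powE//.
by rewrite leNgt t1.
Qed.

Lemma theta_pow n k : (0 < n)%N -> theta n ^+ k.+1 <= theta (n * k.+1)%N.
Proof.
have [h1 _ _ h4] := htheta => n0; elim: k => [|k IH]; first by rewrite muln1 expr1.
rewrite exprSr mulnS addnC; apply: le_trans (h4 _ _ _ _) => //; last by rewrite muln_gt0 n0.
by have /andP[t0 _] := h1 _ n0; rewrite ler_pM2r.
Qed.

(** Round m up to a multiple of n; it stays within m + n, and [a n < 1]. The surplus exponent n does
    not depend on m and disappears in the limit. *)
Lemma theta_root_le n m : (0 < n)%N -> (0 < m)%N -> a n ^+ (m + n) <= theta m.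
Proof.
move=> n0 m0; have [h1 h2 _ _] := htheta.
have mk : (m <= n * (m %/ n).+1)%N by rewrite mulnC; exact/ltnW/ltn_ceil.
apply: (le_trans _ (h2 m (n * (m %/ n).+1)%N _)); last by rewrite m0.
apply: le_trans (theta_pow (m %/ n) n0).
rewrite -(root_powE n0) -exprM; apply: ler_wiXn2l; [exact/ltW/root_gt0|exact/ltW/root_lt1|].
by rewrite mulnS addnC leq_add2r mulnC leq_trunc_div.
Qed.

Let s : R := sup [set a n | n in [set n | (0 < n)%N]].

Lemma root_has_sup : has_sup [set a n | n in [set n | (0 < n)%N]].
Proof.
split; first by exists (a 1), 1%N.
by exists 1 => _ [n n0 <-]; apply/ltW/root_lt1.
Qed.

Lemma root_le_sup n : (0 < n)%N -> a n <= s.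
Proof. by move=> n0; apply: sup_upper_bound; [exact: root_has_sup|exists n]. Qed.

Lemma root_near_sup c : c < s -> exists2 n, (0 < n)%N & c < a n.
Proof.
move=> cs; have [|_ [n n0 <-]] := @sup_adherent _ _ (s - c) _ root_has_sup.
  by rewrite subr_gt0.
by rewrite subKr => ?; exists n.
Qed.

Lemma sup_root_gt0 : 0 < s.
Proof. exact: lt_le_trans (root_gt0 (ltn0Sn 0)) (root_le_sup (ltn0Sn 0)). Qed.

Lemma cvg_root : a n @[n --> \oo] --> s.
Proof.
apply/cvgrPdist_lt => eps eps0; have s0 := sup_root_gt0.
(* The term s / 2 keeps [c] positive, so that [c / a n] is a ratio in (0, 1). *)
pose c := Num.max (s - eps) (s / 2).
have c0 : 0 < c by rewrite lt_max divr_gt0// orbT.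
have cs : c < s by rewrite gt_max gtrBl eps0/= ltr_pdivrMr// ltr_pMr// ltr1n.
have [n n0 cn] := root_near_sup cs; have an0 := root_gt0 n0.
have ca : `|c / a n| < 1 by rewrite ger0_norm ?divr_ge0 ?ltW// ltr_pdivrMr// mul1r.
have /cvgrPdist_lt/(_ (a n ^+ n)) := cvg_expr ca; rewrite exprn_gt0// => /(_ isT) H.
near=> m.
have m0 : (0 < m)%N by near: m; exact: nbhs_infty_gt.
rewrite ger0_norm ?subr_ge0 ?root_le_sup//.
suff : c < a m by rewrite gt_max => /andP[+ _]; lra.
(* Otherwise a_n^(m+n) <= theta_m <= c^m, that is (c / a_n)^m >= a_n^n, which fails for large m. *)
rewrite ltNge; apply/negP => amc.
have tm : theta m <= c ^+ m.
  rewrite -(root_powE m0); apply: lerXn2r => //; rewrite nnegrE; last exact: ltW.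
  exact/ltW/root_gt0.
have := le_trans (theta_root_le n0 m0) tm; apply/negP; rewrite -ltNge.
have : `|0 - (c / a n) ^+ m| < a n ^+ n by near: m.
rewrite sub0r normrN ger0_norm ?exprn_ge0 ?divr_ge0 ?ltW// expr_div_n ltr_pdivrMr ?exprn_gt0//.
by rewrite -exprD addnC.
Unshelve. all: by end_near. Qed.

Lemma root_limitE : root_limit theta = s.
Proof. exact: (cvg_lim (@Rhausdorff R) cvg_root). Qed.

Lemma regular_root : regular_th (theta_ext theta) (root_limit theta).
Proof.
rewrite root_limitE; have [h1 h2 h3 h4] := htheta; have s0 := sup_root_gt0.
have s1 : s <= 1.
  apply: ge_sup; first exact: root_has_sup.1.
  by move=> _ [n n0 <-]; exact/ltW/root_lt1.
split=> //.
- by case=> [|n] //=; have /andP[] := h1 _ (ltn0Sn n).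
- move=> [|n] [|m] //= nm; first by have /andP[_ /ltW] := h1 _ (ltn0Sn m).
  exact: h2.
- move=> [|n] [|m] //=; rewrite ?mul1r ?mulr1 ?addn0//.
  exact: h4.
- case=> [|n] /=; first by rewrite expr0.
  rewrite -(root_powE (ltn0Sn n)); apply: lerXn2r; rewrite ?nnegrE.
  + exact/ltW/root_gt0.
  + exact: ltW.
  + exact: root_le_sup.
- move=> mu /andP[mu0 mu1]; have [|n n0 cn] := @root_near_sup (mu * s).
    by rewrite gtr_pMl.
  exists n => //; case: n n0 cn => // n _ cn /=.
  rewrite -(root_powE (ltn0Sn n)) ltr_pXn2r// nnegrE; first by rewrite mulr_ge0// ltW.
  exact/ltW/root_gt0.
- move=> eps eps0; move/cvgrPdist_lt: h3 => /(_ _ eps0) [m _ mP].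
  exists m.+1; have := mP m.+1 (leqnSn m); rewrite sub0r normrN => /=.
  exact: le_lt_trans (ler_norm _).
Qed.

End RootLimit.

(** * Asymptotic constants and extension of norms *)

Section BlockCoefs.
Context (R : realType).

Lemma supp_least (x : nat -> R) m k : is_least (supp x) m -> x k != 0 -> (m <= k)%N.
Proof. by move=> [_ mP] /mP. Qed.

Lemma block_coefs_system (c : nat -> nat -> R) : block_coefs c ->
  exists beta p, block_system c beta p.
Proof.
move=> [c0 cn cs].
have /choice[P PP] : forall i, exists m, is_least (supp (c i)) m.
  by move=> i; exact: is_least_ex.
have PS i : (P i < P i.+1)%N by apply: (cs i i.+1); [exact: ltnSn|exact: (PP i).1|exact: (PP i.+1).1].
have [beta [bmono ble blt bE]] := interval_blocks PS.
exists beta, (fun i => P i.+1); split=> //.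
- move=> i j ij; elim: j ij => [|j IH]; first by rewrite leqn0 => /eqP ->.
  rewrite leq_eqVlt => /predU1P[->//|/IH/leq_trans]; apply; exact: ltnW.
- move=> i k cik; apply: bE; rewrite (supp_least (PP i) cik)/=.
  by apply: (cs i i.+1); [exact: ltnSn|exact: cik|exact: (PP i.+1).1].
Qed.

Lemma ran_least (x : nat -> R) m : is_least (ran x) m <-> is_least (supp x) m.
Proof.
split=> -[].
  move=> [i [j [xi xj /andP[im mj]]]] mP.
  have im' : (m <= i)%N by apply: mP; exists i, j; rewrite leqnn (leq_trans im mj).
  have -> : m = i by apply/eqP; rewrite eqn_leq im im'.
  by split=> // k xk; rewrite (leq_trans im)// mP//; exists k, k; rewrite leqnn.
move=> xm mP; split; first by exists m, m; rewrite leqnn.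
by move=> k [i [j [xi _ /andP[ik _]]]]; exact: leq_trans (mP _ xi) ik.
Qed.

Lemma bd_common n (c : 'I_n -> nat -> R) : (forall i, c00 (c i)) -> exists B, forall i, bd B (c i).
Proof.
move=> c0; have /choice[b bP] : forall i, exists B, bd B (c i) by move=> i; exact/c00_bd/c0.
by exists (\max_i b i) => i; apply: bd_le (bP i); exact: leq_bigmax.
Qed.

Lemma rst_ran n (c : 'I_n -> nat -> R) i : block_coefs c ->
  (fun k => \sum_(j < n) c j k) \_ (ran (c i)) = c i.
Proof.
move=> [_ _ cs]; apply/funext => k; rewrite rstE; case: asboolP => [[a [b [ca cb /andP[ak kb]]]]|nr].
  rewrite (bigD1 i)//= big1 ?addr0// => j ji; apply/eqP/negPn/negP => cjk.
  have [ij|ij] : (i < j)%N \/ (j < i)%N.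
      by case: (ltngtP i j) => [||/val_inj ij]; [left|right|move: ji; rewrite ij eqxx].
    by have := cs _ _ ij _ _ cb cjk; rewrite ltnNge kb.
  by have := cs _ _ ij _ _ cjk ca; rewrite ltnNge ak.
apply/esym/eqP/negPn/negP => ck; apply: nr; exists k, k; rewrite leqnn; split=> //.
Qed.

End BlockCoefs.

Section Deltas.
Context (d : Order.disp_t) (W : bOrderType d) (hW : is_omega1 W) (fs : W -> nat -> W).
Context (R : realType) (V : normedModType R).
Implicit Types (z : nat -> V) (p : V -> R).

Definition delta_lb a z p (dl : R) : Prop := forall (n : nat) (c : 'I_n -> nat -> R),
  block_coefs c -> admissible fs a (fun i => ran (c i)) ->
  dl * \sum_(i < n) p (comb z (c i)) <= p (\sum_(i < n) comb z (c i)).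

Lemma delta_lbP n z p dl : p 0 = 0 -> lower_est (p \o comb z) n dl ->
  delta_lb (onat W n) z p dl.
Proof.
move=> p0 H l c bc ad; have [c0 _ _] := bc; have [B cB] := bd_common c0.
have [h [hU hsum]] := adm_lab hW R ad.
pose x k := \sum_(i < l) c i k.
have xB : bd B x by move=> k kB; rewrite /x big1// => i _; exact: cB.
have f0 (y : nat -> R) : (forall k, y k = 0) -> (p \o comb z) y = 0.
  by move=> y0 /=; rewrite comb0.
rewrite -(comb_sum z cB).
apply: le_trans (H _ _ _ _ xB hU _); last first.
  move=> k xk; have [[i ci]|H0] := pselect (exists i, c i k != 0).
    by exists i => //; exists k, k; rewrite leqnn.
  case/eqP: xk; rewrite /x big1// => i _; apply/eqP/negPn/negP => ci.
  by apply: H0; exists i.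
rewrite -(hsum _ _ _ f0 xB) le_eqVlt; apply/predU1P; left; congr (_ * _).
by apply: eq_bigr => i _; rewrite /x rst_ran.
Qed.

(** The ordinal [a] is separated from the finite order [n] of the family: the case of a finite
    ordinal and that of omega, where sets of S_n lying far out belong to S_omega, both come from
    here. *)
Lemma delta_lb_est a n z p dl B x U h : p 0 = 0 -> delta_lb a z p dl ->
  bd B x -> lab n U h -> (forall k, x k != 0 -> U k) ->
  (forall F, F `<=` supp x -> Sch succn n F -> schreier fs a (succn @` F)) ->
  dl * \sum_(i < B) p (comb z (x \_ (piece U h i))) <= p (comb z x).
Proof.
move=> p0 H xB hU xU HF.
have xlt k : supp x k -> (k < B)%N.
  by move=> xk; rewrite ltnNge; apply/negP => /xB /eqP; exact/negP.
have [l [E [E0 Esucc EU SE Esum]]] := lab_adm R (lab_sub (xU : supp x `<=` U) hU) xlt.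
pose c i := x \_ (E i).
have cE i : supp (c i) = E i.
  apply/seteqP; split=> k; rewrite /supp/= /c rstE; first by case: asboolP; rewrite ?eqxx.
  by move=> Ek; rewrite asboolT//; exact: EU Ek.
have bc : block_coefs c.
  split.
  - by move=> i; apply: bd_c00 (bd_rst _ xB).
  - by move=> i; rewrite cE.
  - by move=> i j ij; rewrite !cE; exact: Esucc.
(* Filling the gaps of a support does not change its minimum, so the ranges are as admissible as the
   supports. *)
have minE : [set m | exists i, is_least (ran (c i)) m] = [set m | exists i, is_least (E i) m].
  by apply/seteqP; split=> m [i im]; exists i; move: im; rewrite ran_least cE.
have ad : admissible fs a (fun i => ran (c i)).
  split.
  - move=> i; have [k Ek] := E0 i; exists k; exists k, k; rewrite leqnn.
    by split=> //; rewrite -/(supp (c i) k) cE.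
  - move=> i j ij k k' [a1 [b1 [_ + /andP[_ kb]]]] [a2 [b2 [+ _ /andP[ak _]]]].
    rewrite !cE => Eb Ea; apply: leq_ltn_trans kb _; apply: leq_trans ak.
    exact: Esucc ij _ _ Eb Ea.
  - rewrite minE; apply: HF => // m [i [Em _]]; exact: EU Em.
have := H _ _ bc ad; rewrite -(comb_sum z (fun i => bd_rst (E i) xB)).
have -> : (fun k => \sum_(i < l) (x \_ (E i)) k) = x.
  apply/funext => k; rewrite (Esum (fun y => y k) x)//.
  have [xk|xk] := eqVneq (x k) 0.
    by rewrite big1// => b _; rewrite rstE xk if_same.
  have [_ h2 _] := hU; have hk : (h k < B)%N.
    exact: leq_ltn_trans (h2 _ (xU _ xk)) (xlt _ xk).
  rewrite (bigD1 (Ordinal hk))//= rst_in// big1 ?addr0// => b bh; rewrite rst_out// => -[_ hb].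
  by case/eqP: bh; apply/val_inj; rewrite /= hb.
rewrite (Esum (fun y => p (comb z y)) x); last by move=> y y0; rewrite comb0.
congr (_ * _ <= _); apply: eq_bigr => b _; congr (p (comb z _)).
by apply: eq_rst => // k xk; split=> -[? ?]; split=> //; exact: xU.
Qed.

Lemma delta_lb_lower n z p dl : p 0 = 0 -> delta_lb (onat W n) z p dl ->
  lower_est (p \o comb z) n dl.
Proof.
move=> p0 H B x U h xB hU xU; apply: (delta_lb_est p0 H xB hU xU) => F _ SF.
exact: Sch_schreier.
Qed.

Lemma delta_ge a z p dl : 0 <= dl -> delta_lb a z p dl -> (dl%:E <= delta fs a z p)%E.
Proof. by move=> dl0 H; apply: ereal_sup_ubound; exists dl. Qed.

Lemma delta_le a z p b : (forall dl, 0 <= dl -> delta_lb a z p dl -> dl <= b) ->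
  (delta fs a z p <= b%:E)%E.
Proof. by move=> H; apply: ge_ereal_sup => _ [dl [dl0 Hdl] <-]; rewrite lee_fin; exact: H. Qed.

End Deltas.

Section Extension.
Context (R : realType) (V : normedModType R) (e : nat -> V) (q : (nat -> R) -> R) (c C : R).
Context (c0 : 0 < c)
  (q_add : forall B x y, bd B x -> bd B y -> q (fun k => x k + y k) <= q x + q y)
  (q_scale : forall B t x, bd B x -> q (fun k => t * x k) = `|t| * q x)
  (q_ge : forall B x, bd B x -> c * `|comb e x| <= q x)
  (q_le : forall B x, bd B x -> q x <= C * `|comb e x|) (cC : c <= C).

Let S u := [set r | exists B x, bd B x /\ r = q x + C * `|u - comb e x|].

(* The infimal convolution of [q] with [C] times the norm. *)
Lemma norm_extension : exists2 p : V -> R, equivalent_norm [set: V] p &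
  forall B x, bd B x -> p (comb e x) = q x.
Proof.
have C0 : 0 < C by exact: lt_le_trans cC.
have z0 : bd 0 (fun=> 0 : R) by [].
have q0 : q (fun=> 0) = 0.
  by have := q_scale 0 z0; rewrite mul0r normr0 mul0r.
have SC u : S u (C * `|u|).
  by exists 0%N, (fun=> 0); rewrite q0 add0r comb0// subr0.
have Sc u r : S u r -> c * `|u| <= r.
  move=> [B [x [xB ->]]]; apply: (@le_trans _ _ (c * `|comb e x| + c * `|u - comb e x|)).
    rewrite -mulrDr ler_pM2l//; apply: le_trans (ler_normD _ _).
    by rewrite addrC subrK.
  by apply: lerD; [exact: q_ge xB|rewrite ler_wpM2r].
have Slb u : has_lbound (S u) by exists (c * `|u|) => r; exact: Sc.
have Sinf u : has_inf (S u) by split=> //; exists (C * `|u|).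
have Sle u r : S u r -> inf (S u) <= r by move=> Sr; apply: ge_inf.
have Sge u r : (forall s, S u s -> r <= s) -> r <= inf (S u).
  by move=> H; apply: lb_le_inf => //; exists (C * `|u|).
have scale t u : inf (S (t *: u)) <= `|t| * inf (S u).
  have [->|t0] := eqVneq t 0.
    rewrite normr0 mul0r; apply: Sle; exists 0%N, (fun=> 0); split=> //.
    by rewrite q0 comb0// scale0r subr0 normr0 mulr0 addr0.
  rewrite -ler_pdivrMl ?normr_gt0//; apply: Sge => _ [B [x [xB ->]]].
  rewrite ler_pdivrMl ?normr_gt0//; apply: Sle; exists B, (fun k => t * x k); split.
    by move=> k /xB ->; rewrite mulr0.
  by rewrite (q_scale t xB) (combZ e t xB) -scalerBr normrZ mulrDr mulrCA.
exists (fun u => inf (S u)).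
  split.
  - move=> u v _ _; apply/ler_addgt0Pr => eps eps0.
    have e2 : 0 < eps / 2 by rewrite divr_gt0.
    have [_ [B [x [xB ->]]] ux] := inf_adherent e2 (Sinf u).
    have [_ [B' [y [yB ->]]] vy] := inf_adherent e2 (Sinf v).
    have xM : bd (maxn B B') x by apply: bd_le xB; exact: leq_maxl.
    have yM : bd (maxn B B') y by apply: bd_le yB; exact: leq_maxr.
    apply: (@le_trans _ _ (q (fun k => x k + y k) + C * `|u + v - comb e (fun k => x k + y k)|)).
      apply: Sle; exists (maxn B B'), (fun k => x k + y k); split=> //.
      by move=> k kM; rewrite xM// yM// addr0.
    have H1 := q_add xM yM.
    have H2 : C * `|u + v - comb e (fun k => x k + y k)| <=
        C * `|u - comb e x| + C * `|v - comb e y|.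
      rewrite -mulrDr ler_pM2l// (combD e xM yM) opprD addrACA.
      exact: ler_normD.
    by move: H1 H2 ux vy; lra.
  - move=> t u _; apply/eqP; rewrite eq_le scale/=.
    have [->|t0] := eqVneq t 0.
      rewrite normr0 mul0r; apply: Sge => s /Sc; apply: le_trans.
      by rewrite mulr_ge0// ltW.
    rewrite -ler_pdivlMl ?normr_gt0// -normfV.
    by have := scale t^-1 (t *: u); rewrite scalerA mulVf// scale1r.
  - exists c, C; split=> // u _; apply/andP; split; first by apply: Sge => s; exact: Sc.
    exact: Sle.
move=> B x xB; apply/eqP; rewrite eq_le; apply/andP; split.
  by apply: Sle; exists B, x; rewrite subrr normr0 mulr0 addr0.
(* On c_00 nothing is gained: q x <= q y + q (x - y) <= q y + C ||x - y||. *)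
apply: Sge => _ [B' [y [yB ->]]].
have xM : bd (maxn B B') x by apply: bd_le xB; exact: leq_maxl.
have yM : bd (maxn B B') y by apply: bd_le yB; exact: leq_maxr.
have nyM : bd (maxn B B') (fun k => -1 * y k) by move=> k kM; rewrite yM// mulr0.
have xyM : bd (maxn B B') (fun k => x k + -1 * y k).
  by move=> k kM; rewrite xM// yM// mulr0 addr0.
have := q_add yM xyM.
have -> : (fun k => y k + (x k + -1 * y k)) = x by apply/funext => k; rewrite mulN1r addrC subrK.
move=> H; apply: le_trans H _; rewrite lerD2l; apply: le_trans (q_le xyM) _.
by rewrite (combD e xM nyM) (combZ e _ yM) scaleN1r.
Qed.

End Extension.

(** * The theorem *)

Lemma le_of_le_geometric (R : realType) (x y K : R) : 0 < y ->
  (forall k, x ^+ k.+1 <= K * y ^+ k.+1) -> x <= y.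
Proof.
move=> y0 H; rewrite leNgt; apply/negP => yx.
pose q := x / y; have q1 : 0 < q - 1 by rewrite subr_gt0 /q ltr_pdivlMr// mul1r.
pose k := Num.truncn (K / (q - 1)).
have : K / (q - 1) < k.+1%:R by rewrite truncnS_gt.
rewrite ltr_pdivrMr// => Kk.
have := H k; rewrite -ler_pdivrMr ?exprn_gt0// -expr_div_n -/q.
have := bernoulli k.+1 (y := q - 1); rewrite subrKC => b.
have {}b := b ltac:(lra); lra.
Qed.

Section Main.
Context (d : Order.disp_t) (W : bOrderType d) (hW : is_omega1 W)
    (fs : W -> nat -> W) (hfs : fundamental_sequences fs)
    (R : realType) (theta : nat -> R) (htheta : regular_seq theta)
    (X : completeNormedModType R) (e : nat -> X)
    (hX : mixed_tsirelson fs theta e).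

Let th : R := root_limit theta.
Let N (x : nat -> R) : R := `|comb e x|.
Let Hth : regular_th (theta_ext theta) th := regular_root htheta.
Let HN : tnorm (theta_ext theta) N := tnorm_tsirelson hW hX.

Lemma block_basis_system y : block_basis e y ->
  exists v beta p, block_system v beta p /\ forall i, y i = comb e (v i).
Proof.
move=> [c bc yE]; have [beta [p Hc]] := block_coefs_system bc.
by exists c, beta, p.
Qed.

Lemma block_basis_trans y v beta p z : block_system v beta p ->
  (forall i, y i = comb e (v i)) -> block_basis y z ->
  exists v' beta' p', [/\ block_system v' beta' p', forall i, z i = comb e (v' i)
    & forall n x, bd n x -> closed_span y (comb z x)].
Proof.
move=> Hv yE [c bc zE]; have [delta [q Hc]] := block_coefs_system bc.
exists (fun i => lin v beta (c i)), (delta \o beta), (p \o q); split.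
- exact: block_system_comp.
- by move=> i; rewrite zE (comb_lin Hv yE (bd_block Hc i)).
- move=> n x xn; apply: subset_closure; exists (lin c delta x).
    exact: bd_c00 (bd_lin Hc xn).
  exact: comb_lin Hc zE xn.
Qed.

Lemma block_basis_refl (y : nat -> X) : block_basis y y.
Proof.
exists (fun i k => (k == i)%:R).
  split.
  - by move=> i; apply: (@bd_c00 _ i.+1) => k ik; case: eqP => // ki; move: ik; rewrite ki ltnn.
  - by move=> i; exists i; rewrite /supp/= eqxx oner_neq0.
  - move=> i j ij k l; rewrite /supp/= !pnatr_eq0 !eqb0 !negbK => /eqP -> /eqP ->.
    exact: ij.
move=> i; rewrite (combE y (B := i.+1)).
  rewrite (bigD1 ord_max)//= eqxx scale1r big1 ?addr0// => j ji.
  by rewrite (_ : (j == i :> nat) = false) ?scale0r//; apply/negbTE.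
by move=> k ik; case: eqP => // ki; move: ik; rewrite ki ltnn.
Qed.

Lemma equivalent_norm0 (Y : set X) p u : Y u -> equivalent_norm Y p -> p 0 = 0.
Proof.
by move=> Yu [_ hs _]; have := hs 0 u Yu; rewrite scale0r normr0 mul0r.
Qed.

Lemma equivalent_norm_sub (Y : set X) p : equivalent_norm [set: X] p -> equivalent_norm Y p.
Proof.
move=> [h1 h2 [c [C [c0 C0 h3]]]]; split.
- by move=> u v _ _; exact: h1.
- by move=> t u _; exact: h2.
- by exists c, C; split=> // u _; exact: h3.
Qed.

Section Upper.
Context (Y : set X) (z : nat -> X) (v : nat -> nat -> R) (beta p : nat -> nat) (q : X -> R).
Context (Hv : block_system v beta p) (zE : forall i, z i = comb e (v i))
  (Yz : forall n x, bd n x -> Y (comb z x)) (hq : equivalent_norm Y q).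

Lemma q_zero : q 0 = 0.
Proof. exact: equivalent_norm0 (Yz (n := 0) (x := fun=> 0) _) hq. Qed.

Lemma N_lin n x : bd n x -> N (lin v beta x) = `|comb z x|.
Proof. by move=> xn; rewrite /N (comb_lin Hv zE xn). Qed.

Lemma delta_lb_le n dl : (0 < n)%N -> 0 <= dl -> delta_lb fs (onat W n) z q dl -> dl <= th ^+ n.
Proof.
move=> n0 dl0 Hdl; have [_ _ [c [C [c0 C0 hc]]]] := hq.
have th0 := rt_th0 Hth.
have q_ge0 B x : bd B x -> 0 <= (q \o comb z) x.
  move=> xB; have /andP[+ _] := hc _ (Yz xB); apply: le_trans.
  by rewrite mulr_ge0// ltW.
have qz x : (forall k, x k = 0) -> (q \o comb z) x = 0 by move=> x0 /=; rewrite comb0// q_zero.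
have H1 := delta_lb_lower q_zero Hdl.
(* [C / c] comes from the equivalence of the norms, and 3 / th from the bound 3 th^(M-1) at M = n (k
   + 1); neither depends on k. *)
apply: (@le_of_le_geometric _ _ _ (3 * C / (c * th))); first by rewrite exprn_gt0.
move=> k; have nk0 : (0 < n * k.+1)%N by rewrite muln_gt0 n0.
have [|m [x [h [xm _ hU sum1 ub]]]] := upper_estimate Hth HN Hv 0 nk0 (ltr01 : 0 < 1 :> R) _.
  by move=> j _; rewrite mul1r; exact: rt_pow Hth j.
have H2 := lower_estX qz q_ge0 (k := k.+1) dl0 H1 xm hU (fun j xj => xj).
have cN A : c * N (lin v beta (x \_ A)) <= q (comb z (x \_ A)).
  by rewrite (N_lin (bd_rst A xm)); have /andP[] := hc _ (Yz (bd_rst A xm)).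
have H3 : dl ^+ k.+1 * c <= dl ^+ k.+1 * \sum_(a < m)
    (q \o comb z) (x \_ (piece [set j | x j != 0] h a)).
  rewrite ler_wpM2l ?exprn_ge0// -[leLHS]mulr1 -sum1 mulr_sumr.
  by apply: ler_sum => a _; exact: cN.
have H4 : q (comb z x) <= C * (3 * th ^+ (n * k.+1).-1).
  have /andP[_] := hc _ (Yz xm); rewrite -(N_lin xm) => H; apply: le_trans H _.
  by rewrite ler_pM2l//; apply: le_trans ub _; rewrite mulr1.
have := le_trans H3 (le_trans H2 H4).
rewrite -ler_pdivlMr// => H5; apply: le_trans H5 _.
rewrite -exprM -[in leRHS](prednK nk0) exprS le_eqVlt; apply/predU1P; left.
by field; rewrite !gt_eqF.
Qed.

(** If th = 1, take Phi = theta_M, which is small and dominates the tail; if th < 1, take Phi = 1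
    and let th^(M-1) be small. *)
Lemma small_estimate kap : 0 < kap -> exists M Phi, [/\ (0 < M)%N, 0 < Phi,
  forall j, (M <= j)%N -> theta_ext theta j <= Phi * th ^+ j & Phi * th ^+ M.-1 <= kap].
Proof.
move=> k0; have th0 := rt_th0 Hth; have := rt_th1 Hth; rewrite le_eqVlt => /predU1P[t1|t1].
  have [n np] := rt_lim Hth k0.
  exists n.+1, (theta_ext theta n.+1); split=> //; first exact: rt_gt0 Hth _.
    by move=> j nj; rewrite t1 expr1n mulr1; exact: rt_anti Hth _ _ nj.
  rewrite t1 expr1n mulr1; apply: le_trans (ltW np); exact: rt_anti Hth _ _ (leqnSn n).
have ta : `|th| < 1 by rewrite ger0_norm// ltW.
have /cvgrPdist_lt/(_ _ k0)[M _ /(_ M (leqnn M))] := cvg_expr ta.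
rewrite sub0r normrN => MP; exists M.+1, 1; split=> //.
  by move=> j _; rewrite mul1r; exact: rt_pow Hth j.
by rewrite mul1r; apply: le_trans (ler_norm _) (ltW MP).
Qed.

Lemma delta_lb_omega dl : 0 <= dl -> delta_lb fs (oomega W) z q dl -> dl <= 0.
Proof.
move=> dl0 Hdl; have [_ _ [c [C [c0 C0 hc]]]] := hq; rewrite leNgt; apply/negP => dlp.
(* With this value the upper bound 3 C kap is three quarters of the lower bound dl c, a
   contradiction. *)
have [|M [Phi [M0 Phi0 HPhi Hs]]] := small_estimate (kap := dl * c / (4 * C)).
  by rewrite divr_gt0 ?mulr_gt0.
have [wl wb] := oomegaP hW; have [f1 _ f3] := hfs wl.
(* The J-th term of the fundamental sequence of omega is a finite ordinal above M, so an S_M-set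
   lying beyond J belongs to S_omega. *)
have [J J0 MJ] := f3 _ (onat_lt_limit M wl).
have [k kE] := wb _ (f1 _ J0).
have Mk : (M <= k)%N.
  rewrite leqNgt; apply/negP => /(lt_onat hW); rewrite -kE => lt.
  by have := lt_trans lt MJ; rewrite ltxx.
have [m [x [h [xm xJ hU sum1 ub]]]] := upper_estimate Hth HN Hv J M0 Phi0 HPhi.
have HF F : F `<=` supp x -> Sch succn M F -> schreier fs (oomega W) (succn @` F).
  move=> Fx SF; apply: (@schreier_limit _ _ _ _ J) => //.
    by move=> _ [i Fi <-]; apply: leqW; apply: xJ; exact: Fx Fi.
  by rewrite kE; apply: Sch_schreier; exact: Sch_le Mk SF.
have H2 := delta_lb_est q_zero Hdl xm hU (fun j xj => xj) HF.
have cN A : c * N (lin v beta (x \_ A)) <= q (comb z (x \_ A)).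
  by rewrite (N_lin (bd_rst A xm)); have /andP[] := hc _ (Yz (bd_rst A xm)).
have H3 : dl * c <= dl * \sum_(a < m) q (comb z (x \_ (piece [set j | x j != 0] h a))).
  rewrite ler_wpM2l// -[leLHS]mulr1 -sum1 mulr_sumr.
  by apply: ler_sum => a _; exact: cN.
have H4 : q (comb z x) <= C * (3 * (dl * c / (4 * C))).
  have /andP[_] := hc _ (Yz xm); rewrite -(N_lin xm) => H; apply: le_trans H _.
  rewrite ler_pM2l//; apply: le_trans ub _; rewrite -mulrA ler_pM2l//.
have := le_trans H3 (le_trans H2 H4).
have -> : C * (3 * (dl * c / (4 * C))) = (dl * c) * (3 / 4) by field; rewrite gt_eqF.
have : 0 < dl * c by rewrite mulr_gt0.
by move: (dl * c) => r; lra.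
Qed.

End Upper.

(** Take r = theta_n^(1/n) for an [n] where this root exceeds mu th. The norm [qn] is defined on
    c_00 only and is carried over to the completion. *)
Lemma good_norm mu : 0 <= mu < 1 -> exists r p, [/\ mu * th < r, equivalent_norm [set: X] p
  & lower_est (p \o comb e) 1 r].
Proof.
move=> muP; have [n n0 nP] := rt_app Hth muP.
have n0' := n0; case: n n0 n0' nP => // n _ n0 nP.
have [r r0 rn] : exists2 r : R, 0 < r & r ^+ n.+1 = theta_ext theta n.+1.
  by exists (theta n.+1 `^ (n.+1%:R)^-1); [exact: (root_gt0 htheta)|exact: (root_powE htheta)].
have th0 := rt_th0 Hth; have /andP[mu0 _] := muP.
have lt : mu * th < r.
  move: nP; rewrite -rn ltr_pXn2r// nnegrE; last exact: ltW.
  by rewrite mulr_ge0// ltW.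
pose q := qn N n.+1 r; pose K := \sum_(k < n.+1) r ^+ k / theta_ext theta k.
have K2 : 1 <= Num.max 1 K by rewrite le_max lexx.
have K1 : K <= Num.max 1 K by rewrite le_max lexx orbT.
have [| |p hp pE] := @norm_extension _ _ e q 1 (Num.max 1 K) ltr01
    (qn_add Hth HN n.+1 r0) (qn_scale Hth HN n.+1 r)
    (fun B x (xB : bd B x) => eq_ind_r (fun y => y <= q x) (qn_ge Hth HN n0 r0 xB) (mul1r _)).
- move=> B x xB; apply: le_trans (qn_le Hth HN n.+1 r0 xB) _.
  by apply: ler_wpM2r; [exact: normr_ge0|exact: K1].
- exact: K2.
exists r, p; split=> // B x U h xB hU xU /=.
rewrite (pE _ _ xB) (eq_bigr (fun a : 'I_B => q (x \_ (piece U h a)))).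
  exact: (qn_lower Hth HN r0 rn xB hU xU).
by move=> a _; rewrite (pE _ _ (bd_rst _ xB)).
Qed.

Lemma ddot_delta_ge n Y y mu : block_subspace e Y y -> 0 <= mu < 1 ->
  (((mu * th) ^+ n)%:E <= ddot_delta fs (onat W n) Y y)%E.
Proof.
move=> [eby YE] muP; have [r [p [lt hp Hp]]] := good_norm muP.
have [v [beta [b [Hv yE]]]] := block_basis_system eby.
have th0 := rt_th0 Hth; have /andP[mu0 _] := muP.
have r0 : 0 <= r by apply: le_trans (ltW lt); rewrite mulr_ge0// ltW.
have p0 : p 0 = 0 by exact: (equivalent_norm0 (u := 0) _ hp).
have p_ge0 u : 0 <= p u.
  have [_ _ [c [C [c0 _ /(_ u Logic.I)/andP[+ _]]]]] := hp; apply: le_trans.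
  by rewrite mulr_ge0// ltW.
have p0e (u : nat -> X) x : (forall k, x k = 0) -> (p \o comb u) x = 0 by move=> x0 /=; rewrite comb0.
have H1 : lower_est (p \o comb y) 1 r.
  move=> B x U h xB hU xU; have := lower_est_lin (p0e e) Hv Hp xB hU xU.
  rewrite /= (comb_lin Hv yE xB); congr (_ * _ <= _); apply: eq_bigr => a _.
  by rewrite (comb_lin Hv yE (bd_rst _ xB)).
have Hn : lower_est (p \o comb y) n (r ^+ n).
  rewrite -[n in lower_est _ n _]mul1n; apply: lower_estX => //; first exact: p0e.
  by move=> B x _ /=.
apply: (@le_trans _ _ (r ^+ n)%:E).
  by rewrite lee_fin; apply: lerXn2r; rewrite ?nnegrE//; [rewrite mulr_ge0// ltW|exact: ltW].
apply: le_trans (delta_ge (exprn_ge0 _ r0) (delta_lbP hW p0 Hn)) _.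
apply: (@le_trans _ _ (dot_delta fs (onat W n) y p)).
  by apply: ereal_sup_ubound; exists y => //; exact: block_basis_refl.
by apply: ereal_sup_ubound; exists p => //; exact: equivalent_norm_sub.
Qed.

Lemma ddot_delta_le a Y y b : block_subspace e Y y ->
  (forall z v beta p q dl, block_system v beta p -> (forall i, z i = comb e (v i)) ->
    (forall n x, bd n x -> Y (comb z x)) -> equivalent_norm Y q -> 0 <= dl ->
    delta_lb fs a z q dl -> dl <= b) ->
  (ddot_delta fs a Y y <= b%:E)%E.
Proof.
move=> [eby YE] H; have [v [beta [p [Hv yE]]]] := block_basis_system eby.
apply: ge_ereal_sup => _ [q hq <-]; apply: ge_ereal_sup => _ [z ybz <-].
have [v' [beta' [p' [Hv' zE zY]]]] := block_basis_trans Hv yE ybz.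
apply: delta_le => dl dl0 Hdl; apply: (H _ _ _ _ _ _ Hv' zE _ hq dl0 Hdl).
by move=> n x /zY; rewrite YE.
Qed.

Lemma ddot_delta_onat n Y y : block_subspace e Y y -> (0 < n)%N ->
  ddot_delta fs (onat W n) Y y = (th ^+ n)%:E.
Proof.
move=> hY n0; have th0 := rt_th0 Hth.
apply/eqP; rewrite eq_le; apply/andP; split.
  apply: (ddot_delta_le hY) => z v beta p q dl Hv zE zY hq dl0 Hdl.
  exact: (delta_lb_le Hv zE zY hq n0 dl0 Hdl).
rewrite leNgt; apply/negP => lt.
(* The case mu = 0 makes the constant nonnegative, so it is not -oo; being below th^n, it is a real
   number. *)
have := ddot_delta_ge n hY (mu := 0); rewrite lexx ltr01 mul0r expr0n.
rewrite (_ : (n == 0%N) = false); last by apply/negbTE; rewrite -lt0n.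
move=> /(_ isT).
case E : (ddot_delta fs (onat W n) Y y) => [D| |]; last first.
- by rewrite leNgt ltNyr.
- by move: lt; rewrite E ltNge leey.
rewrite lee_fin => D0; move: lt; rewrite E lte_fin => Dlt.
pose rho := D / th ^+ n; have rho1 : rho < 1 by rewrite ltr_pdivrMr ?exprn_gt0// mul1r.
have rho0 : 0 <= rho by rewrite divr_ge0// exprn_ge0// ltW.
(* Bernoulli gives (1 - s)^n >= 1 - n s = (1 + rho) / 2 > rho, so mu = 1 - s contradicts the lower
   bound. *)
pose s := (1 - rho) / (2 * n%:R).
have n1 : 1 <= n%:R :> R by rewrite ler1n.
have ns : n%:R * s = (1 - rho) / 2.
  by rewrite /s; field; rewrite gt_eqF//; lra.
have s0 : 0 < s by rewrite divr_gt0 ?subr_gt0// mulr_gt0//; lra.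
have s1 : s <= (1 - rho) / 2 by rewrite -ns ler_peMl// ltW.
have muP : 0 <= 1 - s < 1 by apply/andP; split; lra.
have := ddot_delta_ge n hY muP; rewrite E lee_fin exprMn -ler_pdivlMr ?exprn_gt0// -/rho.
apply/negP; rewrite -ltNge; apply: lt_le_trans (bernoulli n (y := - s) _); last by lra.
by rewrite mulrN ns; lra.
Qed.

Lemma equivalent_norm_norm (Y : set X) : equivalent_norm Y (fun u : X => `|u|).
Proof.
split.
- by move=> u v _ _; exact: ler_normD.
- by move=> t u _; exact: normrZ.
- by exists 1, 1; split=> // u _; rewrite mul1r lexx.
Qed.

Lemma ddot_delta_norm_ge a Y y dl : block_subspace e Y y -> 0 <= dl ->
  delta_lb fs a y (fun u : X => `|u|) dl -> (dl%:E <= ddot_delta fs a Y y)%E.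
Proof.
move=> [eby YE] dl0 Hdl; apply: le_trans (delta_ge dl0 Hdl) _.
apply: (@le_trans _ _ (dot_delta fs a y (fun u : X => `|u|))).
  by apply: ereal_sup_ubound; exists y => //; exact: block_basis_refl.
apply: ereal_sup_ubound; exists (fun u : X => `|u|) => //; exact: equivalent_norm_norm.
Qed.

Lemma ddot_delta_0 Y y : block_subspace e Y y -> (1 <= ddot_delta fs (onat W 0) Y y)%E.
Proof.
move=> hY; apply: ddot_delta_norm_ge => //; apply: (delta_lbP hW (normr0 _)).
by apply: lower_est0 => [x x0|B x _] /=; [rewrite comb0// normr0|].
Qed.

Lemma ddot_delta_omega Y y : block_subspace e Y y -> ddot_delta fs (oomega W) Y y = 0%E.
Proof.
move=> hY; apply/eqP; rewrite eq_le; apply/andP; split.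
  apply: (ddot_delta_le hY) => z v beta p q dl Hv zE zY hq dl0 Hdl.
  exact: (delta_lb_omega Hv zE zY hq dl0 Hdl).
by apply: ddot_delta_norm_ge => // n c _ _; rewrite mul0r.
Qed.

Lemma spectral_index_eq a (Y : set X) (y : nat -> X) : (ddot_delta fs a Y y < 1)%E ->
  (forall b, (b < a)%O -> (1 <= ddot_delta fs b Y y)%E) -> spectral_index fs Y y = Some a.
Proof.
move=> Pa Pb; rewrite /spectral_index asboolT; last by exists a.
have [P1 P2] : (ddot_delta fs (omin [set a | (ddot_delta fs a Y y < 1)%E]) Y y < 1)%E /\
    forall b, (ddot_delta fs b Y y < 1)%E -> (omin [set a | (ddot_delta fs a Y y < 1)%E] <= b)%O.
  by apply: (ominP hW (P := [set a | (ddot_delta fs a Y y < 1)%E])); exists a.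
congr Some; apply/eqP; rewrite eq_le P2//= leNgt; apply/negP => /Pb.
by rewrite leNgt P1.
Qed.

(** Otherwise, from some index on, every value would be exceeded by a later one, and the sequence
    would return above a fixed positive value arbitrarily late, although it tends to 0. Applied to
    theta_n / th^n, this gives a small Phi valid for all q >= n. *)
Lemma tail_max (phi : nat -> R) eps : 0 < eps -> (forall n, 0 < phi n) ->
  (forall eps, 0 < eps -> exists M, forall n, (M <= n)%N -> phi n < eps) ->
  exists n, [/\ (0 < n)%N, phi n < eps & forall q, (n <= q)%N -> phi q <= phi n].
Proof.
move=> eps0 phi0 Hphi; have [m mP] := Hphi _ eps0.
apply: contrapT => Hn.
have next n : (m.+1 <= n)%N -> exists2 q, (n < q)%N & phi n < phi q.
  move=> mn; apply: contrapT => H; apply: Hn; exists n; split.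
  - exact: leq_ltn_trans mn.
  - exact: mP (ltnW mn).
  - move=> q; rewrite leq_eqVlt => /predU1P[->//|nq]; rewrite leNgt; apply/negP => ?.
    by apply: H; exists q.
have far k : exists2 n, (m.+1 + k <= n)%N & phi m.+1 <= phi n.
  elim: k => [|k [n nk pn]]; first by exists m.+1; rewrite ?addn0.
  have [q nq pq] := next n (leq_trans (leq_addr _ _) nk).
  by exists q; [rewrite addnS; exact: leq_ltn_trans nq|exact: le_trans pn (ltW pq)].
have [M MP] := Hphi _ (phi0 m.+1); have [n nM pn] := far M.
by have := MP n (leq_trans (leq_addl _ _) nM); rewrite ltNge pn.
Qed.

(** On a unit vector that is nice up to n the new norm is at most phi + 2 phi. On a normalized
    average |x|_n is at least the inverse of 3 phi th^(n-1), so the new norm is at least theta_n /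
    (3 phi th^(n-1)) = th / 3. The quotient of the two bounds is th / (9 phi), whence the 9. *)
Lemma distortable_of_small n lambda : (0 < n)%N ->
  (forall q, (n <= q)%N -> theta_ext theta q / th ^+ q <= theta_ext theta n / th ^+ n) ->
  lambda * (theta_ext theta n / th ^+ n) <= th / 9 -> distortable e lambda.
Proof.
move=> n0; set phi := theta_ext theta n / th ^+ n => Hphi small.
have th0 := rt_th0 Hth; have t0 := rt_gt0 Hth n.
have phi0 : 0 < phi by rewrite divr_gt0// exprn_gt0.
have HPhi q : (n <= q)%N -> theta_ext theta q <= phi * th ^+ q.
  by move=> /Hphi; rewrite ler_pdivrMr// exprn_gt0.
pose q x := phi * N x + theta_ext theta n * Nk N n x.
have [|||||| p hp pE] := @norm_extension _ _ e q phi (phi + 1).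
- exact: phi0.
- move=> B x y xB yB; rewrite /q.
  have := tn_add HN xB yB; have := Nk_add Hth HN n xB yB => H1 H2.
  have := ler_wpM2l (ltW phi0) H2; have := ler_wpM2l (ltW t0) H1.
  by rewrite !mulrDr; lra.
- move=> B t x xB; rewrite /q (Nk_scale Hth HN n t xB) (tn_scale HN t xB).
  by rewrite mulrDr mulrCA; congr (_ + _); rewrite mulrCA.
- move=> B x xB; rewrite lerDl mulr_ge0 ?(ltW t0)//; exact: (Nk_ge0 Hth HN n xB).
- move=> B x xB; rewrite mulrDl mul1r lerD2l; exact: (Nk_theta Hth HN n xB).
- by rewrite lerDl.
exists p => // Y y [eby YE]; have [v [beta [b [Hv yE]]]] := block_basis_system eby.
have [_ ps [c [C [c0 C0 hc]]]] := hp.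
have pn u : c * `|u| <= p u by have /andP[] := hc u Logic.I.
have lin_N m x : bd m x -> N (lin v beta x) = `|comb y x|.
  by move=> xm; rewrite /N (comb_lin Hv yE xm).
have py m x : bd m x -> p (comb y x) = q (lin v beta x).
  by move=> xm; rewrite -(comb_lin Hv yE xm) (pE _ _ (bd_lin Hv xm)).
have unit m x : bd m x -> 0 < N (lin v beta x) -> exists u, [/\ Y u, `|u| = 1
    & p u = q (lin v beta x) / N (lin v beta x)].
  move=> xm Nx; exists ((N (lin v beta x))^-1 *: comb y x); split.
  - rewrite YE; apply: subset_closure; exists (fun k => (N (lin v beta x))^-1 * x k).
      by apply: (bd_c00 (B := m)) => k /xm ->; rewrite mulr0.
    by rewrite (combZ y _ xm) (lin_N _ _ xm).
  - by rewrite normrZ -(lin_N _ _ xm) ger0_norm ?invr_ge0 ?ltW// mulVf ?gt_eqF.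
  - by rewrite ps// (py _ _ xm) ger0_norm ?invr_ge0 ?ltW// mulrC.
have Npos m x : bd m x -> (exists j, x j != 0) -> 0 < N (lin v beta x).
  move=> xm [j xj]; rewrite lt_neqAle (N_ge0 HN (bd_lin Hv xm)) andbT eq_sym; apply/eqP => N0.
  have [k] := lin_neq0 Hv xj.
  by rewrite (N_eq0 HN (bd_lin Hv xm) N0) eqxx.
have [m1 [x1 [xm1 _ x10 nx1]]] := nice_vector Hth HN Hv n 0.
have N1 := Npos _ _ xm1 x10.
have [u1 [Yu1 u11 pu1]] := unit _ _ xm1 N1.
have pu1le : p u1 <= 3 * phi.
  rewrite pu1 ler_pdivrMr// /q.
  have : Nk N n (lin v beta x1) <= 2 * N (lin v beta x1) / th ^+ n.
    apply: (Nk_le Hth HN (bd_lin Hv xm1)) => U h hU.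
    rewrite ler_pdivlMr ?exprn_gt0// mulrC; apply: nx1 => //; last exact: (bd_lin Hv xm1).
    by rewrite n0 leqnn.
  move=> /(ler_wpM2l (ltW t0)).
  have -> : theta_ext theta n * (2 * N (lin v beta x1) / th ^+ n) = 2 * (phi * N (lin v beta x1)).
    by rewrite /phi; field; rewrite expf_neq0// gt_eqF.
  rewrite -[3 * phi * _]mulrA.
  by move: (phi * N _) (theta_ext theta n * _) => r1 r2; lra.
have [m2 [x2 [h [xm2 _ hU sum1 ub]]]] := upper_estimate Hth HN Hv 0 n0 phi0 HPhi.
have Nk1 : 1 <= Nk N n (lin v beta x2).
  rewrite -sum1; pose B := maxn m2 (b m2).
  rewrite (@big_piece_le _ (N \o lin v beta) n _ h m2 B x2 _ hU xm2 (leq_maxl _ _)); last first.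
    by move=> z z0; apply: (N_zero HN) => k; rewrite /lin z0 mul0r.
  rewrite (eq_bigr (fun a : 'I_B => N ((lin v beta x2) \_
     (piece (beta @^-1` [set j | x2 j != 0]) (h \o beta) a)))); last first.
    by move=> a _; rewrite /= lin_piece.
  apply: (Nk_ub Hth HN); first exact: (lab_lin Hv hU).
  by apply: bd_le (bd_lin Hv xm2); exact: leq_maxr.
have x20 : exists j, x2 j != 0.
  apply: contrapT => H; move: Nk1; rewrite (Nk_zero Hth HN) ?ler10// => k.
  rewrite /lin; have -> : x2 (beta k) = 0 by apply/eqP/negPn/negP => ?; apply: H; exists (beta k).
  by rewrite mul0r.
have N2 := Npos _ _ xm2 x20.
have [u2 [Yu2 u21 pu2]] := unit _ _ xm2 N2.
have pu2ge : th / 3 <= p u2.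
  rewrite pu2 ler_pdivlMr//.
  apply: (@le_trans _ _ (theta_ext theta n)).
    apply: (@le_trans _ _ (th / 3 * (3 * phi * th ^+ n.-1))).
      by rewrite ler_wpM2l// divr_ge0// ltW.
    rewrite le_eqVlt; apply/predU1P; left.
    have -> : th / 3 * (3 * phi * th ^+ n.-1) = phi * (th * th ^+ n.-1) by field.
    by rewrite -exprS prednK// /phi divfK// expf_neq0// gt_eqF.
  rewrite /q; apply: ler_wpDl; first by rewrite mulr_ge0// ltW.
  by rewrite ler_peMr// ltW.
have pu10 : 0 < p u1 by apply: lt_le_trans (pn u1); rewrite u11 mulr1.
apply: (@le_trans _ _ (p u2 / p u1)%:E); last first.
  by apply: ereal_sup_ubound; exists (u2, u1).
rewrite lee_fin ler_pdivlMr//; apply: le_trans pu2ge.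
have [l0|l0] := leP 0 lambda.
  by apply: le_trans (ler_wpM2l l0 pu1le) _; move: small; lra.
by apply: (@le_trans _ _ 0); [rewrite nmulr_rle0// ltW|rewrite divr_ge0// ltW].
Qed.

Lemma arbitrarily_distortable_tsirelson :
  theta n / th ^+ n @[n --> \oo] --> (0 : R) -> arbitrarily_distortable e.
Proof.
move=> /cvgrPdist_lt H lambda l1; have th0 := rt_th0 Hth.
have [|||n [n0 small nmax]] := @tail_max (fun n => theta_ext theta n / th ^+ n) (th / 9 / lambda).
- by rewrite !divr_gt0//; lra.
- by move=> n; rewrite divr_gt0 ?exprn_gt0// (rt_gt0 Hth).
- move=> eps eps0; have [M _ MP] := H _ eps0; exists M.+1 => -[//|n] Mn.
  have := MP n.+1 (ltnW Mn); rewrite sub0r normrN /=.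
  exact: le_lt_trans (ler_norm _).
apply: (distortable_of_small n0 nmax); rewrite mulrC -ler_pdivlMr ?ltW//; lra.
Qed.

End Main.

Theorem theorem4p2 (d : Order.disp_t) (W : bOrderType d) (hW : is_omega1 W)
    (fs : W -> nat -> W) (hfs : fundamental_sequences fs)
    (R : realType) (theta : nat -> R) (htheta : regular_seq theta)
    (X : completeNormedModType R) (e : nat -> X)
    (hX : mixed_tsirelson fs theta e) :
  let th : R := root_limit theta in
  [/\ (forall (Y : set X) (y : nat -> X), block_subspace e Y y ->
         ddot_delta fs (onat W 1) Y y = th%:E)
      /\ (forall eps : R, 0 < eps ->
            exists2 p : X -> R, equivalent_norm [set: X] p
              & ((th - eps)%:E < delta fs (onat W 1) e p)%E),
      forall (Y : set X) (y : nat -> X), block_subspace e Y y ->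
        (forall n : nat, (0 < n)%N -> ddot_delta fs (onat W n) Y y = (th ^+ n)%:E)
        /\ ddot_delta fs (oomega W) Y y = 0%E,
      forall (Y : set X) (y : nat -> X), block_subspace e Y y ->
        (th = 1 -> spectral_index fs Y y = Some (oomega W))
        /\ (th < 1 -> spectral_index fs Y y = Some (onat W 1))
    & (theta n / th ^+ n @[n --> \oo] --> (0 : R)) ->
      arbitrarily_distortable e].
Proof.
move=> th; have Hth := regular_root htheta; have th0 : 0 < th := rt_th0 Hth.
have ddn Y y n (hY : block_subspace e Y y) := @ddot_delta_onat _ _ hW _ _ _ htheta _ _ hX n _ _ hY.
have ddw Y y (hY : block_subspace e Y y) := ddot_delta_omega hW hfs htheta hX hY.
have dd0 Y y (hY : block_subspace e Y y) := ddot_delta_0 hW fs hY.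
split; [split|..].
- by move=> Y y hY; rewrite ddn.
(* This choice gives mu th >= th - eps; the maximum with 0 covers eps > th. *)
- move=> eps eps0; pose mu := Num.max 0 (1 - eps / th).
  have ed : 0 < eps / th by rewrite divr_gt0.
  have muP : 0 <= mu < 1 by rewrite le_max lexx/= gt_max ltr01/=; lra.
  have [r [p [lt hp Hp]]] := good_norm hW htheta hX muP.
  exists p => //.
  have /andP[mu0 _] := muP.
  have r0 : 0 <= r by apply: le_trans (ltW lt); apply: mulr_ge0 => //; exact: ltW.
  have p0 : p 0 = 0 by exact: (equivalent_norm0 (u := 0) _ hp).
  apply: lt_le_trans (delta_ge r0 (delta_lbP hW p0 Hp)); rewrite lte_fin.
  apply: le_lt_trans lt; rewrite -/th.
  have : 1 - eps / th <= mu by rewrite le_max lexx orbT.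
  by move=> /(ler_wpM2r (ltW th0)); rewrite mulrBl mul1r divfK// gt_eqF.
- by move=> Y y hY; split=> [n n0|]; [exact: ddn|exact: ddw].
- move=> Y y hY; split=> tE.
    apply: (spectral_index_eq hW); first by rewrite ddw// lte_fin.
    move=> b bw; have [_ /(_ _ bw)[[|n] ->]] := oomegaP hW; first exact: dd0.
    by rewrite ddn// -/th tE expr1n.
  apply: (spectral_index_eq hW); first by rewrite ddn// lte_fin expr1.
  move=> b b1; suff -> : b = onat W 0 by exact: dd0.
  apply/eqP; rewrite -lex0 leNgt; apply/negP => /(osucc_le hW) b0.
  by have := lt_le_trans b1 b0; rewrite ltxx.
- exact: (arbitrarily_distortable_tsirelson hW htheta hX).
Qed.
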